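(* Let $p$ be a prime, let $K$ be either $\mathbb Z_{(p)}$ or $\mathbb Z_p$, let $F$ be a field containing $K$, and let $G=\langle a\rangle\cong C_{p^2}$. Put $\Phi(x)=x^{p-1}+\dots+x+1$. Consider: (1) for $i=0,1,\dots,p-2$, the $KC_{p^2}$-submodule $X_i$ of $KC_{p^2}$ generated by $(a-1)\Phi(a^p)$ and $\Phi(a)+(a-1)^{i+1}$, with the cocycle $T_i$ given by $T_i(a)=p^{-2}\Phi(a)\Phi(a^p)+X_i$; (2) if $p>2$, for $j=1,\dots,p-2$, the $KC_{p^2}$-submodule $U_j$ of the free module $(KC_{p^2})^{2}=\{(x_1,x_2):x_1,x_2\in KC_{p^2}\}$ generated by $\big((a-1)^{j+1}+\Phi(a),\,(a-1)^j\big)$ and $\Phi(a^p)(a-1,1)=\big((a-1)\Phi(a^p),\Phi(a^p)\big)$, with the cocycle $f_j$ given by $f_j(a)=p^{-2}\Phi(a)\Phi(a^p)(1,0)+U_j$. Then each of the groups $\mathrm{Crys}(C_{p^2};X_i;T_i)$ and $\mathrm{Crys}(C_{p^2};U_j;f_j)$ is a torsion-free indecomposable group, and every torsion-free indecomposable group $\mathrm{Crys}(C_{p^2};M;T)$ (with $M$ a faithful $KC_{p^2}$-lattice) is isomorphic to one of them. The number of these groups is $2p-3$.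
   Context: Standing conventions: $F$ a field containing $K$, $G$ a finite abelian group, $M$ a $KG$-module free of finite rank over $K$. Put $FM=F\otimes_K M$ and $\widehat M=FM/M$ (quotient of additive groups), a $KG$-module via $g(x+M)=gx+M$. A $1$-cocycle is a map $T:G\to\widehat M$ with $T(gh)=gT(h)+T(g)$; for cyclic $G=\langle a\rangle$ it is determined by $T(a)$ via $T(a^k)=(1+a+\dots+a^{k-1})T(a)$. $T$ is cohomologous to zero if there is $x\in FM$ with $T(g)=(g-1)x+M$ for all $g$. $\mathrm{Crys}(G;M;T)=\{(g,x): g\in G,\ x\in FM,\ x+M=T(g)\}$ with $(g,x)(g',x')=(gg',g'x+x')$. The group $\mathrm{Crys}(G;M;T)$ is called indecomposable if $M$ is an indecomposable $KG$-module and $T$ is not cohomologous to zero. Torsion-free means no nontrivial elements of finite order; isomorphism means isomorphism of abstract groups. *)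

(* Defs.v *)
From HB Require Import structures.
From mathcomp Require Import all_boot all_order all_algebra.
Import GRing.Theory.
Local Open Scope ring_scope.

(* K = Z_(p) inside F: F has characteristic 0 (so that Z_(p) embeds) and
   K is the set of images of fractions m/n with p not dividing n. *)
Definition is_Zploc_in (p : nat) (F : fieldType) (K : F -> Prop) : Prop :=
  (forall m : nat, (m.+1)%:R != 0 :> F) /\
  (forall f : F, K f <-> exists m n : int, ~~ (p%:Z %| n)%Z /\ f = m%:~R / n%:~R).

(* p-adic integers as compatible sequences (x_k mod p^k)_k. *)
Definition padic_valid (p : nat) (x : nat -> int) : Prop :=
  forall k, 0 <= x k /\ x k < (p ^ k)%:Z /\ (x k.+1 %% (p ^ k)%:Z)%Z = x k.
Definition padic_add (p : nat) (x y : nat -> int) : nat -> int :=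
  fun k => ((x k + y k) %% (p ^ k)%:Z)%Z.
Definition padic_mul (p : nat) (x y : nat -> int) : nat -> int :=
  fun k => ((x k * y k) %% (p ^ k)%:Z)%Z.
Definition padic_one (p : nat) : nat -> int := fun k => (1 %% (p ^ k)%:Z)%Z.

Definition is_Zp_in (p : nat) (F : fieldType) (K : F -> Prop) : Prop :=
  exists phi : (nat -> int) -> F,
    (forall x y, padic_valid p x -> padic_valid p y ->
       phi (padic_add p x y) = phi x + phi y) /\
    (forall x y, padic_valid p x -> padic_valid p y ->
       phi (padic_mul p x y) = phi x * phi y) /\
    phi (padic_one p) = 1 /\
    (forall x y, padic_valid p x -> padic_valid p y -> phi x = phi y ->
       forall k, x k = y k) /\
    (forall f : F, K f <-> exists x, padic_valid p x /\ phi x = f).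

(* Crystallographic data for a cyclic group G = <a> of order n.
   The ambient space is F^N (row vectors), a acts by v |-> v *m A,
   a^k acts by v |-> v *m A^+k, M is a K-lattice in F^N (given as a
   set), FM is its F-span (= F (x)_K M, F being flat over K), and the
   cocycle T is given by representatives T k in FM of T(a^k) in FM/M. *)
Record crys_data (F : fieldType) := CrysData {
  cd_N : nat;
  cd_A : 'M[F]_cd_N;
  cd_M : 'rV[F]_cd_N -> Prop;
  cd_T : nat -> 'rV[F]_cd_N }.
Arguments cd_N {F} c.
Arguments cd_A {F} c.
Arguments cd_M {F} c _.
Arguments cd_T {F} c _.

Definition fspan {F : fieldType} {N : nat} (M : 'rV[F]_N -> Prop) (v : 'rV[F]_N) : Prop :=
  exists s : seq (F * 'rV[F]_N), (forall e, e \in s -> M e.2) /\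
    v = \sum_(e <- s) e.1 *: e.2.

Definition crys_set {F : fieldType} (n : nat) (D : crys_data F) :
    nat * 'rV[F]_(cd_N D) -> Prop :=
  fun s => (s.1 < n)%N /\ fspan (cd_M D) s.2 /\ cd_M D (s.2 - cd_T D s.1).

Definition crys_mul {F : fieldType} (n : nat) (D : crys_data F)
    (s t : nat * 'rV[F]_(cd_N D)) : nat * 'rV[F]_(cd_N D) :=
  (((s.1 + t.1) %% n)%N, s.2 *m cd_A D ^+ t.1 + t.2).

Definition crys_one {F : fieldType} (D : crys_data F) : nat * 'rV[F]_(cd_N D) :=
  (0%N, 0).

Definition crys_torsion_free {F : fieldType} (n : nat) (D : crys_data F) : Prop :=
  forall s, crys_set n D s -> forall m : nat, (0 < m)%N ->
    iter m (crys_mul n D s) (crys_one D) = crys_one D -> s = crys_one D.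

Definition crys_iso {F : fieldType} (n : nat) (D1 D2 : crys_data F) : Prop :=
  exists f : nat * 'rV[F]_(cd_N D1) -> nat * 'rV[F]_(cd_N D2),
    (forall s, crys_set n D1 s -> crys_set n D2 (f s)) /\
    (forall s t, crys_set n D1 s -> crys_set n D1 t -> f s = f t -> s = t) /\
    (forall u, crys_set n D2 u -> exists s, crys_set n D1 s /\ f s = u) /\
    (forall s t, crys_set n D1 s -> crys_set n D1 t ->
       f (crys_mul n D1 s t) = crys_mul n D2 (f s) (f t)).

Definition KG_submodule {F : fieldType} (K : F -> Prop) {N : nat} (A : 'M[F]_N)
    (M P : 'rV[F]_N -> Prop) : Prop :=
  (forall v, P v -> M v) /\ P 0 /\
  (forall u v, P u -> P v -> P (u + v)) /\
  (forall c v, K c -> P v -> P (c *: v)) /\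
  (forall v, P v -> P (v *m A)).

Definition KG_indecomposable {F : fieldType} (K : F -> Prop) {N : nat} (A : 'M[F]_N)
    (M : 'rV[F]_N -> Prop) : Prop :=
  (exists v, M v /\ v != 0) /\
  forall P Q, KG_submodule K A M P -> KG_submodule K A M Q ->
    (forall v, M v -> exists u w, P u /\ Q w /\ v = u + w) ->
    (forall v, P v -> Q v -> v = 0) ->
    (forall v, P v -> v = 0) \/ (forall v, Q v -> v = 0).

Definition cohomologous_to_zero {F : fieldType} (n : nat) (D : crys_data F) : Prop :=
  exists x, fspan (cd_M D) x /\
    forall k, (k < n)%N -> cd_M D (cd_T D k - (x *m cd_A D ^+ k - x)).

Definition crys_indecomposable {F : fieldType} (K : F -> Prop) (n : nat)
    (D : crys_data F) : Prop :=
  KG_indecomposable K (cd_A D) (cd_M D) /\ ~ cohomologous_to_zero n D.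

Definition is_cocycle {F : fieldType} (n : nat) (D : crys_data F) : Prop :=
  (forall k, (k < n)%N -> fspan (cd_M D) (cd_T D k)) /\
  (forall k k', (k < n)%N -> (k' < n)%N ->
     cd_M D (cd_T D ((k + k') %% n)%N - (cd_T D k' *m cd_A D ^+ k + cd_T D k))).

Definition lattice_data {F : fieldType} (K : F -> Prop) {d : nat} (A : 'M[F]_d)
    (T : nat -> 'rV[F]_d) : crys_data F :=
  @CrysData F d A (fun v => forall j, K (v 0 j)) T.

(* cocycle on a cyclic group determined by T(a) = t + M:
   T(a^k) = (1 + a + ... + a^(k-1)) t *)
Definition cyc_cocycle {F : fieldType} {N : nat} (A : 'M[F]_N) (t : 'rV[F]_N) :
    nat -> 'rV[F]_N :=
  fun k => t *m (\sum_(l < k) A ^+ l).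

Definition KG_span {F : fieldType} (K : F -> Prop) (n : nat) {N : nat} (A : 'M[F]_N)
    (gens : seq 'rV[F]_N) (v : 'rV[F]_N) : Prop :=
  exists c : nat -> nat -> F, (forall g k, K (c g k)) /\
    v = \sum_(g < size gens) \sum_(k < n) c g k *: (gens`_g *m A ^+ k).

(* The group ring F C_{p^2}, identified with F^(p^2) via the basis
   1, a, ..., a^(p^2-1); polynomials in a are reduced mod a^(p^2) - 1. *)
Definition shiftmx (F : fieldType) (n : nat) : 'M[F]_n :=
  \matrix_(i < n, j < n) ((j : nat) == (i.+1 %% n)%N)%:R.

Definition gr_vec {F : fieldType} (p : nat) (q : {poly F}) : 'rV[F]_(p ^ 2) :=
  \row_(j < p ^ 2) (q %% ('X^(p ^ 2) - 1))`_j.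

Definition Phi (F : fieldType) (p : nat) : {poly F} := \sum_(i < p) 'X^i.
Definition Phip (F : fieldType) (p : nat) : {poly F} := Phi F p \Po 'X^p.

Definition norm_elt (F : fieldType) (p : nat) : 'rV[F]_(p ^ 2) :=
  (p%:R ^+ 2)^-1 *: gr_vec p (Phi F p * Phip F p).

Definition X_data {F : fieldType} (K : F -> Prop) (p i : nat) : crys_data F :=
  @CrysData F (p ^ 2) (shiftmx F (p ^ 2))
    (KG_span K (p ^ 2) (shiftmx F (p ^ 2))
       [:: gr_vec p (('X - 1) * Phip F p);
           gr_vec p (Phi F p + ('X - 1) ^+ i.+1)])
    (cyc_cocycle (shiftmx F (p ^ 2)) (norm_elt F p)).

Definition shift2 (F : fieldType) (p : nat) : 'M[F]_(p ^ 2 + p ^ 2) :=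
  block_mx (shiftmx F (p ^ 2)) 0 0 (shiftmx F (p ^ 2)).

Definition U_data {F : fieldType} (K : F -> Prop) (p j : nat) : crys_data F :=
  @CrysData F (p ^ 2 + p ^ 2) (shift2 F p)
    (KG_span K (p ^ 2) (shift2 F p)
       [:: row_mx (gr_vec p (('X - 1) ^+ j.+1 + Phi F p)) (gr_vec p (('X - 1) ^+ j));
           row_mx (gr_vec p (('X - 1) * Phip F p)) (gr_vec p (Phip F p))])
    (cyc_cocycle (shift2 F p) (row_mx (norm_elt F p) 0)).

(* Main.v *)
(** Write [lam = X - 1], [Phi1 = Phi(X)], [Phi2 = Phi(X^p)], with [X] acting as the
    generator [a]. A lattice [M] is an extension of [M / L], free over the discrete
    valuation ring [K[X]/Phi2], by [L = ker(a^p - 1)]; in turn [L] is a sum of copies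
    of [K], [K[X]/Phi1] and [K C_p]. Since [Phi2] acts as [p] on [L], the extension is
    given by a matrix over [F_p[lam]], which elimination brings to pivot form. The
    group is torsion-free iff the invariant vector [m = Phi1 Phi2 T(a)] lies outside
    [Phi2 M]. For indecomposable [M] this leaves only the lattices spanned by
    [e], [m], [t] with [Phi2 e = m + lam^n t], where [t] generates [K[X]/Phi1]
    (these are the [X_n]) or [K C_p] (the [U_n]). They are told apart by whether
    [lam^j Phi2 M] lies in [p M] and whether [Phi1 L] lies in [p M]. An abstract
    isomorphism maps lattice to lattice and twists the action by an automorphism of
    [C_{p^2}]; this preserves both conditions. *)
Require Import Defs.
From HB Require Import structures.
From mathcomp Require Import all_boot all_order all_algebra ring zify.
From mathcomp Require Import boolp.
Set Implicit Arguments.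
Unset Strict Implicit.
Unset Printing Implicit Defensive.
Import GRing.Theory.
Local Open Scope ring_scope.

(** Everything rests on one test. The ring [K[X]/(X^(p^2) - 1)] is local with maximal ideal
    generated by [p] and [X - 1], so an element is a unit exactly when its value at 1 is nonzero
    modulo [p]. Each elimination either divides by such a unit or extracts one more factor [X - 1];
    separation of [K] for the powers of [p] makes the second alternative end. [F] is arbitrary, so
    the cyclotomic factors may be reducible over it. Coprimality over [F] is therefore obtained from
    identities over [K] whose left-hand side is a power of [p]. The cocycle reduces to one vector.
    The norm [Phi1 Phi2] is [p^2] plus a multiple of [X - 1], and [p^2] is invertible in [F]; hence
    two values of [T(a)] with the same norm [m] differ by a coboundary. What has to be brought to
    normal form is the pair of [M] and [m], which is why [m] itself is a basis vector of the final
    presentation. *)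

Definition rdvd (R : comNzRingType) (d q : R) := exists s, q = d * s.

(** * Divisibility in a commutative ring *)

Section Dvd.
Variable R : comNzRingType.
Implicit Types d a b : R.

Lemma rdvdD d a b : rdvd d a -> rdvd d b -> rdvd d (a + b).
Proof. by move=> [s ->] [t ->]; exists (s + t); rewrite mulrDr. Qed.

Lemma rdvdMr d a b : rdvd d a -> rdvd d (a * b).
Proof. by move=> [s ->]; exists (s * b); rewrite mulrA. Qed.

Lemma rdvdMl d a b : rdvd d b -> rdvd d (a * b).
Proof. by rewrite mulrC; apply: rdvdMr. Qed.

Lemma rdvdN d a : rdvd d a -> rdvd d (- a).
Proof. by move=> [s ->]; exists (- s); rewrite mulrN. Qed.

Lemma rdvdB d a b : rdvd d a -> rdvd d b -> rdvd d (a - b).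
Proof. by move=> da db; apply: rdvdD => //; apply: rdvdN. Qed.

Lemma rdvd_refl d : rdvd d d.
Proof. by exists 1; rewrite mulr1. Qed.

Lemma rdvd0 d : rdvd d 0.
Proof. by exists 0; rewrite mulr0. Qed.

Lemma rdvd_trans b a c : rdvd a b -> rdvd b c -> rdvd a c.
Proof. by move=> [s ->] [t ->]; exists (s * t); rewrite mulrA. Qed.

End Dvd.

(** * The factors of [X^(p^2) - 1] over a commutative ring *)

Section CyclotomicFactors.
Variables (R : comNzRingType) (p : nat).

Definition lamR : {poly R} := 'X - 1.
Definition phi1R : {poly R} := \sum_(i < p) 'X^i.
Definition phi2R : {poly R} := phi1R \Po 'X^p.
Local Notation lam := lamR.
Local Notation phi1 := phi1R.
Local Notation phi2 := phi2R.

Lemma lam_phi1 : lam * phi1 = 'X^p - 1.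
Proof. by rewrite /lamR /phi1R -subrX1. Qed.

Lemma Xp1_phi2 : ('X^p - 1) * phi2 = 'X^(p ^ 2) - 1.
Proof.
have := congr1 (fun q => q \Po ('X^p : {poly R})) lam_phi1.
rewrite /lamR rmorphM /= !rmorphB /= rmorph1 comp_polyX comp_Xn_poly -exprM.
by rewrite mulnn.
Qed.

Lemma lam_monic : lam \is monic.
Proof. by rewrite /lamR monicXsubC. Qed.

Lemma horner_lam1 : lam.[1] = 0.
Proof. by rewrite /lamR !hornerE subrr. Qed.

Lemma horner_phi1 : phi1.[1] = p%:R.
Proof.
rewrite /phi1R horner_sum (eq_bigr (fun=> 1)) ?sumr_const ?card_ord //.
by move=> i _; rewrite hornerXn expr1n.
Qed.

Lemma horner_phi2 : phi2.[1] = p%:R.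
Proof. by rewrite /phi2R horner_comp hornerXn expr1n horner_phi1. Qed.

Lemma rdvd_lam (q : {poly R}) : q.[1] = 0 -> rdvd lam q.
Proof.
move=> q1; have /factor_theorem [s ->] : root q 1 by apply/rootP.
by exists s; rewrite mulrC /lamR.
Qed.

Lemma lam_rem (q : {poly R}) : exists s, q = (q.[1])%:P + lam * s.
Proof.
have [s Es] : rdvd lam (q - (q.[1])%:P) by apply: rdvd_lam; rewrite !hornerE subrr.
by exists s; rewrite -Es addrC subrK.
Qed.

Lemma phi1_lam : exists s, phi1 = p%:R + lam * s.
Proof. by have [s] := lam_rem phi1; rewrite horner_phi1 polyC_natr; exists s. Qed.

(** Substitution of ['X^p] in [phi1_lam]. It is the reason why [phi2] acts as [p] on vectors killed
    by ['X^p - 1]. *)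
Lemma phi2_Xp1 : exists s, phi2 = p%:R + ('X^p - 1) * s.
Proof.
have [s Es] := phi1_lam; exists (s \Po 'X^p).
rewrite {1}/phi2R Es rmorphD rmorphM /= rmorph_nat /lamR rmorphB /= rmorph1.
by rewrite comp_polyX.
Qed.

Lemma Xp1_dvd n m : (n %| m)%N -> rdvd ('X^n - 1 : {poly R}) ('X^m - 1).
Proof.
move=> /dvdnP [k ->]; rewrite mulnC exprM.
by exists (\sum_(i < k) ('X^n) ^+ i); rewrite -subrX1.
Qed.

Hypothesis p_gt0 : (0 < p)%N.

Lemma phi1E : phi1 = \poly_(i < p) 1.
Proof. by rewrite poly_def /phi1R; apply: eq_bigr => i _; rewrite scale1r. Qed.

Lemma size_phi1 : size phi1 = p.
Proof. by case: p p_gt0 phi1E => // n _ ->; rewrite size_poly_eq // oner_neq0. Qed.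

Lemma phi1_monic : phi1 \is monic.
Proof.
rewrite monicE /lead_coef size_phi1 phi1E coef_poly.
by case: p p_gt0 => //= n _; rewrite ltnSn.
Qed.

Lemma XnS1_monic n : (0 < n)%N -> ('X^n - 1 : {poly R}) \is monic.
Proof.
move=> n0; rewrite monicE lead_coefDl ?lead_coefXn //.
by rewrite size_polyN size_poly1 size_polyXn; case: n n0.
Qed.

Lemma size_XnS1 n : (0 < n)%N -> size ('X^n - 1 : {poly R}) = n.+1.
Proof.
move=> n0; rewrite size_polyDl ?size_polyXn //.
by rewrite size_polyN size_poly1; case: n n0.
Qed.

Lemma phi2_monic : phi2 \is monic.
Proof.
have := XnS1_monic (n := p ^ 2); rewrite expn_gt0 p_gt0 => /(_ isT).
by rewrite -Xp1_phi2 monicMl ?XnS1_monic.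
Qed.

Lemma size_phi2 : size phi2 = (p * p.-1).+1.
Proof.
have := size_XnS1 (n := p ^ 2); rewrite expn_gt0 p_gt0 => /(_ isT).
rewrite -Xp1_phi2 size_monicM ?XnS1_monic ?size_XnS1 ?monic_neq0 ?phi2_monic //=.
move/eqP; rewrite -mulnn => /eqP.
case: p p_gt0 => // n _ /=; rewrite mulnS addSn => [[]].
by rewrite addSnnS => /addnI.
Qed.

End CyclotomicFactors.

Lemma map_lam (R S : comNzRingType) (f : {rmorphism R -> S}) :
  map_poly f (lamR R) = lamR S.
Proof. by rewrite /lamR rmorphB /= rmorph1 map_polyX. Qed.

Lemma map_phi1 (R S : comNzRingType) (f : {rmorphism R -> S}) p :
  map_poly f (phi1R R p) = phi1R S p.
Proof.
by rewrite /phi1R rmorph_sum; apply: eq_bigr => i _; rewrite rmorphXn /= map_polyX.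
Qed.

Lemma map_phi2 (R S : comNzRingType) (f : {rmorphism R -> S}) p :
  map_poly f (phi2R R p) = phi2R S p.
Proof. by rewrite /phi2R map_comp_poly map_phi1 map_polyXn. Qed.

(** * Modulo [p] all factors become powers of [X - 1] *)

Section CyclotomicModP.
Variables (p : nat) (p_pr : prime p).

Lemma pchar_polyFp : p \in [pchar {poly 'F_p}].
Proof. by rewrite pchar_poly pchar_Fp. Qed.

Lemma Xpk_Fp k : 'X^(p ^ k) - 1 = lamR 'F_p ^+ (p ^ k).
Proof.
have pn : [pchar {poly 'F_p}].-nat (p ^ k)%N.
  by rewrite pnatX pnatE // pchar_polyFp.
by rewrite /lamR exprDn_pchar // exprNn_pchar // expr1n.
Qed.

Lemma lam_neq0 : lamR 'F_p != 0.
Proof. exact/monic_neq0/lam_monic. Qed.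

Lemma phi1_Fp : phi1R 'F_p p = lamR 'F_p ^+ p.-1.
Proof.
apply: (mulfI lam_neq0); rewrite lam_phi1 -exprS prednK ?prime_gt0 //.
exact: (Xpk_Fp 1).
Qed.

Lemma phi2_Fp : phi2R 'F_p p = lamR 'F_p ^+ (p * p.-1).
Proof.
have p0 := prime_gt0 p_pr.
apply: (mulfI (expf_neq0 p lam_neq0)).
have <- : 'X^p - 1 = lamR 'F_p ^+ p := Xpk_Fp 1.
rewrite Xp1_phi2 (Xpk_Fp 2) [RHS]mulrC.
have -> : 'X^p - 1 = lamR 'F_p ^+ p := Xpk_Fp 1.
by rewrite -exprD addnC -mulnS prednK // mulnn.
Qed.

End CyclotomicModP.

(** * The local group ring and its quotients by monic factors *)

Lemma map_resultant_coef (aR rR : nzRingType) (f : {rmorphism aR -> rR}) (p q : {poly aR}) :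
  f (lead_coef p) != 0 -> f (lead_coef q) != 0 ->
  f (resultant p q) = resultant (map_poly f p) (map_poly f q).
Proof.
move=> nz_fp nz_fq; rewrite /resultant /Sylvester_mx !size_map_poly_id0 //.
rewrite -det_map_mx /= map_col_mx; congr (\det (col_mx _ _));
  by apply: map_lin1_mx => v; rewrite map_poly_rV rmorphM /= map_rVpoly.
Qed.

(** What [Z_(p)] and [Z_p] have in common: a discrete valuation ring with uniformizer [p] and
    residue field [F_p]. The module theory below sees [K] only in this form. *)
Record residue_axioms (p : nat) (K : comNzRingType) (red : {rmorphism K -> 'F_p}) :
  Prop := ResidueAxioms {
  res_prime : prime p;
  res_ker : forall x, red x = 0 -> rdvd (p%:R : K) x;
  res_unit : forall x, red x != 0 -> exists y, x * y = 1;
  res_reg : forall x : K, p%:R * x = 0 -> x = 0;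
  res_sep : forall x : K, (forall s, rdvd (p%:R ^+ s : K) x) -> x = 0 }.

Section LocalRing.
Variables (p : nat) (K : comNzRingType) (red : {rmorphism K -> 'F_p}).
Hypothesis Kres : residue_axioms red.
Let p_pr : prime p := res_prime Kres.
Let p_gt0 : (0 < p)%N := prime_gt0 p_pr.
Local Notation P := {poly K}.

Local Notation lam := (lamR K).
Local Notation phi1 := (phi1R K p).
Local Notation phi2 := (phi2R K p).
Local Notation redP := (map_poly red).

(** The residue map of the local ring [K[X]/(X^(p^2) - 1)]; [unit1_inv] shows that this condition
    yields an inverse. *)
Definition unit_at1 (q : P) := red q.[1] != 0.
Local Notation unit1 := unit_at1.

Lemma redP_horner1 (q : P) : (redP q).[1] = red q.[1].
Proof. by rewrite -{1}(rmorph1 red) horner_map. Qed.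

Lemma red_p : red p%:R = 0.
Proof. by rewrite rmorph_nat pchar_Fp_0. Qed.

Lemma redP_p : redP p%:R = 0.
Proof. by rewrite -polyC_natr map_polyC /= red_p. Qed.

Lemma dvdp_redP (q : P) : redP q = 0 -> rdvd (p%:R : P) q.
Proof.
move=> q0; have /choice [y Hy] : forall i, exists y, q`_i = p%:R * y.
  by move=> i; apply: (res_ker Kres); rewrite -coef_map q0 coef0.
exists (\poly_(i < size q) y i); apply/polyP=> i.
rewrite -polyC_natr coefCM coef_poly; case: ltnP => [_|/leq_sizeP/(_ i (leqnn _)) ->].
  exact: Hy.
by rewrite mulr0.
Qed.

Lemma redP_eq (a b : P) : redP a = redP b -> exists z, a = b + p%:R * z.
Proof.
move=> ab; have [z Ez] : rdvd (p%:R : P) (a - b).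
  by apply: dvdp_redP; rewrite rmorphB /= ab subrr.
by exists z; rewrite -Ez addrC subrK.
Qed.

Lemma phi1_lamX : exists z, phi1 = lam ^+ p.-1 + p%:R * z.
Proof. by apply: redP_eq; rewrite map_phi1 phi1_Fp // rmorphXn /= map_lam. Qed.

Lemma Xp1_lamX : exists z, 'X^p - 1 = lam ^+ p + p%:R * z :> P.
Proof.
apply: redP_eq; rewrite rmorphB /= rmorph1 map_polyXn rmorphXn /= map_lam.
exact: (Xpk_Fp p_pr 1).
Qed.

Lemma phi2_lamX : exists z, phi2 = lam ^+ (p * p.-1) + p%:R * z.
Proof. by apply: redP_eq; rewrite map_phi2 phi2_Fp // rmorphXn /= map_lam. Qed.

Lemma nunit1 (q : P) : ~~ unit1 q -> exists c s, q = p%:R * c%:P + lam * s.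
Proof.
rewrite negbK => /eqP /(res_ker Kres) [c Ec]; have [s Es] := lam_rem q.
by exists c, s; rewrite {1}Es Ec rmorphM /= rmorph_nat.
Qed.

Lemma unit1_mod (a b c : P) : unit1 a -> unit1 (a + lam * b + p%:R * c).
Proof.
rewrite /unit_at1 !hornerD !hornerM horner_lam1 mul0r addr0 -polyC_natr hornerC.
by rewrite rmorphD rmorphM /= red_p mul0r addr0.
Qed.

Lemma unit1_lam (a b : P) : unit1 a -> unit1 (a + lam * b).
Proof. by move=> ua; rewrite -[_ + _]addr0 -(mulr0 p%:R); apply: unit1_mod. Qed.

Lemma unit11 : unit1 1.
Proof. by rewrite /unit_at1 hornerC rmorph1 oner_neq0. Qed.

(** The valuation at [X - 1] in [F_p[X]], lifted with an error in [p K[X]]. The bound [l] stops the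
    search, since the reduction of [q] may vanish. *)
Lemma lam_adic (l : nat) (q : P) :
  (exists v u z, [/\ (v < l)%N, unit1 u & q = lam ^+ v * u + p%:R * z]) \/
  (exists s z, q = lam ^+ l * s + p%:R * z).
Proof.
elim: l => [|l [[v [u [z [vl u1 Eq]]]]|[s [z Eq]]]].
- by right; exists q, 0; rewrite mulr0 addr0 mul1r.
- by left; exists v, u, z; split=> //; apply: ltnW.
- have [us|/nunit1 [c [s' Es]]] := boolP (unit1 s); first by left; exists l, s, z.
  right; exists s', (lam ^+ l * c%:P + z).
  by rewrite Eq Es exprS; ring.
Qed.

Lemma lam_adic_uniq n m (u s z : P) : unit1 u ->
  lam ^+ n * u = lam ^+ m * s + p%:R * z -> (m <= n)%N.
Proof.
move=> u1 E; rewrite leqNgt; apply/negP=> lt_nm.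
move/(congr1 redP): E; rewrite rmorphD !rmorphM /= !rmorphXn /= redP_p mul0r addr0.
rewrite map_lam -(subnKC lt_nm) exprD exprSr -!mulrA.
move/(mulfI (expf_neq0 _ (lam_neq0 _)))/(congr1 (horner^~ 1)).
rewrite redP_horner1 hornerM horner_lam1 mul0r.
by move/eqP; apply/negP.
Qed.

(** The resultant with [X^(p^2) - 1] is a unit of [K]: modulo [p] that polynomial is
    [(X - 1)^(p^2)], and [q] does not vanish at 1. The resultant lies in the ideal of the two
    polynomials, which yields the inverse. *)
Lemma unit1_inv (q : P) : unit1 q ->
  exists u r, u * q = 1 + ('X^(p ^ 2) - 1) * r.
Proof.
move=> uq; set f : P := 'X^(p ^ 2) - 1.
have N0 : (0 < p ^ 2)%N by rewrite expn_gt0 p_gt0.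
have f_mon : f \is monic by apply: XnS1_monic.
have f_sz : size f = (p ^ 2).+1 by apply: size_XnS1.
have Xf_mon : 'X^(size q) * f \is monic by rewrite monicMl // monicXn.
have Xf_sz : size ('X^(size q) * f) = (size q + (p ^ 2).+1)%N.
  by rewrite size_monicM ?monicXn ?monic_neq0 // size_polyXn f_sz.
(* Congruent to [q] modulo [f], but monic and nonconstant, so that the resultant commutes with
   reduction modulo [p]. *)
set g : P := q + 'X^(size q) * f.
have lt_q : (size q < size ('X^(size q) * f)%R)%N by rewrite Xf_sz addnS ltnS leq_addr.
have g_mon : g \is monic by rewrite monicE /g lead_coefDr // (monicP Xf_mon).
have g_sz : size g = (size q + (p ^ 2).+1)%N by rewrite /g addrC size_polyDl.
have res_neq0 : red (resultant f g) != 0.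
  rewrite map_resultant_coef ?(monicP f_mon) ?(monicP g_mon) ?rmorph1 ?oner_neq0 //.
  rewrite resultant_eq0 -leqNgt.
  have -> : redP f = lamR 'F_p ^+ (p ^ 2).
    by rewrite /f rmorphB /= rmorph1 map_polyXn Xpk_Fp.
  suff : coprimep (lamR 'F_p ^+ (p ^ 2)) (redP g) by move/eqP=> ->.
  apply: coprimep_expl; rewrite coprimep_sym /lamR -polyC1 coprimep_XsubC.
  rewrite /root redP_horner1 /g hornerD hornerM /f hornerD hornerN hornerXn hornerC.
  by rewrite hornerXn !expr1n subrr mulr0 addr0.
have [||uv _ Er] := @resultant_in_ideal _ f g; rewrite ?f_sz ?g_sz ?ltnS //.
  by rewrite addnS ltnS addn_gt0 N0 orbT.
have [y Ey] := res_unit Kres res_neq0.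
exists (y%:P * uv.2), (- (y%:P * uv.1 + y%:P * uv.2 * 'X^(size q))).
have : y%:P * (resultant f g)%:P = 1 by rewrite -rmorphM /= mulrC Ey.
by rewrite Er /g -/f => <-; ring.
Qed.

(** Remainders by a monic [f] are linear in [q], so every coefficient of the remainder is divisible
    by all powers of [p] and vanishes by [res_sep]. *)
Lemma red_sep_modp (f : P) : f \is monic ->
  forall q, (forall s, exists a b, q = p%:R ^+ s * a + f * b) -> rdvd f q.
Proof.
move=> f_mon q Hq; suff q0 : Pdiv.Ring.rmodp q f = 0.
  exists (Pdiv.Ring.rdivp q f); rewrite mulrC.
  by rewrite {1}(Pdiv.RingMonic.rdivp_eq f_mon q) q0 addr0.
apply/polyP=> i; rewrite coef0; apply: (res_sep Kres) => s.
have [a [b ->]] := Hq s.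
rewrite Pdiv.RingMonic.rmodpD // mulrC [f * b]mulrC Pdiv.RingMonic.rmodp_mull // addr0.
rewrite mulrC -polyC_natr -polyC_exp mul_polyC Pdiv.RingMonic.rmodpZ // coefZ.
by exists (Pdiv.Ring.rmodp a f)`_i.
Qed.

(* [pi] generates the maximal ideal of the discrete valuation ring [K[X]/(f)]. *)
Definition unif (f pi : P) :=
  (forall q, ~~ unit1 q -> exists a b, q = pi * a + f * b) /\
  (exists D a b, pi ^+ D = p%:R * a + f * b).

Lemma unif_sep (f pi : P) : f \is monic -> unif f pi ->
  forall q, (forall s, exists a b, q = pi ^+ s * a + f * b) -> rdvd f q.
Proof.
move=> f_mon [_ [D [a [b E]]]] q Hq; apply: red_sep_modp => // s.
(* [pi ^+ D] is a multiple of [p] modulo [f], so the exponent [D * s] yields a multiple of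
   [p ^ s]. *)
have [c [d ->]] := Hq (D * s)%N; rewrite exprM E.
have [e ->] : exists e, (p%:R * a + f * b) ^+ s = (p%:R * a) ^+ s + f * e.
  elim: s => [|s [e IH]]; first by exists 0; rewrite mulr0 addr0.
  by exists (b * (p%:R * a) ^+ s + e * (p%:R * a + f * b)); rewrite !exprS IH; ring.
by exists (a ^+ s * c), (e * c + d); rewrite exprMn; ring.
Qed.

(** [phi1] is [p] modulo [lam], so [p] is a multiple of [lam] modulo [phi1]; and [phi1] is
    [lam ^+ p.-1] modulo [p], so this power is a multiple of [p] modulo [phi1]. *)
Lemma unif_phi1 : unif phi1 lam.
Proof.
split=> [q /nunit1 [c [s ->]]|].
  have [r Er] := phi1_lam K p.
  by exists (s - r * c%:P), c%:P; rewrite Er; ring.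
have [z Ez] := phi1_lamX.
by exists p.-1, (- z), 1; rewrite Ez; ring.
Qed.

Lemma unif_phi2 : unif phi2 lam.
Proof.
split=> [q /nunit1 [c [s ->]]|].
  have [r Er] := phi2_Xp1 K p.
  by exists (s - phi1 * r * c%:P), c%:P; rewrite Er -lam_phi1; ring.
have [z Ez] := phi2_lamX.
by exists (p * p.-1)%N, (- z), 1; rewrite Ez; ring.
Qed.

Lemma unif_lam : unif lam p%:R.
Proof.
split=> [q /nunit1 [c [s ->]]|]; first by exists c%:P, s.
by exists 1%N, 1, 0; rewrite expr1; ring.
Qed.

Lemma unif_power (f pi : P) : unif f pi ->
  forall v, exists N a b, p%:R ^+ N = pi ^+ v * a + f * b.
Proof.
move=> [H _] v; have [|a [b E]] := H p%:R.
  by rewrite /unit_at1 -polyC_natr hornerC red_p eqxx.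
exists v; elim: v => [|v [c [d IH]]]; first by exists 1, 0; rewrite !expr0; ring.
exists (a * c), (b * p%:R ^+ v + pi * a * d).
by rewrite exprS IH {1}E; rewrite exprS; ring.
Qed.

Lemma unif_factor (f pi q : P) : f \is monic -> unif f pi ->
  ~ rdvd f q -> exists v u b, unit1 u /\ q = pi ^+ v * u + f * b.
Proof.
move=> f_mon Uf ndv; apply: contrapT => Hn; apply: ndv.
apply: (unif_sep f_mon Uf); elim=> [|s [a [b E]]].
  by exists q, 0; rewrite mulr0 addr0 mul1r.
have [ua|na] := boolP (unit1 a); first by case: Hn; exists s, a, b.
have [a' [b' Ea]] := Uf.1 _ na.
exists a', (pi ^+ s * b' + b); rewrite E Ea exprS; ring.
Qed.

(** In the valuation ring [K[X]/(f)] a nonzero [q] is a power of [pi] times a unit, hence divides a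
    power of [p]. In [F] that power is invertible, so [q] becomes prime to [f] even if [f] is
    reducible over [F]. *)
Lemma bezout_unif (f pi q : P) : f \is monic -> unif f pi -> rdvd f ('X^(p ^ 2) - 1) ->
  ~ rdvd f q -> exists N a b, p%:R ^+ N = q * a + f * b.
Proof.
move=> f_mon Uf [w Ew] /(unif_factor f_mon Uf) [v [u [b [uu Eq]]]].
have [u' [r Eu]] := unit1_inv uu; have [N [c [d E]]] := unif_power Uf v.
exists N, (u' * c), (d - b * u' * c - pi ^+ v * c * w * r).
rewrite E Eq.
have -> : (pi ^+ v * u + f * b) * (u' * c) = pi ^+ v * c * (u' * u) + f * b * u' * c.
  by ring.
by rewrite Eu Ew; ring.
Qed.

Lemma natr_reg (n : nat) (x : K) : n.+1%:R * x = 0 -> x = 0.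
Proof.
have [q nq ->] := pfactor_coprime p_pr (ltn0Sn n); set v := logn _ _.
have [y Ey] : exists y, q%:R * y = 1 :> K.
  apply: (res_unit Kres); rewrite rmorph_nat.
  by rewrite -(dvdn_pcharf (pchar_Fp p_pr)) -prime_coprime.
rewrite natrM natrX; set a := q%:R in Ey *; set b := _ ^+ v => E.
have {E} : b * x = 0.
  have -> : b * x = y * (a * b * x) by rewrite -[LHS]mul1r -Ey; ring.
  by rewrite E mulr0.
rewrite /b {a b Ey}.
elim: v => [|v IH]; first by rewrite mul1r.
by rewrite exprS -mulrA => /(res_reg Kres).
Qed.

End LocalRing.

(** * Linear combinations, and submodules as predicates *)

Section Dot.
Variables (R : comNzRingType) (V : lmodType R).

Definition dot n (q : 'I_n -> R) (e : 'I_n -> V) : V := \sum_i q i *: e i.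

Lemma dotD n (q r : 'I_n -> R) e : dot (fun i => q i + r i) e = dot q e + dot r e.
Proof. by rewrite /dot -big_split; apply: eq_bigr => i _; rewrite scalerDl. Qed.

Lemma dotN n (q : 'I_n -> R) e : dot (fun i => - q i) e = - dot q e.
Proof. by rewrite /dot -sumrN; apply: eq_bigr => i _; rewrite scaleNr. Qed.

Lemma dotB n (q r : 'I_n -> R) e : dot (fun i => q i - r i) e = dot q e - dot r e.
Proof. by rewrite dotD dotN. Qed.

Lemma dotZ n a (q : 'I_n -> R) e : dot (fun i => a * q i) e = a *: dot q e.
Proof. by rewrite /dot scaler_sumr; apply: eq_bigr => i _; rewrite scalerA. Qed.

Lemma dot0 n (e : 'I_n -> V) : dot (fun=> 0) e = 0.
Proof. by rewrite /dot big1 // => i _; rewrite scale0r. Qed.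

Lemma dotDr n (q : 'I_n -> R) e f : dot q (fun i => e i + f i) = dot q e + dot q f.
Proof. by rewrite /dot -big_split; apply: eq_bigr => i _; rewrite scalerDr. Qed.

Lemma dotZr n a (q : 'I_n -> R) e : dot q (fun i => a *: e i) = a *: dot q e.
Proof.
by rewrite /dot scaler_sumr; apply: eq_bigr => i _; rewrite !scalerA mulrC.
Qed.

Lemma dotNr n (q : 'I_n -> R) e : dot q (fun i => - e i) = - dot q e.
Proof. by rewrite /dot -sumrN; apply: eq_bigr => i _; rewrite scalerN. Qed.

Lemma dotBr n (q : 'I_n -> R) e f : dot q (fun i => e i - f i) = dot q e - dot q f.
Proof. by rewrite dotDr dotNr. Qed.

Definition delta n (j : 'I_n) (i : 'I_n) : R := (i == j)%:R.

Lemma dot_delta n (j : 'I_n) e : dot (delta j) e = e j.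
Proof.
rewrite /dot (bigD1 j) //= /delta eqxx scale1r big1 ?addr0 // => i /negPf ->.
by rewrite scale0r.
Qed.

Lemma dot_eq n (q r : 'I_n -> R) (e f : 'I_n -> V) :
  (forall i, q i *: e i = r i *: f i) -> dot q e = dot r f.
Proof. by move=> E; apply: eq_bigr. Qed.

Definition comb n m (q : 'I_n -> R) (C : 'I_n -> 'I_m -> R) (i : 'I_m) : R :=
  \sum_j q j * C j i.

Lemma dot_comb n m (q : 'I_n -> R) (C : 'I_n -> 'I_m -> R) e :
  dot (comb q C) e = dot q (fun j => dot (C j) e).
Proof.
rewrite /dot /comb; under eq_bigr do rewrite scaler_suml.
rewrite exchange_big; apply: eq_bigr => j _ /=.
by rewrite scaler_sumr; apply: eq_bigr => i _; rewrite scalerA.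
Qed.

Lemma dotD1 n (j : 'I_n) (q : 'I_n -> R) e :
  dot q e = q j *: e j + \sum_(i | i != j) q i *: e i.
Proof. by rewrite /dot (bigD1 j). Qed.

Lemma dot_split n m (q : 'I_(n + m) -> R) e :
  dot q e = dot (q \o lshift m) (e \o lshift m) + dot (q \o @rshift n m) (e \o @rshift n m).
Proof. exact: big_split_ord. Qed.

Lemma dot_lift n (j : 'I_n.+1) (q : 'I_n.+1 -> R) e :
  dot q e = q j *: e j + dot (q \o lift j) (e \o lift j).
Proof. by rewrite /dot (bigD1_ord j). Qed.

Definition submod (M : V -> Prop) :=
  M 0 /\ forall a u v, M u -> M v -> M (a *: u + v).

Section Submod.
Variables (M : V -> Prop) (HM : submod M).

Lemma submodD u v : M u -> M v -> M (u + v).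
Proof. by move=> Mu Mv; rewrite -[u]scale1r; apply: HM.2. Qed.

Lemma submodZ a u : M u -> M (a *: u).
Proof. by move=> Mu; rewrite -[_ *: _]addr0; apply: HM.2 => //; apply: HM.1. Qed.

Lemma submodN u : M u -> M (- u).
Proof. by rewrite -scaleN1r; apply: submodZ. Qed.

Lemma submodB u v : M u -> M v -> M (u - v).
Proof. by move=> Mu Mv; apply: submodD => //; apply: submodN. Qed.

Lemma submod_sum n (Q : pred 'I_n) (F : 'I_n -> V) :
  (forall i, Q i -> M (F i)) -> M (\sum_(i | Q i) F i).
Proof.
by move=> H; elim/big_rec: _ => [|i v Qi Mv]; [apply: HM.1|apply: submodD; auto].
Qed.

Lemma submod_dot n (q : 'I_n -> R) e : (forall i, M (e i)) -> M (dot q e).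
Proof. by move=> H; apply: submod_sum => i _; apply: submodZ. Qed.

End Submod.

Definition fingen (M : V -> Prop) := exists n (e : 'I_n -> V),
  (forall i, M (e i)) /\ forall v, M v -> exists q, v = dot q e.

Definition annih (M : V -> Prop) (h : R) (v : V) := M v /\ h *: v = 0.

Lemma submod_annih M h : submod M -> submod (annih M h).
Proof.
move=> HM; split; first by split; [apply: HM.1|rewrite scaler0].
move=> a u v [Mu hu] [Mv hv]; split; first exact: HM.2.
by rewrite scalerDr scalerA mulrC -scalerA hu hv scaler0 addr0.
Qed.

End Dot.

(** * Splitting off a free part over [K[X]/(f)] *)

Section Step.
Variables (p : nat) (K : comNzRingType) (red : {rmorphism K -> 'F_p}).
Hypothesis Kres : residue_axioms red.
Local Notation P := {poly K}.
Variable V : lmodType P.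

Lemma unit1_act (u : P) : unit_at1 red u -> exists u' : P, forall v : V,
  ('X^(p ^ 2) - 1 : P) *: v = 0 -> u' *: (u *: v) = v.
Proof.
move=> /(unit1_inv Kres) [u' [r E]]; exists u' => v v0.
by rewrite scalerA E scalerDl scale1r mulrC -scalerA v0 scaler0 addr0.
Qed.

(** A relation modulo the kernel of [h] with a unit coefficient removes a generator. If no such
    relation is left, all coefficients of any relation are nonunits; [pi] can be divided out again
    and again, and separation makes each coefficient a multiple of [f]. *)
Lemma free_step (M : V -> Prop) (h f pi : P) :
  submod M -> fingen M -> f \is monic -> unif red f pi ->
  (forall v, M v -> ('X^(p ^ 2) - 1 : P) *: v = 0) ->
  (forall v, M v -> h *: (f *: v) = 0) ->
  (forall v, M v -> h *: (pi *: v) = 0 -> h *: v = 0) ->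
  exists n (e : 'I_n -> V), [/\ forall i, M (e i),
    forall v, M v -> exists q z, v = dot q e + z /\ annih M h z,
    forall q, h *: dot q e = 0 -> forall i, rdvd f (q i) &
    fingen (annih M h)].
Proof.
move=> HM [n0 [g [Mg gen_g]]] f_mon Uf HX hf htf.
have HA := submod_annih h HM.
have [n [e [Me gen_e free_e]]] : exists n (e : 'I_n -> V), [/\ forall i, M (e i),
    forall v, M v -> exists q z, v = dot q e + z /\ annih M h z &
    forall q, h *: dot q e = 0 -> forall i, rdvd f (q i)].
  have : forall v, M v -> exists q z, v = dot q g + z /\ annih M h z.
    by move=> v /gen_g [q ->]; exists q, 0; rewrite addr0; split=> //; apply: HA.1.
  elim: n0 g Mg {gen_g} => [|n IH] g Mg gen_g.
    by exists 0%N, g; split=> // q _ [].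
  have [free|] := EM (forall q, h *: dot q g = 0 -> forall i, ~~ unit_at1 red (q i)).
    exists n.+1, g; split=> // q hq i; apply: (unif_sep Kres f_mon Uf) => s.
    suff : exists q', h *: dot q' g = 0 /\
        forall i, exists b, q i = pi ^+ s * q' i + f * b.
      by move=> [q' [_ /(_ i) [b E]]]; exists (q' i), b.
    elim: s => [|s [q' [hq' Eq']]].
      by exists q; split=> // j; exists 0; rewrite mulr0 addr0 mul1r.
    have /choice [r Hr] : forall j, exists ab, q' j = pi * ab.1 + f * ab.2.
      by move=> j; have [a [b E]] := Uf.1 _ (free _ hq' j); exists (a, b).
    exists (fun j => (r j).1); split.
      apply: htf; first exact: submod_dot.
      move: hq'; have -> : dot q' g = pi *: dot (fun j => (r j).1) g
                       + f *: dot (fun j => (r j).2) g.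
        by rewrite -!dotZ -dotD; apply: dot_eq => j; rewrite Hr.
      by rewrite scalerDr hf ?addr0 //; apply: submod_dot.
    move=> j; have [b Eb] := Eq' j; exists (pi ^+ s * (r j).2 + b).
    by rewrite Eb Hr exprS; ring.
  move=> /existsNP [q] /not_implyP [hq] /existsNP [j] /negP; rewrite negbK => uj.
  apply: (IH (g \o lift j)) => [i|v]; first exact: Mg.
  move=> /gen_g [c [z [-> Az]]]; have [u Hu] := unit1_act uj.
  exists (fun i => c (lift j i) - c j * u * q (lift j i)).
  exists ((c j * u) *: dot q g + z); split.
    have Ej : g j = u *: dot q g - u *: dot (q \o lift j) (g \o lift j).
      by rewrite (dot_lift j q) scalerDr addrK Hu // HX.
    rewrite (dot_lift j c) {1}Ej scalerBr !scalerA.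
    set A := dot q g; set B := dot (q \o _) _; set C := dot (c \o _) _.
    have -> : dot (fun i => c (lift j i) - c j * u * q (lift j i)) (g \o lift j)
            = C - (c j * u) *: B by rewrite dotB dotZ.
    by rewrite addrA; congr (_ + _); rewrite [RHS]addrC addrA addrAC.
  by apply: (HA.2) => //; split=> //; apply: submod_dot.
exists n, e; split=> //.
have /choice [c Hc] : forall i, exists qz, g i = dot qz.1 e + qz.2 /\ annih M h qz.2.
  by move=> i; have [q [z H]] := gen_e _ (Mg i); exists (q, z).
(* The kernel of [h] is generated by the [f *: e j] and the kernel parts of the original generators,
   because a combination of the [e j] in the kernel has coefficients divisible by [f]. *)
exists (n + n0)%N, (fun i => match split i with inl j => f *: e j | inr j => (c j).2 end).
split=> [i|v [Mv hv]].
  case: split => j; last by have [] := Hc j.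
  by split; [apply: submodZ|apply: hf].
have [q Eq] := gen_g _ Mv.
pose d i := comb q (fun j => (c j).1) i.
have Ev : v = dot d e + dot q (fun j => (c j).2).
  rewrite Eq /d dot_comb -dotDr; apply: dot_eq => i.
  by have [-> _] := Hc i.
have [|s Hs] := choice (free_e d _).
  move: hv; rewrite Ev scalerDr.
  have [_ ->] : annih M h (dot q (fun j => (c j).2)).
    by apply: submod_dot => // i; have [] := Hc i.
  by rewrite addr0.
exists (fun i => match split i with inl j => s j | inr j => q j end).
rewrite dot_split Ev; congr (_ + _); apply: dot_eq => i /=.
  by rewrite !(unsplitK (inl i)) scalerA mulrC -Hs.
by rewrite !(unsplitK (inr i)).
Qed.

End Step.

(** * Matrices over [K] acting on families of vectors *)

Section MatrixFamily.
Variables (K : comNzRingType) (V : lmodType {poly K}).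

Definition mxfam m n (A : 'M[K]_(m, n)) (e : 'I_n -> V) (i : 'I_m) : V :=
  dot (fun j => (A i j)%:P) e.

Lemma mxfamM m n l (A : 'M_(m, n)) (B : 'M_(n, l)) e i :
  mxfam A (mxfam B e) i = mxfam (A *m B) e i.
Proof.
rewrite /mxfam -dot_comb; apply: dot_eq => j; congr (_ *: _).
by rewrite mxE rmorph_sum; apply: eq_bigr => s _; rewrite rmorphM.
Qed.

Lemma mxfam_pid r m n (e : 'I_n -> V) (i : 'I_m) (j : 'I_n) : (i : nat) = j ->
  mxfam (pid_mx r) e i = if (i < r)%N then e j else 0.
Proof.
move=> ij; rewrite /mxfam (dotD1 j) mxE ij eqxx /= big1 => [|l lj].
  by case: ltnP; rewrite ?scale1r ?scale0r addr0.
rewrite mxE ij; case: eqP => [/val_inj jl|_]; last by rewrite scale0r.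
by rewrite jl eqxx in lj.
Qed.

Lemma mxfam1 n (e : 'I_n -> V) i : mxfam 1%:M e i = e i.
Proof. by rewrite -pid_mx_1 (mxfam_pid _ _ (erefl (i : nat))) ltn_ord. Qed.

Lemma mxfam_pid0 r m n (e : 'I_n -> V) (i : 'I_m) : (r <= i)%N ->
  mxfam (pid_mx r) e i = 0.
Proof.
move=> ri; rewrite /mxfam /dot big1 // => j _.
by rewrite mxE ltnNge ri andbF scale0r.
Qed.

Lemma mxfamD m n (A B : 'M_(m, n)) e i : mxfam (A + B) e i = mxfam A e i + mxfam B e i.
Proof.
by rewrite /mxfam -dotD; apply: dot_eq => j; rewrite mxE rmorphD.
Qed.

Lemma mxfamZ m n a (A : 'M_(m, n)) e i : mxfam (a *: A) e i = a%:P *: mxfam A e i.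
Proof.
by rewrite /mxfam -dotZ; apply: dot_eq => j; rewrite mxE rmorphM.
Qed.

Lemma eq_mxfam m n (A : 'M_(m, n)) e f i : (forall j, e j = f j) ->
  mxfam A e i = mxfam A f i.
Proof. by move=> E; apply: dot_eq => j; rewrite E. Qed.

Lemma dot_mxfam m n (A : 'M_(m, n)) q e :
  dot q (mxfam A e) = dot (fun j => \sum_i q i * (A i j)%:P) e.
Proof. by rewrite /mxfam -dot_comb. Qed.

End MatrixFamily.

(** * Gaussian elimination modulo [p] *)

Section Gauss.
Variables (p : nat) (K : comNzRingType) (red : {rmorphism K -> 'F_p}).
Hypothesis Kres : residue_axioms red.

Lemma lift_mx m n (A : 'M['F_p]_(m, n)) : exists B : 'M[K]_(m, n), map_mx red B = A.
Proof.
exists (\matrix_(i, j) (A i j : nat)%:R); apply/matrixP => i j; rewrite !mxE rmorph_nat.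
by rewrite natr_Zp.
Qed.

Lemma lift_unitmx n (A : 'M['F_p]_n) : A \in unitmx ->
  exists B B' : 'M[K]_n, [/\ map_mx red B = A, B *m B' = 1%:M & B' *m B = 1%:M].
Proof.
rewrite unitmxE unitfE => dA; have [B EB] := lift_mx A.
have [|y Ey] := res_unit Kres (x := \det B); first by rewrite -det_map_mx EB.
exists B, (y *: \adj B); split=> //.
  by rewrite -scalemxAr mul_mx_adj scale_scalar_mx mulrC Ey.
by rewrite -scalemxAl mul_adj_mx scale_scalar_mx mulrC Ey.
Qed.

(** The invertible matrices of the elimination over [F_p] lift to invertible matrices over [K],
    because a determinant with nonzero residue is a unit. *)
Lemma gauss_mod_p m n (X : 'M[K]_(m, n)) : exists r (C C' : 'M[K]_m) (E E' : 'M[K]_n) Z,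
  [/\ (r <= m)%N /\ (r <= n)%N, C *m C' = 1%:M /\ C' *m C = 1%:M,
      E *m E' = 1%:M /\ E' *m E = 1%:M & C' *m X *m E' = pid_mx r + p%:R *: Z].
Proof.
pose A := map_mx red X.
have [C [C' [EC CC' C'C]]] := lift_unitmx (col_ebase_unit A).
have [E [E' [EE EE' E'E]]] := lift_unitmx (row_ebase_unit A).
have E0 : map_mx red (C' *m X *m E' - pid_mx (\rank A)) = 0.
  rewrite map_mxB !map_mxM -/A -{1}(mulmx_ebase A) -EC -EE !mulmxA -map_mxM C'C.
  rewrite -!mulmxA -map_mxM EE' !map_mx1 mul1mx mulmx1.
  by rewrite map_pid_mx subrr.
have /choice [z Hz] : forall ij : 'I_m * 'I_n, exists z,
    (C' *m X *m E' - pid_mx (\rank A)) ij.1 ij.2 = p%:R * z.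
  by move=> [i j]; apply: (res_ker Kres); move/matrixP/(_ i j): E0; rewrite mxE [RHS]mxE.
exists (\rank A), C, C', E, E', (\matrix_(i, j) z (i, j)).
split=> //; first by rewrite rank_leq_row rank_leq_col.
set B := pid_mx _ in Hz *; apply/matrixP=> i j.
have /= := Hz (i, j); rewrite [LHS]mxE [X in _ + X]mxE => H.
by rewrite [RHS]mxE [X in _ + X]mxE [X in p%:R * X]mxE -H addrC subrK.
Qed.

(** Elimination modulo [p] is enough: [f] acts as [p] on the [k i], so the error [p%:R *: Z] is [f]
    applied to a combination of them, and a change of [e j] absorbs it. *)
Lemma gauss_family (V : lmodType {poly K}) m n (e w : 'I_m -> V) (k : 'I_n -> V)
    (f : {poly K}) (X : 'M[K]_(m, n)) :
  (forall j, f *: e j = mxfam X k j + w j) -> (forall i, f *: k i = p%:R *: k i) ->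
  exists r (C C' : 'M[K]_m) (E E' : 'M[K]_n) Z,
  [/\ (r <= m)%N /\ (r <= n)%N, C *m C' = 1%:M /\ C' *m C = 1%:M,
      E *m E' = 1%:M /\ E' *m E = 1%:M &
      forall j, f *: (mxfam C' e j - mxfam Z (mxfam E k) j) =
                mxfam (pid_mx r) (mxfam E k) j + mxfam C' w j].
Proof.
move=> He Hk; have [r [C [C' [E [E' [Z [Hr HC HE HX]]]]]]] := gauss_mod_p X.
exists r, C, C', E, E', Z; split=> // j.
have fmx l l' (A : 'M_(l, l')) g i : f *: mxfam A g i = mxfam A (fun i => f *: g i) i.
  by rewrite /mxfam dotZr.
rewrite scalerBr fmx (eq_mxfam _ _ He) /mxfam dotDr -/(mxfam _ _ _).
rewrite -/(mxfam C' w j) mxfamM addrAC; congr (_ + _).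
have -> : mxfam (C' *m X) k j = mxfam (pid_mx r + p%:R *: Z) (mxfam E k) j.
  by rewrite mxfamM -HX -mulmxA HE.2 mulmx1.
rewrite mxfamD mxfamZ fmx.
have -> : mxfam Z (fun i => f *: mxfam E k i) j = p%:R *: mxfam Z (mxfam E k) j.
  rewrite -dotZr; apply: dot_eq => i; rewrite fmx; congr (_ *: _).
  by rewrite -dotZr; apply: dot_eq => l; rewrite Hk.
by rewrite polyC_natr addrK.
Qed.

End Gauss.

Lemma scale_rdvd (R : comNzRingType) (V : lmodType R) (d q : R) (v : V) :
  rdvd d q -> d *: v = 0 -> q *: v = 0.
Proof. by move=> [s ->] v0; rewrite mulrC -scalerA v0 scaler0. Qed.

Lemma mx_cancel (K : comNzRingType) m n (E : 'M[K]_(m, n)) (E' : 'M[K]_(n, m))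
    (d : 'I_m -> {poly K}) i : E *m E' = 1%:M ->
  \sum_j (\sum_l d l * (E l j)%:P) * (E' j i)%:P = d i.
Proof.
move=> EE'; under eq_bigr do rewrite mulr_suml; rewrite exchange_big /=.
rewrite (bigD1 i) //= [X in _ + X]big1 ?addr0 => [|l li].
  under eq_bigr do rewrite -mulrA -rmorphM /=; rewrite -mulr_sumr -rmorph_sum.
  by move/matrixP/(_ i i): EE'; rewrite !mxE eqxx => ->; rewrite mulr1.
under eq_bigr do rewrite -mulrA -rmorphM /=; rewrite -mulr_sumr -rmorph_sum.
by move/matrixP/(_ l i): EE'; rewrite !mxE (negPf li) => ->; rewrite mulr0.
Qed.

Lemma mx_rdvd (K : comNzRingType) m n (E : 'M[K]_(m, n)) (E' : 'M[K]_(n, m))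
    (d : 'I_m -> {poly K}) f : E *m E' = 1%:M ->
  (forall j, rdvd f (\sum_l d l * (E l j)%:P)) -> forall i, rdvd f (d i).
Proof.
move=> EE' Hd i; rewrite -(mx_cancel d i EE').
elim/big_ind: _ => [|x y|j _]; [exact: rdvd0|exact: rdvdD|exact: rdvdMr].
Qed.

(** * The layers [M / L], [L / L0] and [L0] of a lattice *)

Section Lattice.
Variables (p : nat) (K : comNzRingType) (red : {rmorphism K -> 'F_p}).
Hypothesis Kres : residue_axioms red.
Let p_pr : prime p := res_prime Kres.
Let p_gt0 : (0 < p)%N := prime_gt0 p_pr.
Local Notation P := {poly K}.
Local Notation lam := (lamR K).
Local Notation phi1 := (phi1R K p).
Local Notation phi2 := (phi2R K p).
Local Notation Xp1 := ('X^p - 1 : P).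
Local Notation XN1 := ('X^(p ^ 2) - 1 : P).
Local Notation unit1 := (unit_at1 red).

Variable V : lmodType P.
Hypothesis tf : forall v : V, (p%:R : P) *: v = 0 -> v = 0.

Lemma phi2_Xp1_act (v : V) : Xp1 *: v = 0 -> phi2 *: v = p%:R *: v.
Proof.
move=> v0; have [s ->] := phi2_Xp1 K p.
by rewrite scalerDl mulrC -scalerA v0 scaler0 addr0.
Qed.

Lemma phi1_lam_act (v : V) : lam *: v = 0 -> phi1 *: v = p%:R *: v.
Proof.
move=> v0; have [s ->] := phi1_lam K p.
by rewrite scalerDl mulrC -scalerA v0 scaler0 addr0.
Qed.

Lemma lam_act_const (q : P) (v : V) : lam *: v = 0 -> q *: v = (q.[1])%:P *: v.
Proof.
move=> v0; have [s {1}->] := lam_rem q.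
by rewrite scalerDl mulrC -scalerA v0 scaler0 addr0.
Qed.

Lemma lam_Xp1_act (v : V) : lam *: v = 0 -> Xp1 *: v = 0.
Proof. by move=> v0; rewrite -lam_phi1 mulrC -scalerA v0 scaler0. Qed.

(** Put [w = Xp1 *: v]. If [lam *: w = 0], then [phi2] acts on [w] as [p]; but [phi2 *: w] is
    [XN1 *: v = 0], and [p] has no torsion. *)
Lemma lam_Xp1_tf (v : V) : XN1 *: v = 0 -> Xp1 *: (lam *: v) = 0 -> Xp1 *: v = 0.
Proof.
move=> vN; rewrite scalerA mulrC -scalerA => E; apply: tf.
by rewrite -(phi2_Xp1_act (lam_Xp1_act E)) scalerA mulrC Xp1_phi2.
Qed.

Lemma lam_lam_tf (v : V) : Xp1 *: v = 0 -> lam *: (lam *: v) = 0 -> lam *: v = 0.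
Proof.
move=> vL E; apply: tf.
by rewrite -(phi1_lam_act E) scalerA mulrC lam_phi1.
Qed.

Variable M : V -> Prop.
Hypotheses (HM : submod M) (fgM : fingen M).
Hypothesis MN : forall v, M v -> XN1 *: v = 0.
Local Notation L := (annih M Xp1).
Local Notation L0 := (annih M lam).

Let HL : submod L := submod_annih Xp1 HM.
Let HL0 : submod L0 := submod_annih lam HM.

Lemma basis_M : exists n (e : 'I_n -> V), [/\ forall i, M (e i),
    forall v, M v -> exists q z, v = dot q e + z /\ L z,
    forall q, Xp1 *: dot q e = 0 -> forall i, rdvd phi2 (q i) & fingen L].
Proof.
apply: (free_step Kres HM fgM (phi2_monic K p_gt0) (unif_phi2 Kres)) => // v Mv.
  by rewrite scalerA Xp1_phi2 MN.
exact: lam_Xp1_tf (MN Mv).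
Qed.

Lemma basis_L : exists n (e : 'I_n -> V), [/\ forall i, L (e i),
    forall v, L v -> exists q z, v = dot q e + z /\ L0 z,
    forall q, lam *: dot q e = 0 -> forall i, rdvd phi1 (q i) & fingen L0].
Proof.
have [_ [_ [_ _ _ fgL]]] := basis_M.
have LL0 v : annih L lam v <-> L0 v.
  split=> [[[Mv _] v0]|[Mv v0]] //; split=> //; split=> //; exact: lam_Xp1_act.
have [n [e [Le gen free [m [g [Lg fg]]]]]] :=
  free_step Kres (h := lam) HL fgL (phi1_monic K p_gt0) (unif_phi1 Kres)
   (fun v Lv => MN Lv.1)
   (fun v (Lv : L v) => etrans (scalerA _ _ _) (etrans (congr1 ( *:%R^~ v) (lam_phi1 K p)) Lv.2))
   (fun v (Lv : L v) E => lam_lam_tf Lv.2 E).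
exists n, e; split=> // [v /gen [q [z [-> /LL0 Lz]]]|]; first by exists q, z.
by exists m, g; split=> [i|v /LL0 /fg //]; apply/LL0.
Qed.

Lemma basis_L0 : exists n (e : 'I_n -> V), [/\ forall i, L0 (e i),
    forall v, L0 v -> exists c : 'I_n -> K, v = dot (fun i => (c i)%:P) e &
    forall q, dot q e = 0 -> forall i, rdvd lam (q i)].
Proof.
have [_ [_ [_ _ _ fgL0]]] := basis_L.
have [v Lv|v Lv|v Lv|n [e [Le gen free _]]] :=
  @free_step _ _ _ Kres _ L0 1 lam p%:R HL0 fgL0 (lam_monic K) (unif_lam Kres).
- exact: MN Lv.1.
- by rewrite Lv.2 scaler0.
- by rewrite !scale1r => /tf.
exists n, e; split=> // [v /gen [q [z [-> [_]]]]|q q0].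
  rewrite scale1r => ->; exists (fun i => (q i).[1]); rewrite addr0.
  by apply: dot_eq => i; apply: lam_act_const; have [] := Le i.
by apply: free; rewrite q0 scaler0.
Qed.

Definition ann_poly (ty : bool) : P := if ty then Xp1 else phi1.
Local Notation gT := ann_poly.

(** The vectors [phi1 *: r j] lie in [L0], and elimination turns this map into [pid_mx m]. A [t j]
    with [j < m] generates a copy of [K C_p], which absorbs [k1 j = phi1 *: t j]; the other [t j]
    generate copies of [K[X]/phi1], and the remaining [k1 j] copies of [K]. *)
Lemma nf_L : exists a b (k : 'I_a -> V) (t : 'I_b -> V) (ty : 'I_b -> bool),
  [/\ forall i, L0 (k i), forall i, M (t i) /\ gT (ty i) *: t i = 0,
      forall v, L v -> exists c y, v = dot c k + dot y t &
      forall c y, dot c k + dot y t = 0 ->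
        (forall i, rdvd lam (c i)) /\ (forall i, rdvd (gT (ty i)) (y i))].
Proof.
have [n [r [Lr gen_r free_r _]]] := basis_L.
have [a [k [L0k gen_k free_k]]] := basis_L0.
have phi_r j : L0 (phi1 *: r j).
  have [Mr rL] := Lr j; split; first exact: submodZ.
  by rewrite scalerA lam_phi1.
have /choice [c Hc] := fun j => gen_k _ (phi_r j).
pose X := \matrix_(j, i) c j i.
have HX j : phi1 *: r j = mxfam X k j + 0.
  by rewrite addr0 Hc; apply: dot_eq => i; rewrite mxE.
have Hk i : phi1 *: k i = p%:R *: k i by apply: phi1_lam_act; have [] := L0k i.
have [m [C [C' [E [E' [Z [[mn ma] [CC' C'C] [EE' E'E] HG]]]]]]] := gauss_family Kres HX Hk.
set k1 := mxfam E k in HG; set t := fun j => mxfam C' r j - mxfam Z k1 j.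
have {HG} Ht j : phi1 *: t j = mxfam (pid_mx m) k1 j.
  by rewrite HG /mxfam (_ : dot _ (fun=> 0) = 0) ?addr0 // /dot big1 // => i _; rewrite scaler0.
have L0k1 i : L0 (k1 i) by apply: submod_dot.
have Lt i : L (t i).
  apply: submodB => //; apply: submod_dot => // j.
  have [Mk1 k10] := L0k1 j; split=> //; exact: lam_Xp1_act.
have gen_k1 v : L0 v -> exists d, v = dot d k1.
  move=> /gen_k [d ->]; exists (fun i => \sum_j (d j)%:P * (E' j i)%:P).
  rewrite -dot_mxfam; apply: dot_eq => i; congr (_ *: _).
  by rewrite mxfamM E'E mxfam1.
have free_k1 d : dot d k1 = 0 -> forall i, rdvd lam (d i).
  rewrite dot_mxfam => /free_k Hd i.
  exact: (mx_rdvd EE' Hd).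
have gen_t v : L v -> exists y d, v = dot y t + dot d k1.
  move=> /gen_r [q [z [-> /gen_k1 [d ->]]]].
  pose y i := \sum_j q j * (C j i)%:P.
  exists y, (fun i => d i + \sum_j y j * (Z j i)%:P).
  rewrite /t dotBr dotD -(dot_mxfam Z y k1).
  rewrite [_ + dot y (mxfam Z k1)]addrC addrA subrK.
  congr (_ + _); rewrite -(dot_mxfam C q); apply: dot_eq => j; congr (_ *: _).
  by rewrite mxfamM CC' mxfam1.
have free_t y : lam *: dot y t = 0 -> forall i, rdvd phi1 (y i).
  rewrite /t dotBr scalerBr (_ : lam *: dot y (mxfam Z k1) = 0) ?subr0; last first.
    by rewrite -dotZr /dot big1 // => i _; rewrite (submod_dot HL0 _ L0k1).2 scaler0.
  rewrite dot_mxfam => /free_r Hd i.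
  exact: (mx_rdvd C'C Hd).
clearbody t k1; have [n' En] : exists n', n = (m + n')%N by exists (n - m)%N; rewrite subnKC.
have [a' Ea] : exists a', a = (m + a')%N by exists (a - m)%N; rewrite subnKC.
clear -tf HM MN Ea En Ht L0k1 Lt gen_k1 free_k1 gen_t free_t p_gt0; subst n a.
have HtL i : phi1 *: t (lshift n' i) = k1 (lshift a' i).
  by rewrite Ht (mxfam_pid _ _ (j := lshift a' i)) //= ltn_ord.
have HtR i : phi1 *: t (rshift m i) = 0 by rewrite Ht mxfam_pid0 //= leq_addr.
exists a', (m + n')%N, (k1 \o @rshift m a'), t, (fun i => (i < m)%N).
split=> [i|i|v|c y].
- exact: L0k1.
- have [Mt tL] := Lt i; split=> //; rewrite /ann_poly; case: ltnP => // mi.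
  by case: (split_ordP i) mi => j -> /=; rewrite ?HtR // leqNgt ltn_ord.
- move=> /gen_t [y [d ->]]; rewrite (dot_split d).
  exists (d \o @rshift m a').
  exists (fun i => y i + match split i with inl j => d (lshift a' j) * phi1 | _ => 0 end).
  rewrite dotD [RHS]addrC addrA; congr (_ + _ + _).
  rewrite [RHS]dot_split [X in _ = _ + X](_ : _ = 0) ?addr0.
    by apply: dot_eq => i /=; rewrite (unsplitK (inl i)) -scalerA HtL.
  by rewrite /dot big1 // => i _ /=; rewrite (unsplitK (inr i)) scale0r.
move=> E; have /choice [s Hs] : forall i, rdvd phi1 (y i).
  apply: free_t; have -> : dot y t = - dot c (k1 \o @rshift m a').
    by apply/eqP; rewrite -addr_eq0 addrC E.
  by rewrite scalerN (submod_dot (submod_annih lam HM) c _).2 ?oppr0 // => i; apply: L0k1.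
(* Once [phi1] divides every [y i], the terms [y i *: t i] are multiples of vectors [k1 i], and the
   freeness of these decides. *)
pose d i := match split i with inl j => s (lshift n' j) | inr j => c j end.
have /free_k1 Hd : dot d k1 = 0.
  rewrite -E (dot_split d) addrC; congr (_ + _).
    by apply: dot_eq => i /=; rewrite /d (unsplitK (inr i)).
  rewrite [RHS]dot_split [X in _ = _ + X](_ : _ = 0) ?addr0.
    apply: dot_eq => i /=; rewrite /d (unsplitK (inl i)) -HtL scalerA.
    by rewrite Hs mulrC.
  by rewrite /dot big1 // => i _ /=; rewrite Hs mulrC -scalerA HtR scaler0.
split=> i; first by have := Hd (rshift m i); rewrite /d (unsplitK (inr i)).
rewrite Hs /ann_poly; case: ltnP => [im|_]; last exact: rdvdMr (rdvd_refl _).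
have [s' Es] : rdvd lam (s i).
  have := Hd (lshift a' (Ordinal im)); rewrite /d (unsplitK (inl _)).
  by rewrite (_ : lshift n' _ = i) //; apply: val_inj.
by exists s'; rewrite Es -lam_phi1; ring.
Qed.

End Lattice.

(* The lattice spanned by [e], [k], [t]: the case [ty = false] is that of [X_n],
   where [t] generates [K[X]/Phi(X)]; [ty = true] is that of [U_n], where [t]
   generates the group ring of [C_p]. *)
Definition pres (p : nat) (K : comNzRingType) (V : lmodType {poly K}) (M : V -> Prop)
    (ty : bool) (n : nat) (e k t : V) : Prop :=
  [/\ [/\ M e, M k & M t],
      [/\ phi2R K p *: e = k + lamR K ^+ n *: t, lamR K *: k = 0 & ann_poly p K ty *: t = 0],
      forall v, M v -> exists q c y, v = q *: e + c *: k + y *: t,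
      forall q, ('X^p - 1 : {poly K}) *: (q *: e) = 0 -> rdvd (phi2R K p) q &
      forall c y, c *: k + y *: t = 0 -> rdvd (lamR K) c /\ rdvd (ann_poly p K ty) y].

(** * Reduction of an indecomposable lattice to a single pivot *)

Section Indecomposable.
Variables (p : nat) (K : comNzRingType) (red : {rmorphism K -> 'F_p}).
Hypothesis Kres : residue_axioms red.
Let p_pr : prime p := res_prime Kres.
Let p_gt0 : (0 < p)%N := prime_gt0 p_pr.
Local Notation P := {poly K}.
Local Notation lam := (lamR K).
Local Notation phi1 := (phi1R K p).
Local Notation phi2 := (phi2R K p).
Local Notation Xp1 := ('X^p - 1 : P).
Local Notation XN1 := ('X^(p ^ 2) - 1 : P).
Local Notation unit1 := (unit_at1 red).
Local Notation gT := (ann_poly p K).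

Lemma nunit1_phi2 : ~ rdvd phi2 1.
Proof.
move=> [s /(congr1 (horner^~ 1))]; rewrite hornerM horner_phi2 hornerC => E.
have := oner_neq0 'F_p; rewrite -(rmorph1 red) E rmorphM /= (red_p Kres) mul0r.
by rewrite eqxx.
Qed.

Lemma red_gT ty : red (gT ty).[1] = 0.
Proof.
case: ty; rewrite /ann_poly; last by rewrite horner_phi1 (red_p Kres).
by rewrite hornerD hornerN hornerXn hornerC expr1n subrr rmorph0.
Qed.

Lemma nunit1_gT ty q : rdvd (gT ty) q -> ~~ unit1 q.
Proof. by move=> [s ->]; rewrite /unit_at1 hornerM rmorphM /= red_gT mul0r eqxx. Qed.

Lemma gT_Xp1 ty : rdvd (gT ty) Xp1.
Proof.
by case: ty; [exact: rdvd_refl|exists lam; rewrite mulrC lam_phi1].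
Qed.

(** The degree of [gT ty], which modulo [p] is the power of [lam] with this exponent: coefficients
    of [t] matter only below it. *)
Definition len_ty (ty : bool) : nat := if ty then p else p.-1.
Local Notation lenT := len_ty.

Lemma gT_lamX ty : exists z, gT ty = lam ^+ lenT ty + p%:R * z.
Proof. by case: ty; [exact: Xp1_lamX Kres|exact: phi1_lamX Kres]. Qed.

Variable V : lmodType P.
Hypothesis tf : forall v : V, (p%:R : P) *: v = 0 -> v = 0.
Variable M : V -> Prop.
Hypotheses (HM : submod M) (fgM : fingen M).
Hypothesis MN : forall v, M v -> XN1 *: v = 0.
Hypothesis Mfaith : exists v, M v /\ Xp1 *: v <> 0.
Hypothesis Mindec : forall Q1 Q2 : V -> Prop, submod Q1 -> submod Q2 ->
  (forall v, Q1 v -> M v) -> (forall v, Q2 v -> M v) ->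
  (forall v, M v -> exists u w, [/\ Q1 u, Q2 w & v = u + w]) ->
  (forall v, Q1 v -> Q2 v -> v = 0) ->
  (forall v, Q1 v -> v = 0) \/ (forall v, Q2 v -> v = 0).
Local Notation L := (annih M Xp1).
Local Notation L0 := (annih M lam).

Let HL : submod L := submod_annih Xp1 HM.
Let HL0 : submod L0 := submod_annih lam HM.

Definition basisE n (e : 'I_n -> V) := [/\ forall j, M (e j),
  forall v, M v -> exists q z, v = dot q e + z /\ L z &
  forall q, Xp1 *: dot q e = 0 -> forall j, rdvd phi2 (q j)].

Definition basisL c (u : 'I_c -> V) (g : 'I_c -> P) :=
  [/\ forall i, [/\ L (u i), g i *: u i = 0 & ~ rdvd (g i) 1],
  forall v, L v -> exists y, v = dot y u &
  forall y, dot y u = 0 -> forall i, rdvd (g i) (y i)].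

Lemma basis_n_gt0 n (e : 'I_n -> V) : basisE e -> (0 < n)%N.
Proof.
case: n e => // e [_ gen _]; have [v [Mv []]] := Mfaith.
by have [q [z [-> [_ Lz]]]] := gen _ Mv; rewrite /dot big_ord0 add0r.
Qed.

Lemma basisE_neq0 n (e : 'I_n -> V) j : basisE e -> e j <> 0.
Proof.
move=> [_ _ free] ej0; apply: nunit1_phi2.
have := free (delta _ j); rewrite dot_delta ej0 scaler0 => /(_ erefl j).
by rewrite /delta eqxx.
Qed.

Lemma basisL_neq0 c (u : 'I_c -> V) g i : basisL u g -> u i <> 0.
Proof.
move=> [Hu _ free] ui0; have [_ _] := Hu i; apply.
have := free (delta _ i); rewrite dot_delta ui0 => /(_ erefl i).
by rewrite /delta eqxx.
Qed.

Lemma phi2_L v : M v -> L (phi2 *: v).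
Proof. by move=> Mv; split; [exact: submodZ|rewrite scalerA Xp1_phi2 MN]. Qed.

Section Span.
Variables (n c : nat) (e : 'I_n -> V) (u : 'I_c -> V).

Definition subspan (A : pred 'I_n) (B : pred 'I_c) (v : V) := exists q y,
  [/\ forall j, ~~ A j -> q j = 0, forall i, ~~ B i -> y i = 0 & v = dot q e + dot y u].

Lemma submod_subspan A B : submod (subspan A B).
Proof.
split.
  by exists (fun=> 0), (fun=> 0); split=> //; rewrite !dot0 addr0.
move=> a v w [q [y [Hq Hy ->]]] [q' [y' [Hq' Hy' ->]]].
exists (fun j => a * q j + q' j), (fun i => a * y i + y' i); split.
- by move=> j nA; rewrite Hq // Hq' // mulr0 addr0.
- by move=> i nB; rewrite Hy // Hy' // mulr0 addr0.
- by rewrite !dotD !dotZ scalerDr; rewrite !addrA; congr (_ + _); rewrite addrAC.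
Qed.

End Span.

(** If each [phi2 *: e j] involves only vectors [u i] on the side of [j], the spans of the two sides
    are complementary, and one side is empty. Indecomposability enters only here; later arguments
    choose [A] and [B]. *)
Lemma basis_split n c (e : 'I_n -> V) (u : 'I_c -> V) g (A : pred 'I_n) (B : pred 'I_c) :
  basisE e -> basisL u g ->
  (forall j, exists y, phi2 *: e j = dot y u /\ forall i, B i != A j -> y i = 0) ->
  ((forall j, ~~ A j) /\ (forall i, ~~ B i)) \/ ((forall j, A j) /\ (forall i, B i)).
Proof.
move=> He Hu /choice [Y HY]; have [Me gen_e free_e] := He; have [Lu gen_u free_u] := Hu.
have Msub A' B' v : subspan e u A' B' v -> M v.
  move=> [q [y [_ _ ->]]]; apply: submodD => //; apply: submod_dot => // i.
  by have [[]] := Lu i.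
have SA j (A' : pred 'I_n) (B' : pred 'I_c) : A' j -> subspan e u A' B' (e j).
  move=> Aj; exists (delta _ j), (fun=> 0); split=> //; last by rewrite dot_delta dot0 addr0.
  by move=> i nA; rewrite /delta; case: eqP nA => [->|//]; rewrite Aj.
have SB i (A' : pred 'I_n) (B' : pred 'I_c) : B' i -> subspan e u A' B' (u i).
  move=> Bi; exists (fun=> 0), (delta _ i); split=> //; last by rewrite dot_delta dot0 add0r.
  by move=> i' nB; rewrite /delta; case: eqP nB => [->|//]; rewrite Bi.
have [] := Mindec (submod_subspan e u A B) (submod_subspan e u (predC A) (predC B)) (Msub _ _) (Msub _ _).
- move=> v /gen_e [q [z [-> /gen_u [y ->]]]].
  exists (dot (fun j => if A j then q j else 0) e + dot (fun i => if B i then y i else 0) u).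
  exists (dot (fun j => if A j then 0 else q j) e + dot (fun i => if B i then 0 else y i) u).
  split.
  + do 2 eexists; split; last by reflexivity.
      by move=> j /negPf /= ->.
    by move=> i /negPf /= ->.
  + do 2 eexists; split; last by reflexivity.
      by move=> j; rewrite negbK => /= ->.
    by move=> i; rewrite negbK => /= ->.
  + rewrite addrACA -!dotD; congr (_ + _); apply: dot_eq => i.
      by case: (A i); rewrite ?addr0 ?add0r.
    by case: (B i); rewrite ?addr0 ?add0r.
- move=> v [q [y [Aq By Ev]]] [q' [y' [Aq' By' Ev']]].
  (* The two families of coefficients have disjoint supports, so [phi2] divides each of them. Then
     [phi2 *: e j] moves both expressions into [L], where the supports are again disjoint. *)
  have Hq j : rdvd phi2 (q j - q' j).
    move: j; apply: free_e; rewrite dotB.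
    have -> : dot q e - dot q' e = dot y' u - dot y u.
      by apply/eqP; rewrite subr_eq addrAC eq_sym subr_eq -Ev addrC -Ev'.
    have Lu' i : L (u i) by have [] := Lu i.
    by have [_ ] := submodB HL (submod_dot HL y' Lu') (submod_dot HL y Lu').
  have /choice [s Hs] : forall j, rdvd phi2 (q j).
    move=> j; have := Hq j; have [Aj|nA] := boolP (A j); last by rewrite Aq // => _; exact: rdvd0.
    by rewrite Aq' ?subr0 //= negbK.
  have /choice [s' Hs'] : forall j, rdvd phi2 (q' j).
    move=> j; have := Hq j; have [Aj|nA] := boolP (A j); last by rewrite Aq // sub0r => /rdvdN; rewrite opprK.
    by rewrite Aq' ?subr0 //= ?negbK // => _; exact: rdvd0.
  have Ee r r' : (forall j, r j = phi2 * r' j) -> dot r e = dot (comb r' Y) u.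
    move=> Er; rewrite dot_comb; apply: dot_eq => j; rewrite Er mulrC -scalerA.
    by have [-> _] := HY j.
  pose z i := comb s Y i + y i; pose z' i := comb s' Y i + y' i.
  have Ez : v = dot z u by rewrite Ev (Ee _ _ Hs) -dotD.
  have Ez' : v = dot z' u by rewrite Ev' (Ee _ _ Hs') -dotD.
  have phi2_reg a : phi2 * a = 0 -> a = 0.
    move=> E; apply: (monic_rreg (phi2_monic K p_gt0)); rewrite mul0r.
    by rewrite mulrC.
  have z0 i : ~~ B i -> z i = 0.
    move=> nB; rewrite /z By // addr0 /comb big1 // => j _.
    have [Aj|nA] := boolP (A j).
      by have [_ ->] := HY j; rewrite ?mulr0 // Aj (negPf nB).
    by rewrite (phi2_reg (s j)) ?mul0r // -Hs Aq.
  have z'0 i : B i -> z' i = 0.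
    move=> Bi; rewrite /z' By' ?addr0 /comb /= ?negbK // big1 // => j _.
    have [Aj|nA] := boolP (A j).
      by rewrite (phi2_reg (s' j)) ?mul0r // -Hs' Aq' //= negbK.
    by have [_ ->] := HY j; rewrite ?mulr0 // Bi (negPf nA).
  rewrite Ez /dot big1 // => i _; have [Bi|nB] := boolP (B i); last by rewrite z0 ?scale0r.
  have H0 : dot (fun i => z i - z' i) u = 0 by rewrite dotB -Ez -Ez' subrr.
  have := free_u _ H0 i; rewrite z'0 // subr0 => Hz.
  by have [_ gu _] := Lu i; exact: scale_rdvd Hz gu.
- move=> Q0; left; split=> [j|i]; apply/negP.
    by move=> Aj; apply: (basisE_neq0 (j := j) He); apply: Q0; apply: SA.
  by move=> Bi; apply: (basisL_neq0 (i := i) Hu); apply: Q0; apply: SB.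
- move=> Q0; right; split=> [j|i]; apply: contraT.
    by move=> Aj; case: (basisE_neq0 (j := j) He); apply: Q0; apply: SA.
  by move=> Bi; case: (basisL_neq0 (i := i) Hu); apply: Q0; apply: SB.
Qed.

Lemma basisE_change n (e e' : 'I_n -> V) (C C' : 'I_n -> 'I_n -> P) : basisE e ->
  (forall j, L (e' j - dot (C j) e)) ->
  (forall q i, comb (comb q C) C' i = q i) ->
  (forall q i, comb (comb q C') C i = q i) -> basisE e'.
Proof.
move=> [Me gen_e free_e] Le' CC' C'C; split.
- move=> j; rewrite -[e' j](subrK (dot (C j) e)); apply: submodD => //.
    by have [] := Le' j.
  exact: submod_dot.
- move=> v /gen_e [q [z [-> Lz]]].
  exists (comb q C'), (z - dot (comb q C') (fun j => e' j - dot (C j) e)); split; last first.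
    by apply: submodB => //; apply: submod_dot.
  have -> : dot q e = dot (comb q C') (fun j => dot (C j) e).
    by rewrite -dot_comb; apply: dot_eq => i; rewrite C'C.
  rewrite dotBr opprB; set A := dot _ (fun j => dot _ _); set B := dot _ e'.
  by rewrite [RHS]addrCA [B + _]addrCA subrr addr0 addrC.
- move=> q Hq i; rewrite -(CC' q i).
  have : Xp1 *: dot (comb q C) e = 0.
    rewrite dot_comb (_ : dot q _ = dot q e' - dot q (fun j => e' j - dot (C j) e)).
      by rewrite scalerBr Hq (submod_dot HL q Le').2 subr0.
    by rewrite -dotBr; apply: dot_eq => j; rewrite opprB addrC subrK.
  move/free_e => H; rewrite /comb; elim/big_ind: _ => [|x y|j _].
  + exact: rdvd0.
  + exact: rdvdD.
  + by apply: rdvdMr; apply: H.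
Qed.

Lemma basisE_shift n (e l : 'I_n -> V) : basisE e -> (forall j, L (l j)) ->
  basisE (fun j => e j + l j).
Proof.
have comb1 (q : 'I_n -> P) i : comb q (@delta _ n) i = q i.
  rewrite /comb (bigD1 i) //= /delta eqxx mulr1 big1 ?addr0 // => j /negPf.
  by rewrite eq_sym => ->; rewrite mulr0.
move=> He Hl; apply: (basisE_change He (C := @delta _ n) (C' := @delta _ n)).
- by move=> j; rewrite dot_delta addrAC subrr add0r.
- by move=> q i; rewrite !comb1.
- by move=> q i; rewrite !comb1.
Qed.

Definition basisKT a b (k : 'I_a -> V) (t : 'I_b -> V) (ty : 'I_b -> bool) :=
  [/\ forall i, L0 (k i), forall i, M (t i) /\ gT (ty i) *: t i = 0,
      forall v, L v -> exists c y, v = dot c k + dot y t &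
      forall c y, dot c k + dot y t = 0 ->
        (forall i, rdvd lam (c i)) /\ (forall i, rdvd (gT (ty i)) (y i))].

Definition cat_ord T a b (k : 'I_a -> T) (t : 'I_b -> T) (i : 'I_(a + b)) :=
  match split i with inl j => k j | inr j => t j end.

Lemma cat_ordl T a b (k : 'I_a -> T) (t : 'I_b -> T) i : cat_ord k t (lshift b i) = k i.
Proof. by rewrite /cat_ord (unsplitK (inl i)). Qed.

Lemma cat_ordr T a b (k : 'I_a -> T) (t : 'I_b -> T) i : cat_ord k t (rshift a i) = t i.
Proof. by rewrite /cat_ord (unsplitK (inr i)). Qed.

Lemma dot_cat a b c y (k : 'I_a -> V) (t : 'I_b -> V) :
  dot (cat_ord c y) (cat_ord k t) = dot c k + dot y t.
Proof.
by rewrite dot_split; congr (_ + _); apply: dot_eq => i /=; rewrite ?cat_ordl ?cat_ordr.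
Qed.

Lemma dot_lshift_eq r n (k : 'I_r -> V) (j : 'I_(r + n)) :
  dot (fun i => if lshift n i == j then 1 else 0) k = cat_ord k (fun=> 0) j.
Proof.
case: (split_ordP j) => l ->; rewrite ?cat_ordl ?cat_ordr.
  rewrite (dotD1 l) eqxx scale1r big1 ?addr0 // => i /negPf li.
  by rewrite (inj_eq (@lshift_inj _ _)) li scale0r.
by rewrite [LHS]big1 // => i _; rewrite eq_lrshift scale0r.
Qed.

Lemma basisL_KT a b (k : 'I_a -> V) (t : 'I_b -> V) ty : basisKT k t ty ->
  basisL (cat_ord k t) (cat_ord (fun=> lam) (fun i => gT (ty i))).
Proof.
move=> [L0k Lt gen free]; split.
- move=> i; case: (split_ordP i) => j ->; rewrite ?cat_ordl ?cat_ordr.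
    have [Mk k0] := L0k j; split=> //; first by split=> //; exact: lam_Xp1_act.
    move=> [s /(congr1 (horner^~ 1))]; rewrite hornerM horner_lam1 mul0r hornerC.
    by move/eqP; rewrite oner_eq0.
  have [Mt t0] := Lt j; split=> //; first by split=> //; exact: scale_rdvd (gT_Xp1 _) t0.
  by move/nunit1_gT/negP; apply; exact: unit11.
- by move=> v /gen [c [y ->]]; exists (cat_ord c y); rewrite dot_cat.
- move=> y; rewrite dot_split => E i.
  have [] := free (y \o @lshift a b) (y \o @rshift a b).
    rewrite -[RHS]E; congr (_ + _); apply: dot_eq => j /=;
    by rewrite ?cat_ordl ?cat_ordr.
  by case: (split_ordP i) => j ->; rewrite ?cat_ordl ?cat_ordr => H1 H2; [apply: H1|apply: H2].
Qed.

Definition entry (ty : bool) (y : P) :=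
  y = 0 \/ exists v u, [/\ (v < lenT ty)%N, unit1 u & y = lam ^+ v * u].

Lemma entryP ty (q : P) : exists y s z, entry ty y /\ q = y + gT ty * s + p%:R * z.
Proof.
have [[v [u [z [vl uu ->]]]]|[s [z ->]]] := lam_adic Kres (lenT ty) q.
  by exists (lam ^+ v * u), 0, z; split; [right; exists v, u|rewrite mulr0 addr0].
have [w Ew] := gT_lamX ty; exists 0, s, (z - w * s); split; first by left.
by rewrite Ew; ring.
Qed.

(** Gauss modulo [p] treats the part at [k]. In the part at [t], multiples of [gT] vanish, and a
    multiple [p%:R * z] is absorbed in [e j], since [p%:R *: (z *: t)] is [phi2 *: (z *: t)]; what
    remains is a normalized entry. *)
Lemma nf_M0 : exists n a b r (e : 'I_n -> V) (k : 'I_a -> V) (t : 'I_b -> V) ty Y,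
  [/\ basisE e, basisKT k t ty, forall j i, entry (ty i) (Y j i), (r <= n)%N /\ (r <= a)%N &
      forall j, phi2 *: e j = mxfam (pid_mx r) k j + dot (Y j) t].
Proof.
have [n [e0 [Me0 gen_e0 free_e0 _]]] := basis_M Kres tf HM fgM MN.
have [a [b [k0 [t [ty [L0k Lt gen free]]]]]] := nf_L Kres tf HM fgM MN.
have He0 : basisE e0 by [].
have /choice [cy Hcy] : forall j, exists cy : ('I_a -> P) * ('I_b -> P),
    phi2 *: e0 j = dot cy.1 k0 + dot cy.2 t.
  by move=> j; have [c [y E]] := gen _ (phi2_L (Me0 j)); exists (c, y).
pose X := \matrix_(j, i) ((cy j).1 i).[1].
have HX j : phi2 *: e0 j = mxfam X k0 j + dot (cy j).2 t.
  rewrite Hcy; congr (_ + _); apply: dot_eq => i; rewrite mxE.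
  by apply: lam_act_const; have [] := L0k i.
have Hk i : phi2 *: k0 i = p%:R *: k0 i.
  by apply: phi2_Xp1_act; apply: lam_Xp1_act; have [] := L0k i.
have [r [C [C' [E [E' [Z [Hr [CC' C'C] [EE' E'E] HG]]]]]]] := gauss_family Kres HX Hk.
set k := mxfam E k0 in HG.
have L0k' i : L0 (k i) by apply: submod_dot.
have Lt' i : L (t i).
  by have [Mt t0] := Lt i; split=> //; exact: scale_rdvd (gT_Xp1 _) t0.
have kt_basis : basisKT k t ty.
  split=> // [v /gen [c [y ->]]|c y].
    exists (fun i => \sum_j c j * (E' j i)%:P), y; congr (_ + _).
    rewrite -dot_mxfam; apply: dot_eq => i; congr (_ *: _).
    by rewrite mxfamM E'E mxfam1.
  by rewrite dot_mxfam => /free [Hc Hy]; split=> // i; exact: (mx_rdvd EE' Hc).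
pose Y0 j := comb (fun i => (C' j i)%:P) (fun i => (cy i).2).
have HY0 j : mxfam C' (fun j => dot (cy j).2 t) j = dot (Y0 j) t by rewrite dot_comb.
have /choice [yz Hyz] : forall ji : 'I_n * 'I_b, exists yz : P * P * P,
    entry (ty ji.2) yz.1.1 /\
    Y0 ji.1 ji.2 = yz.1.1 + gT (ty ji.2) * yz.1.2 + p%:R * yz.2.
  by move=> [j i]; have [y [s [z H]]] := entryP (ty i) (Y0 j i); exists ((y, s), z).
pose Y j i := (yz (j, i)).1.1; pose z j i := (yz (j, i)).2.
pose e1 j := mxfam C' e0 j.
have He1 : basisE e1.
  have cmx (A B : 'M[K]_n) (q : 'I_n -> P) i : A *m B = 1%:M ->
    comb (comb q (fun i j => (A i j)%:P)) (fun i j => (B i j)%:P) i = q i.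
    exact: mx_cancel.
  apply: (basisE_change He0 (C := fun i j => (C' i j)%:P) (C' := fun i j => (C i j)%:P)).
  - by move=> j; rewrite subrr; exact: HL.1.
  - by move=> q i; apply: cmx.
  - by move=> q i; apply: cmx.
exists n, a, b, r, (fun j => e1 j + (- mxfam Z k j - dot (z j) t)), k, t, ty, Y.
split=> //.
- apply: basisE_shift => // j; apply: submodB => //; last exact: submod_dot.
  apply: submodN => //; apply: submod_dot => // i; have [Mk k1] := L0k' i; split=> //.
  exact: lam_Xp1_act.
- by move=> j i; have [] := Hyz (j, i).
move=> j; rewrite addrA scalerBr HG HY0 -addrA; congr (_ + _).
rewrite phi2_Xp1_act ?(submod_dot HL) //; last first.
  by have [] := submod_dot HL (z j) Lt'.
rewrite -dotZ -dotB; apply: dot_eq => i; have [_ ->] := Hyz (j, i).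
have [_ t0] := Lt i.
by rewrite /= addrK scalerDl mulrC -scalerA t0 scaler0 addr0.
Qed.

(** A vector [k i] with [r <= i] occurs in no [phi2 *: e j] and would be a direct summand; hence
    [a = r]. *)
Lemma nf_M : exists r n b (e : 'I_(r + n) -> V) (k : 'I_r -> V) (t : 'I_b -> V) ty Y,
  [/\ basisE e, basisKT k t ty, forall j i, entry (ty i) (Y j i) &
      forall j, phi2 *: e j = cat_ord k (fun=> 0) j + dot (Y j) t].
Proof.
have [n [a [b [r [e [k [t [ty [Y [He Hkt HY [rn ra] HE]]]]]]]]]] := nf_M0.
have [lt_ra|] := ltnP r a.
  have [] := basis_split (A := pred0) (B := pred1 (lshift b (Ordinal lt_ra))) He (basisL_KT Hkt).
  - move=> j; have [ij|nij] := ltnP j r.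
      pose i := Ordinal (leq_trans ij ra).
      exists (cat_ord (delta _ i) (Y j)); rewrite dot_cat dot_delta HE; split.
        by rewrite (mxfam_pid _ _ (j := i)) // ij.
      move=> l; rewrite /= eqbF_neg negbK => /eqP ->; rewrite cat_ordl /delta.
      by rewrite -val_eqE /= gtn_eqF.
    exists (cat_ord (fun=> 0) (Y j)); rewrite dot_cat dot0 HE mxfam_pid0 //; split=> //.
    by move=> l; rewrite /= eqbF_neg negbK => /eqP ->; rewrite cat_ordl.
  - by move=> [_ /(_ (lshift b (Ordinal lt_ra)))]; rewrite /= eqxx.
  - by move=> [/(_ (Ordinal (basis_n_gt0 He)))].
move=> ar; have Ea : a = r by apply/eqP; rewrite eqn_leq ra ar.
have [n' En] : exists n', n = (r + n')%N by exists (n - r)%N; rewrite subnKC.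
move: e k t ty Y He Hkt HY HE; rewrite {}Ea {}En => e k t ty Y He Hkt HY HE.
exists r, n', b, e, k, t, ty, Y; split=> // j; rewrite HE; congr (_ + _).
case: (split_ordP j) => i ->; rewrite ?cat_ordl ?cat_ordr.
  by rewrite (mxfam_pid _ _ (j := i)) //= ltn_ord.
by rewrite mxfam_pid0 //= leq_addr.
Qed.

Lemma basisE_elem n (e : 'I_n -> V) (W : 'I_n -> P) j1 : basisE e -> W j1 = 0 ->
  basisE (fun j => e j - W j *: e j1).
Proof.
move=> He W1; pose C (w : 'I_n -> P) j i : P := delta _ j i + w j * delta _ j1 i.
have combC w q i : comb q (C w) i = q i + (\sum_j q j * w j) * delta _ j1 i.
  rewrite /comb /C; under eq_bigr do rewrite mulrDr mulrA.
  rewrite big_split /= -mulr_suml; congr (_ + _).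
  rewrite (bigD1 i) //= /delta eqxx mulr1 big1 ?addr0 // => j /negPf.
  by rewrite eq_sym => ->; rewrite mulr0.
have CC w q i : w j1 = 0 -> comb (comb q (C w)) (C (fun j => - w j)) i = q i.
  move=> w1; rewrite combC.
  have -> : \sum_j comb q (C w) j * - w j = - \sum_j q j * w j.
    rewrite -sumrN; apply: eq_bigr => j _; rewrite combC /delta.
    by case: eqP => [->|_]; rewrite ?w1 ?mulr0 ?addr0 ?mulrN // ?mulr0 oppr0.
  by rewrite combC mulNr addrK.
apply: (basisE_change He (C := C (fun j => - W j)) (C' := C W)).
- move=> j; rewrite /C dotD dotZ !dot_delta scaleNr subrr; exact: HL.1.
- move=> q i; rewrite -[RHS](CC (fun j => - W j)) ?W1 ?oppr0 // !combC.
  by congr (_ + _ * _); apply: eq_bigr => j _; rewrite combC opprK.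
- by move=> q i; apply: CC.
Qed.

Lemma basisKT_k a b (k : 'I_a -> V) (t : 'I_b -> V) ty (W : 'I_a -> P) i1 :
  basisKT k t ty -> W i1 = 0 -> basisKT (fun i => k i - W i *: k i1) t ty.
Proof.
move=> [L0k Lt gen free] W1; have D c : dot c (fun i => k i - W i *: k i1) =
    dot (fun i => c i - (\sum_j c j * W j) * delta _ i1 i) k.
  rewrite dotBr dotB dotZ dot_delta; congr (_ - _).
  by rewrite scaler_suml; apply: eq_bigr => j _; rewrite scalerA.
split=> //.
- by move=> i; apply: submodB => //; apply: submodZ.
- move=> v /gen [c [y ->]]; exists (fun i => c i + (\sum_j c j * W j) * delta _ i1 i), y.
  congr (_ + _); rewrite D; apply: dot_eq => i; congr (_ *: _).
  have -> : \sum_j (c j + (\sum_l c l * W l) * delta _ i1 j) * W j = \sum_j c j * W j.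
    apply: eq_bigr => j _; rewrite /delta.
    by case: eqP => [->|_]; rewrite ?W1 ?mulr0 ?addr0.
  by rewrite addrK.
- move=> c y; rewrite D => /free [Hc Hy]; split=> //.
  have Hc' i : i != i1 -> rdvd lam (c i).
    by move=> /negPf ni; have := Hc i; rewrite /delta ni mulr0 subr0.
  move=> i; have [->|/Hc' //] := eqVneq i i1.
  have -> : c i1 = (c i1 - (\sum_j c j * W j) * delta _ i1 i1) + \sum_j c j * W j.
    by rewrite /delta eqxx mulr1 subrK.
  apply: rdvdD => //; elim/big_ind: _ => [|x z|j _]; [exact: rdvd0|exact: rdvdD|].
  by have [->|/Hc' H] := eqVneq j i1; [rewrite W1 mulr0; exact: rdvd0|exact: rdvdMr].
Qed.

Lemma gT_XN1 ty : rdvd (gT ty) XN1.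
Proof. by apply: rdvd_trans (gT_Xp1 ty) _; exists phi2; rewrite Xp1_phi2. Qed.

Lemma unit1_cancel_XN1 (d u y : P) : rdvd d XN1 -> unit1 u -> rdvd d (y * u) -> rdvd d y.
Proof.
move=> dX /(unit1_inv Kres) [u' [r E]] H.
have -> : y = u' * (y * u) - XN1 * (y * r).
  have -> : u' * (y * u) = y * (u' * u) by ring.
  by rewrite E; ring.
by apply: rdvdB; [exact: rdvdMl|exact: rdvdMr].
Qed.

Lemma unit1_cancel ty (u y : P) : unit1 u -> rdvd (gT ty) (y * u) -> rdvd (gT ty) y.
Proof. exact: (unit1_cancel_XN1 (gT_XN1 ty)). Qed.

(** A column operation: the unit coefficient lets [dot Y t] replace [t b1], and the last hypothesis
    ensures that the new vector is still killed by [gT (ty b1)]. *)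
Lemma basisKT_t a b (k : 'I_a -> V) (t : 'I_b -> V) ty (Y : 'I_b -> P) b1 :
  basisKT k t ty -> unit1 (Y b1) -> gT (ty b1) *: dot Y t = 0 ->
  basisKT k (fun i => if i == b1 then dot Y t else t i) ty.
Proof.
move=> [L0k Lt gen free] uY gY; set t' := fun _ => _.
have Mt i : M (t i) by have [] := Lt i.
have Dt0 y : dot y t' = dot (fun i => if i == b1 then 0 else y i) t + y b1 *: dot Y t.
  rewrite (dotD1 b1) addrC /t' eqxx; congr (_ + _).
  rewrite [RHS](dotD1 b1) eqxx scale0r add0r.
  by apply: eq_bigr => i /negPf ->.
have Dt' y : dot y t' = dot (fun i => (if i == b1 then 0 else y i) + y b1 * Y i) t.
  by rewrite dotD dotZ Dt0.
split=> //.
- move=> i; rewrite /t'; case: eqP => // ->; split=> //; exact: submod_dot.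
- move=> v /gen [c [y ->]]; have [u [r E]] := unit1_inv Kres uY.
  exists c, (fun i => if i == b1 then y b1 * u else y i - y b1 * u * Y i).
  congr (_ + _); rewrite Dt' eqxx; apply: dot_eq => i.
  case: eqP => [->|_]; last by congr (_ *: _); ring.
  have -> : 0 + y b1 * u * Y b1 = y b1 + (y b1 * r) * XN1.
    by rewrite add0r -mulrA E; ring.
  rewrite scalerDl -[in RHS]scalerA (scale_rdvd (gT_XN1 (ty b1))) ?scaler0 ?addr0 //.
  by have [] := Lt b1.
- move=> c y E; move: (E); rewrite Dt' => /free [Hc Hy]; split=> //.
  have Hb : rdvd (gT (ty b1)) (y b1).
    by apply: (unit1_cancel uY); have := Hy b1; rewrite eqxx add0r.
  move: E; rewrite Dt0 (scale_rdvd Hb gY) addr0 => /free [_ H] i.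
  by have := H i; case: eqP => // ->.
Qed.

Variable m : V.
Hypotheses (L0m : L0 m) (m_phi2 : forall w, M w -> m <> phi2 *: w).

(** If all entries vanish, a vector [t i] splits off. If there is no [t] at all, [L] is spanned by
    the [k i], which are values of [phi2], and [m] lies in [phi2 M]. *)
Lemma unused_t r n b (e : 'I_(r + n) -> V) (k : 'I_r -> V) (t : 'I_b -> V) ty Y :
  basisE e -> basisKT k t ty ->
  (forall j, phi2 *: e j = cat_ord k (fun=> 0) j + dot (Y j) t) ->
  exists j i, Y j i != 0.
Proof.
move=> He Hkt HE; apply: contrapT => HY.
have {HY} Y0 j i : Y j i = 0.
  by apply/eqP; apply: contra_notT HY => ji; exists j, i.
have {}HE j : phi2 *: e j = cat_ord k (fun=> 0) j.
  by rewrite HE [dot _ t]big1 ?addr0 // => i _; rewrite Y0 scale0r.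
have [b0|b0] := posnP b.
  have [_ _ gen _] := Hkt; have [|c [y Em]] := gen m.
    by split; [exact: L0m.1|apply: lam_Xp1_act; exact: L0m.2].
  case: (@m_phi2 (dot c (e \o lshift n))).
    by apply: submod_dot => // i; have [Me _ _] := He; exact: Me.
  rewrite Em -dotZr [X in _ + X](_ : _ = 0) ?addr0.
    by apply: dot_eq => i /=; rewrite HE cat_ordl.
  by rewrite /dot big1 // => i; have := ltn_ord i; rewrite {2}b0.
have [] := basis_split (A := pred0) (B := pred1 (rshift r (Ordinal b0))) He (basisL_KT Hkt).
- move=> j; exists (cat_ord (fun i => if lshift n i == j then 1 else 0) (fun=> 0)).
  rewrite dot_cat dot0 addr0 HE; split; first by rewrite dot_lshift_eq.
  by move=> l; rewrite /= eqbF_neg negbK => /eqP ->; rewrite cat_ordr.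
- by move=> [_ /(_ (rshift r (Ordinal b0)))]; rewrite /= eqxx.
- by move=> [/(_ (Ordinal (basis_n_gt0 He)))].
Qed.

(** Like [pres], but [k] may be [0]: this occurs when the pivot row is one without [k]. The vector
    [m] excludes it in [classification]. *)
Definition pres0 ty n (e k t : V) : Prop :=
  [/\ [/\ M e, M k & M t],
      [/\ phi2 *: e = k + lam ^+ n *: t, lam *: k = 0 & gT ty *: t = 0],
      forall v, M v -> exists q c y, v = q *: e + c *: k + y *: t,
      forall q, Xp1 *: (q *: e) = 0 -> rdvd phi2 q &
      forall c y, c *: k + y *: t = 0 -> (k = 0 \/ rdvd lam c) /\ rdvd (gT ty) y].

(* Split off the summand through an entry of least weight: smallest power of
   [lam], then free before cyclotomic columns, then rows without [k]. *)
Lemma pivot : exists ty n e k t, (n < lenT ty)%N /\ pres0 ty n e k t.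
Proof.
have [r [n [b [e [k [t [ty [Y [He Hkt HY HE]]]]]]]]] := nf_M.
have [j0 [i0 nz0]] := unused_t He Hkt HE.
have /choice [vu Hvu] : forall ji : 'I_(r + n) * 'I_b, exists vu : nat * P,
    Y ji.1 ji.2 != 0 -> [/\ (vu.1 < lenT (ty ji.2))%N, unit1 vu.2 &
      Y ji.1 ji.2 = lam ^+ vu.1 * vu.2].
  move=> [j i] /=; have [->|[v [u [vl uu E]]]] := HY j i.
    by exists (0%N, 0); rewrite eqxx.
  by exists (v, u) => _; split.
pose val j i := (vu (j, i)).1; pose un j i := (vu (j, i)).2.
have {}Hvu j i : Y j i != 0 ->
    [/\ (val j i < lenT (ty i))%N, unit1 (un j i) & Y j i = lam ^+ val j i * un j i].
  exact: (Hvu (j, i)).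
pose wt (ji : 'I_(r + n) * 'I_b) :=
  (4 * val ji.1 ji.2 + 2 * ~~ ty ji.2 + (ji.1 < r))%N.
pose nzp (ji : 'I_(r + n) * 'I_b) := Y ji.1 ji.2 != 0.
have [[j1 b1] nz1 Hmin] := arg_minnP (P := nzp) (i0 := (j0, i0)) wt nz0.
rewrite {}/nzp /= in nz1 Hmin; have {j0 i0 nz0} {}Hmin j i : Y j i != 0 -> (wt (j1, b1) <= wt (j, i))%N.
  by move=> nz; apply: (Hmin (j, i)).
have [v1l u1 EY1] := Hvu _ _ nz1.
set v1 := val j1 b1 in v1l EY1; set un1 := un j1 b1 in u1 EY1.
have vge j i : Y j i != 0 -> (v1 <= val j i)%N.
  by move=> /Hmin; rewrite /wt /= -/v1; case: (ty b1); case: (ty i); case: (_ < r)%N; case: (_ < r)%N; lia.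
pose kk := cat_ord k (fun _ : 'I_n => 0).
have [L0k Lt gen_kt free_kt] := Hkt.
have L0kk j : L0 (kk j).
  by rewrite /kk; case: (split_ordP j) => i ->; rewrite ?cat_ordl ?cat_ordr //; apply: HL0.1.
pose Y' i := if Y j1 i == 0 then 0 else lam ^+ (val j1 i - v1) * un j1 i.
have EY' i : Y j1 i = lam ^+ v1 * Y' i.
  rewrite /Y'; case: eqVneq => [->|nz]; first by rewrite mulr0.
  by have [_ _ ->] := Hvu _ _ nz; rewrite mulrA -exprD subnKC // vge.
have Y'1 : Y' b1 = un1 by rewrite /Y' (negPf nz1) subnn mul1r.
(* The delicate case is a cyclotomic pivot column. A nonzero entry of its row in a free column then
   has a strictly larger exponent, and the spare [lam] turns [phi1] into [X^p - 1], which kills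
   [t i]. *)
have gY' : gT (ty b1) *: dot Y' t = 0.
  rewrite -dotZ /dot big1 // => i _; have [Mt gt] := Lt i.
  case Ety1: (ty b1); first by rewrite mulrC -scalerA (scale_rdvd (gT_Xp1 (ty i))) ?scaler0.
  case Ety: (ty i) gt => gt; last by rewrite mulrC -scalerA gt scaler0.
  rewrite /Y'; case: eqVneq => [_|nz]; first by rewrite mulr0 scale0r.
  have lt_v : (v1 < val j1 i)%N.
    by have := Hmin _ _ nz; rewrite /wt /= -/v1 Ety Ety1; lia.
  rewrite -(subnSK lt_v) exprS.
  have -> : gT false * (lam * lam ^+ (val j1 i - v1.+1) * un j1 i) =
     (lam ^+ (val j1 i - v1.+1) * un j1 i) * (lam * phi1) by rewrite /ann_poly; ring.
  by rewrite lam_phi1 -scalerA gt scaler0.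
have [U [R EU]] := unit1_inv Kres u1.
pose W j := if (j == j1) || (Y j b1 == 0) then 0 else lam ^+ (val j b1 - v1) * un j b1 * U.
have W1 : W j1 = 0 by rewrite /W eqxx.
have HW j : j != j1 -> (Y j b1 - W j * Y j1 b1) *: t b1 = 0.
  move=> nj; rewrite /W (negPf nj) /=; case: eqVneq => [->|nz].
    by rewrite mul0r subrr scale0r.
  have [_ _ ->] := Hvu _ _ nz; rewrite EY1.
  have -> : lam ^+ val j b1 = lam ^+ (val j b1 - v1) * lam ^+ v1 by rewrite -exprD subnK // vge.
  set x := lam ^+ (_ - _); set z := lam ^+ v1.
  have -> : x * z * un j b1 - x * un j b1 * U * (z * un1) = - (x * z * un j b1 * R) * XN1.
    by have -> : x * un j b1 * U * (z * un1) = x * z * un j b1 * (U * un1); [ring|rewrite EU; ring].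
  by rewrite -scalerA (scale_rdvd (gT_XN1 (ty b1))) ?scaler0 //; have [] := Lt b1.
(* Clearing a row subtracts a multiple of [kk j1], which a row without [k] cannot absorb. If the
   pivot row has a [k], the entry of such a row has a strictly larger exponent, so [W] is a multiple
   of [lam] and kills [kk j1]. *)
have HWk i : W (rshift r i) *: kk j1 = 0.
  have [j1r|rj1] := ltnP j1 r; last first.
    rewrite /kk; case: (split_ordP j1) rj1 => l ->; rewrite ?cat_ordr ?scaler0 //=.
    by rewrite leqNgt ltn_ord.
  rewrite /W; case: ifP => [_|/norP [nj nz]]; first by rewrite scale0r.
  have lt_v : (v1 < val (rshift r i) b1)%N.
    by have := Hmin _ _ nz; rewrite /wt /= -/v1 j1r ltnNge leq_addr /=; lia.
  by rewrite -(subnSK lt_v) exprS -!mulrA mulrC -scalerA (L0kk j1).2 scaler0.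
pose e' j := e j - W j *: e j1.
have He' : basisE e' by apply: basisE_elem.
pose t' i := if i == b1 then dot Y' t else t i.
(* In the rows with a [k], the same subtraction is absorbed by changing [k i]. *)
pose k' i := k i - W (lshift n i) *: kk j1.
have Hkt' : basisKT k' t' ty.
  apply: basisKT_t; rewrite ?Y'1 //; rewrite /k' /kk; case: (split_ordP j1) => l El.
    by rewrite El cat_ordl; apply: basisKT_k; rewrite // -El.
  suff -> : (fun i => k i - W (lshift n i) *: cat_ord k (fun=> 0) j1) = k by [].
  by apply/funext => i; rewrite El cat_ordr scaler0 subr0.
have k'1 i : lshift n i = j1 -> k' i = kk j1.
  by move=> E; rewrite /k' E W1 scale0r subr0 -E /kk cat_ordl.
have t'1 : t' b1 = dot Y' t by rewrite /t' eqxx.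
have HE1 : phi2 *: e j1 = kk j1 + lam ^+ v1 *: t' b1.
  by rewrite HE t'1 -dotZ; congr (_ + _); apply: dot_eq => i; rewrite EY'.
have HEj j : j != j1 -> phi2 *: e' j =
    cat_ord k' (fun=> 0) j + dot (fun i => if i == b1 then 0 else Y j i - W j * Y j1 i) t'.
  move=> nj; rewrite /e' scalerBr HE scalerA mulrC -scalerA HE.
  rewrite scalerDr opprD addrACA -dotZ -dotB; congr (_ + _).
    case: (split_ordP j) => i ->; rewrite ?cat_ordl ?cat_ordr //.
    by rewrite -/kk HWk subr0.
  apply: dot_eq => i; rewrite /t'; case: eqP => [->|//].
  by rewrite scale0r HW.
(* The pivot side: [t' b1], and [k' i] if row [j1] is the row of that [k]. *)
pose Bp := cat_ord (fun i => lshift n i == j1) (fun i => i == b1).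
have [] := basis_split (A := pred1 j1) (B := Bp) He' (basisL_KT Hkt').
- move=> j; rewrite /=; have [->|nj] := eqVneq j j1.
    exists (cat_ord (fun i => if lshift n i == j1 then 1 else 0)
                    (fun i => if i == b1 then lam ^+ v1 else 0)).
    rewrite dot_cat /e' W1 scale0r subr0 HE1; split.
      congr (_ + _); last first.
        by rewrite (dotD1 b1) eqxx big1 ?addr0 // => i /negPf ->; rewrite scale0r.
      rewrite dot_lshift_eq /kk; case: (split_ordP j1) => l El; rewrite El ?cat_ordr //.
      by rewrite !cat_ordl k'1 // /kk El cat_ordl.
    move=> i; rewrite eqb_id /Bp; case: (split_ordP i) => l ->; rewrite ?cat_ordl ?cat_ordr.
      by move/negPf ->.
    by move/negPf ->.
  exists (cat_ord (fun i => if lshift n i == j then 1 else 0)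
           (fun i => if i == b1 then 0 else Y j i - W j * Y j1 i)).
  rewrite dot_cat HEj //; split.
    by congr (_ + _); rewrite dot_lshift_eq.
  move=> i; rewrite eqbF_neg negbK /Bp; case: (split_ordP i) => l ->; rewrite ?cat_ordl ?cat_ordr.
    by move/eqP ->; rewrite eq_sym (negPf nj).
  by move=> ->.
- by move=> [/(_ j1)]; rewrite /= eqxx.
move=> [Aall Ball].
have {}Aall j : j = j1 by apply/eqP; apply: Aall.
have Bk i : lshift n i = j1.
  by apply/eqP; have := Ball (lshift b i); rewrite /Bp cat_ordl.
have Bt i : i = b1 by apply/eqP; have := Ball (rshift r i); rewrite /Bp cat_ordr.
have [Me' gen_e' free_e'] := He'; have [L0k' Lt' gen_kt' free_kt'] := Hkt'.
have e'1 : e' j1 = e j1 by rewrite /e' W1 scale0r subr0.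
have dot_e q : dot q e' = q j1 *: e j1.
  by rewrite (dotD1 j1) e'1 big1 ?addr0 // => j /eqP []; apply: Aall.
have dot_t y : dot y t' = y b1 *: t' b1.
  by rewrite (dotD1 b1) big1 ?addr0 // => i /eqP []; apply: Bt.
exists (ty b1), v1, (e j1), (kk j1), (t' b1); split=> //; split.
- by split; [rewrite -e'1|have [] := L0kk j1|have [] := Lt' b1].
- by split=> //; [have [] := L0kk j1|have [] := Lt' b1].
- move=> v /gen_e' [q [z [-> /gen_kt' [c [y ->]]]]].
  exists (q j1), (\sum_i c i), (y b1); rewrite dot_e dot_t addrA; congr (_ + _ + _).
  by rewrite scaler_suml; apply: eq_bigr => i _; rewrite k'1.
- by move=> q Hq; apply: (free_e' (fun=> q) _ j1); rewrite dot_e.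
- move=> c y E.
  rewrite /kk in E *; case: (split_ordP j1) E => l El; rewrite El ?cat_ordl ?cat_ordr => E.
    have [|Hc Hy] := free_kt' (fun=> c) (fun=> y).
      rewrite dot_t -[RHS]E; congr (_ + _).
      rewrite (dotD1 l) k'1 // El /kk cat_ordl big1 ?addr0 // => i /eqP [].
      by apply: (@lshift_inj r n); rewrite -El Bk.
    by split; [right; apply: (Hc l)|apply: (Hy b1)].
  split; [by left|].
  have [|_ Hy] := free_kt' (fun=> 0) (fun=> y); last exact: (Hy b1).
  by rewrite dot0 dot_t -[RHS]E scaler0.
Qed.

Definition span3 (e k t v : V) := exists q c y : P, v = q *: e + c *: k + y *: t.

Lemma submod_span3 e k t : submod (span3 e k t).
Proof.
split; first by exists 0, 0, 0; rewrite !scale0r !addr0.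
move=> a u v [q [c [y ->]]] [q' [c' [y' ->]]].
exists (a * q + q'), (a * c + c'), (a * y + y').
rewrite !scalerDl -!scalerA !scalerDr [LHS]addrACA; congr (_ + _).
by rewrite addrACA.
Qed.

Lemma span3_e e k t : span3 e k t e.
Proof. by exists 1, 0, 0; rewrite scale1r !scale0r !addr0. Qed.

Lemma span3_k e k t : span3 e k t k.
Proof. by exists 0, 1, 0; rewrite scale1r !scale0r addr0 add0r. Qed.

Lemma span3_t e k t : span3 e k t t.
Proof. by exists 0, 0, 1; rewrite scale1r !scale0r !add0r. Qed.

Lemma pres0_L ty n e k t v : pres0 ty n e k t -> L v -> exists c y, v = c *: k + y *: t.
Proof.
move=> [_ [Ee k0 t0] gen free _] [/gen [q [c [y ->]]]].
have t1 := scale_rdvd (gT_Xp1 ty) t0; have k1 := lam_Xp1_act p k0.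
rewrite !scalerDr [_ *: (c *: k)]scalerA mulrC -scalerA k1 scaler0 addr0.
rewrite [_ *: (y *: t)]scalerA mulrC -scalerA t1 scaler0 addr0 => /free [s ->].
exists (s + c), (s * lam ^+ n + y).
by rewrite mulrC -scalerA Ee scalerDr scalerA !scalerDl addrACA addrA.
Qed.

(** [k0], [t0] is another basis of [L], and [e0] another generator modulo [L]. If [phi2 *: e0] is
    one of the two basis vectors, the other one splits off. *)
Lemma pres0_split_absurd n e k t e0 k0 t0 : pres0 true n e k t ->
  L (e0 - e) -> L0 k0 -> L t0 ->
  (forall c y, exists c' y', c *: k + y *: t = c' *: k0 + y' *: t0) ->
  (forall c y, c *: k0 + y *: t0 = 0 -> rdvd lam c /\ rdvd Xp1 y) ->
  ~ (phi2 *: e0 = k0 \/ phi2 *: e0 = t0).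
Proof.
move=> Hp Le0 L0k0 Lt0 gen' free' HE; have [[Me Mk Mt] [Ee k1 t1] gen free1 free2] := Hp.
have dot1 (q : 'I_1 -> P) (f : 'I_1 -> V) : dot q f = q ord0 *: f ord0.
  by rewrite /dot big_ord_recl big_ord0 addr0.
have He0 : basisE (fun _ : 'I_1 => e).
  split=> // [v /gen [q [c [y ->]]]|q]; last first.
    by rewrite dot1 => /free1 H j; rewrite (ord1 j).
  exists (fun=> q), (c *: k + y *: t); rewrite dot1 addrA; split=> //.
  apply: submodD => //; apply: submodZ => //; split=> //; exact: lam_Xp1_act.
have He : basisE (fun _ : 'I_1 => e + (e0 - e)) := basisE_shift He0 (fun=> Le0).
have Hkt : basisKT (fun _ : 'I_1 => k0) (fun _ : 'I_1 => t0) (fun=> true).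
  split=> // [v /(pres0_L Hp) [c [y ->]]|c y].
    by have [c' [y' ->]] := gen' c y; exists (fun=> c'), (fun=> y'); rewrite !dot1.
  by rewrite !dot1 => /free' [Hc Hy]; split=> i; rewrite (ord1 i).
pose Bp (i : 'I_(1 + 1)) := `[<phi2 *: e0 = cat_ord (fun=> k0) (fun=> t0) i>].
pose l0 : 'I_(1 + 1) := lshift 1 ord0; pose r0 : 'I_(1 + 1) := @rshift 1 1 ord0.
have lE : cat_ord (fun=> k0) (fun=> t0) l0 = k0 by rewrite /l0 cat_ordl.
have rE : cat_ord (fun=> k0) (fun=> t0) r0 = t0 by rewrite /r0 cat_ordr.
have kt : k0 <> t0.
  move=> E; have [] := free' 1 (-1).
    by rewrite scale1r scaleN1r E subrr.
  move=> [s /(congr1 (horner^~ 1))]; rewrite hornerM horner_lam1 mul0r hornerC.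
  by move/eqP; rewrite oner_eq0.
have [] := basis_split (A := predT) (B := Bp) He (basisL_KT Hkt).
- move=> j; rewrite [e + _]addrC subrK; case: HE => HE.
    exists (cat_ord (fun=> 1) (fun=> 0)); rewrite dot_cat !dot1 scale1r scale0r addr0.
    split=> // i; case: (split_ordP i) => l ->; rewrite ?cat_ordr // (ord1 l) /Bp -/l0 lE.
    by rewrite asboolT.
  exists (cat_ord (fun=> 0) (fun=> 1)); rewrite dot_cat !dot1 scale1r scale0r add0r.
  split=> // i; case: (split_ordP i) => l ->; rewrite ?cat_ordl // (ord1 l) /Bp -/r0 rE.
  by rewrite asboolT.
- by move=> [/(_ ord0)].
move=> [_ HB]; apply: kt.
have /asboolP := HB l0; have /asboolP := HB r0; rewrite lE rE.
by move=> ->.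
Qed.

Definition range_ok (ty : bool) n := if ty then (0 < n < p.-1)%N else (n < p.-1)%N.

(** Both ends of the free case decompose. For [n = 0], [k] and [k + t] form a basis of [L]
    containing [phi2 *: e]. For [n = p.-1], [lam ^+ n] is [phi1] modulo [p]; a change of [e] gives
    [phi2 *: e = k + phi1 *: t], which forms a basis together with [t]. *)
Lemma pres0_range ty n e k t : pres0 ty n e k t -> k <> 0 -> (n < lenT ty)%N ->
  range_ok ty n.
Proof.
case: ty => // Hp kn0 /= np; have [[Me Mk Mt] [Ee k0 t0] gen free1 free2'] := Hp.
have free2 c y : c *: k + y *: t = 0 -> rdvd lam c /\ rdvd Xp1 y.
  by move=> /free2' [[]].
have L0k : L0 k by [].
have Lt : L t by [].
have Lk : L k by split=> //; exact: lam_Xp1_act.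
case: n np Ee Hp => [|n] np Ee Hp.
  case: (@pres0_split_absurd _ _ _ _ e k (k + t) Hp) => //.
  - by rewrite subrr; exact: HL.1.
  - exact: submodD.
  - move=> c y; exists (c - y), y; rewrite scalerBl scalerDr addrA subrK //.
  - move=> c y; rewrite scalerDr addrA -scalerDl => /free2 [Hc Hy]; split=> //.
    rewrite -[c](addrK y); apply: rdvdB => //; apply: rdvd_trans Hy.
    by exists phi1; rewrite lam_phi1.
  - by right; rewrite Ee expr0 scale1r.
have [//|np'] := ltnP n.+1 p.-1.
have {np np'} En : n.+1 = p.-1 by move: np np' p_gt0; lia.
have [z Ez] := phi1_lamX Kres.
case: (@pres0_split_absurd _ _ _ _ (e + z *: t) (k + phi1 *: t) t Hp) => //.
- by rewrite addrAC subrr add0r; exact: submodZ.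
- split; first by apply: submodD => //; exact: submodZ.
  by rewrite scalerDr k0 add0r scalerA lam_phi1.
- move=> c y; exists c, (y - c * phi1); rewrite scalerDr scalerBl !scalerA -addrA.
  by congr (_ + _); rewrite addrC subrK.
- move=> c y; rewrite scalerDr scalerA -addrA -scalerDl => /free2 [Hc Hy]; split=> //.
  have -> : y = (c * phi1 + y) - c * phi1 by ring.
  apply: rdvdB => //.
  by have [s ->] := Hc; exists s; rewrite -lam_phi1; ring.
left; rewrite scalerDr Ee En (phi2_Xp1_act (v := z *: t)); last first.
  by rewrite scalerA mulrC -scalerA t0 scaler0.
by rewrite Ez scalerDl !scalerA addrA.
Qed.

(** Besides [k], only multiples of [phi1 *: t] contribute to [L0], and these lie in [phi2 M] when
    [k = 0] or [n < p.-1]. As [m] is not in [phi2 M], its coefficient at [k] is a unit, and [m] can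
    take the place of [k]. *)
Theorem classification : exists ty n e t, range_ok ty n /\ pres p M ty n e m t.
Proof.
have [ty [n [e [k [t [nl Hp]]]]]] := pivot.
have [[Me Mk Mt] [Ee k0 t0] gen free1 free2] := Hp.
have Lm : L m by split; [exact: L0m.1|apply: lam_Xp1_act; exact: L0m.2].
have [c [y Em]] := pres0_L Hp Lm.
have t1 := scale_rdvd (gT_Xp1 ty) t0.
have ck0 : (lam * c) *: k = 0 by rewrite mulrC -scalerA k0 scaler0.
have [_ lam_y] : (k = 0 \/ rdvd lam (lam * c)) /\ rdvd (gT ty) (lam * y).
  by apply: free2; rewrite -!scalerA -scalerDr -Em L0m.2.
have [z Ez] := phi1_lamX Kres.
have [d Ed] : exists d, y *: t = (d * phi1) *: t.
  case: ty {nl Hp gen free1 free2} t0 lam_y => /= t0; last first.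
    move=> lam_y; exists 0; rewrite mul0r scale0r.
    apply: tf; rewrite -phi1_lam_act.
      by rewrite scalerA mulrC -scalerA t0 scaler0.
    by rewrite scalerA; exact: scale_rdvd lam_y t0.
  move=> [s Es]; exists s; congr (_ *: _).
  apply: (monic_rreg (lam_monic K)); rewrite [LHS]mulrC Es -lam_phi1; ring.
rewrite {}Ed in Em.
(* From [phi1 = lam ^+ p.-1 + p%:R * z]: the power of [lam] is reached from [e], the multiple of [p]
   from [z *: t], on which [phi2] acts as [p]. *)
have phi1t j : (j <= p.-1)%N -> (lam ^+ (p.-1 - j) *: k = 0) -> n = j ->
    phi1 *: t = phi2 *: (lam ^+ (p.-1 - j) *: e + z *: t).
  move=> jp lk nj; rewrite scalerDr scalerA mulrC -scalerA Ee scalerDr lk add0r nj.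
  rewrite (phi2_Xp1_act (v := z *: t)); last first.
    by rewrite scalerA mulrC -scalerA t1 scaler0.
  by rewrite !scalerA -exprD subnK // {1}Ez scalerDl.
have np : (n <= p.-1)%N by case: (ty) nl => /= nl; lia.
have kn0 : k <> 0.
  move=> k00; have := @m_phi2 (d *: (lam ^+ (p.-1 - n) *: e + z *: t)).
  rewrite Em k00 scaler0 add0r -scalerA (phi1t n) ?k00 ?scaler0 //; apply.
    by apply: submodZ => //; apply: submodD => //; apply: submodZ.
  by rewrite !scalerA mulrC.
have Hr := pres0_range Hp kn0 nl.
have lt_n : (n < p.-1)%N by case: (ty) Hr => //= /andP [].
have lk : lam ^+ (p.-1 - n) *: k = 0.
  by rewrite -(subnSK lt_n) exprS mulrC -scalerA k0 scaler0.
have uc : unit1 c.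
  apply: contraT => /nunit1 [//|c0 [s Ec]].
  case: (@m_phi2 (c0%:P *: k + d *: (lam ^+ (p.-1 - n) *: e + z *: t))).
    apply: submodD => //; first exact: submodZ.
    by apply: submodZ => //; apply: submodD => //; apply: submodZ.
  rewrite Em -scalerA (phi1t n) // [RHS]scalerDr; congr (_ + _).
    rewrite Ec scalerDl [lam * s]mulrC -[(s * lam) *: k]scalerA k0 scaler0 addr0.
    have kc : Xp1 *: (c0%:P *: k) = 0.
      by rewrite scalerA mulrC -scalerA (lam_Xp1_act p k0) scaler0.
    by rewrite (phi2_Xp1_act kc) scalerA.
  by rewrite !scalerA mulrC.
(* The coefficient of [lam ^+ n *: t] after [k] is expressed by [m]: replacing [d * phi1]
   contributes [- d * lam ^+ p.-1], and the multiple of [p] goes into the new [e]. *)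
pose w := c - d * lam ^+ (p.-1 - n).
have uw : unit1 w.
  rewrite /w -(subnSK lt_n) exprS.
  have -> : c - d * (lam * lam ^+ (p.-1 - n.+1)) =
    c + lam * (- (d * lam ^+ (p.-1 - n.+1))) by ring.
  exact: unit1_lam.
have MN1 v : M v -> XN1 *: v = 0 by apply: MN.
have Mm := L0m.1.
exists ty, n, (c *: e + (d * z) *: t), (w *: t); split=> //; split.
- by split=> //; [apply: submodD => //; apply: submodZ|apply: submodZ].
- split; last 1 first.
  + by rewrite scalerA mulrC -scalerA t0 scaler0.
  + have -> : phi2 *: (c *: e + (d * z) *: t) = c *: (phi2 *: e) + phi2 *: ((d * z) *: t).
      by rewrite scalerDr; congr (_ + _); rewrite !scalerA mulrC.
    rewrite Ee (phi2_Xp1_act (v := (d * z) *: t)); last first.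
      by rewrite scalerA mulrC -scalerA t1 scaler0.
    rewrite Em scalerDr !scalerA -!addrA -!scalerDl; congr (_ + _ *: _).
    rewrite /w Ez.
    have -> : lam ^+ p.-1 = lam ^+ n * lam ^+ (p.-1 - n) by rewrite -exprD subnKC.
    by ring.
  + exact: L0m.2.
- pose S := span3 (c *: e + (d * z) *: t) m (w *: t).
  have HS : submod S := submod_span3 _ _ _.
  have St : S t.
    have [w' Hw'] := unit1_act Kres V uw; rewrite -(Hw' t (MN1 _ Mt)).
    by apply: submodZ => //; exact: span3_t.
  have Sk : S k.
    have [c' Hc'] := unit1_act Kres V uc; rewrite -(Hc' k (MN1 _ Mk)).
    apply: submodZ => //; rewrite (_ : c *: k = m - (d * phi1) *: t).
      by apply: submodB => //; [exact: span3_k|exact: submodZ].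
    by rewrite Em addrK.
  have Se : S e.
    have [c' Hc'] := unit1_act Kres V uc; rewrite -(Hc' e (MN1 _ Me)).
    apply: submodZ => //.
    have -> : c *: e = (c *: e + (d * z) *: t) - (d * z) *: t by rewrite addrK.
    by apply: submodB => //; [exact: span3_e|exact: submodZ].
  move=> v /gen [q [c' [y' ->]]].
  suff : S (q *: e + c' *: k + y' *: t) by [].
  by apply: submodD => //; [apply: submodD => //; apply: submodZ|apply: submodZ].
- move=> q; rewrite scalerDr scalerDr [Xp1 *: (q *: (_ *: t))]scalerA.
  rewrite [Xp1 * q]mulrC -scalerA [Xp1 *: (_ *: t)]scalerA [Xp1 * _]mulrC -scalerA t1.
  rewrite !scaler0 addr0 [q *: _]scalerA => /free1.
  by apply: unit1_cancel_XN1 => //; exists Xp1; rewrite mulrC Xp1_phi2.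
- move=> c' y'; rewrite Em scalerDr !scalerA -addrA -scalerDl => /free2 [Hc Hy].
  have {}Hc : rdvd lam c'.
    apply: (unit1_cancel_XN1 _ uc); last by case: Hc.
    by exists (phi1 * phi2); rewrite mulrA lam_phi1 Xp1_phi2.
  split=> //; apply: (unit1_cancel uw).
  have -> : y' * w = (c' * (d * phi1) + y' * w) - c' * (d * phi1) by ring.
  apply: rdvdB => //.
  apply: rdvd_trans (gT_Xp1 ty) _.
  by have [s ->] := Hc; exists (s * d); rewrite -lam_phi1; ring.
Qed.

End Indecomposable.

(** * Lattices given by a presentation: indecomposability and invariants *)

Section Presentation.
Variables (p : nat) (K : comNzRingType) (red : {rmorphism K -> 'F_p}).
Hypothesis Kres : residue_axioms red.
Let p_pr : prime p := res_prime Kres.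
Let p_gt0 : (0 < p)%N := prime_gt0 p_pr.
Local Notation P := {poly K}.
Local Notation lam := (lamR K).
Local Notation phi1 := (phi1R K p).
Local Notation phi2 := (phi2R K p).
Local Notation Xp1 := ('X^p - 1 : P).
Local Notation XN1 := ('X^(p ^ 2) - 1 : P).
Local Notation unit1 := (unit_at1 red).
Local Notation gT := (ann_poly p K).
Local Notation lenT := (len_ty p).
Variable V : lmodType P.
Hypothesis tf : forall v : V, (p%:R : P) *: v = 0 -> v = 0.
Variables (M : V -> Prop) (HM : submod M).
Hypothesis MN : forall v, M v -> XN1 *: v = 0.
Variables (ty : bool) (n : nat) (e k t : V).
Hypothesis Hpres : pres p M ty n e k t.
Local Notation L := (annih M Xp1).

Let Me : M e. Proof. by case: Hpres => [[]]. Qed.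
Let Mk : M k. Proof. by case: Hpres => [[]]. Qed.
Let Mt : M t. Proof. by case: Hpres => [[]]. Qed.
Let Ee : phi2 *: e = k + lam ^+ n *: t. Proof. by case: Hpres => [_ []]. Qed.
Let k0 : lam *: k = 0. Proof. by case: Hpres => [_ []]. Qed.
Let t0 : gT ty *: t = 0. Proof. by case: Hpres => [_ []]. Qed.
Let k1 : Xp1 *: k = 0. Proof. exact: lam_Xp1_act. Qed.
Let t1 : Xp1 *: t = 0. Proof. exact: scale_rdvd (gT_Xp1 p K ty) t0. Qed.
Let gen v : M v -> exists q c y, v = q *: e + c *: k + y *: t.
Proof. by case: Hpres => _ _ + _ _; apply. Qed.
Let freeE q : Xp1 *: (q *: e) = 0 -> rdvd phi2 q.
Proof. by case: Hpres => _ _ _ + _; apply. Qed.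
Let freeL c y : c *: k + y *: t = 0 -> rdvd lam c /\ rdvd (gT ty) y.
Proof. by case: Hpres => _ _ _ _; apply. Qed.

Lemma scaleCA (a b : P) (v : V) : a *: (b *: v) = b *: (a *: v).
Proof. by rewrite !scalerA mulrC. Qed.

Lemma pres_L_span c y : Xp1 *: (c *: k + y *: t) = 0.
Proof. by rewrite scalerDr !(scaleCA Xp1) k1 t1 !scaler0 addr0. Qed.

Lemma pres_L v : L v -> exists c y, v = c *: k + y *: t.
Proof.
move=> [/gen [q [c [y ->]]]]; rewrite -addrA scalerDr pres_L_span addr0 => /freeE [s ->].
exists (s + c), (s * lam ^+ n + y).
by rewrite mulrC -scalerA Ee scalerDr scalerA !scalerDl addrACA addrA.
Qed.

(** [L] is pure in [M], as [p] has no torsion. So [w] lies in [L], and freeness allows the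
    coefficients to be compared. *)
Lemma pres_pM c y w : M w -> c *: k + y *: t = p%:R *: w ->
  exists c' y', [/\ w = c' *: k + y' *: t, rdvd lam (c - p%:R * c') &
     rdvd (gT ty) (y - p%:R * y')].
Proof.
move=> Mw E; have [|c' [y' Ew]] := @pres_L w.
  by split=> //; apply: tf; rewrite scaleCA -E pres_L_span.
exists c', y'; rewrite Ew in E *; split=> //.
all: have [] := @freeL (c - p%:R * c') (y - p%:R * y') => //.
all: rewrite !scalerBl -!scalerA addrACA -opprD -scalerDr E subrr //.
Qed.

Lemma pres_lamX_pM c j u w : M w -> unit1 u ->
  c *: k + (lam ^+ j * u) *: t = p%:R *: w -> (lenT ty <= j)%N.
Proof.
move=> Mw uu /(pres_pM Mw) [c' [y' [_ _ [s Es]]]].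
have [z Ez] := gT_lamX Kres ty.
apply: (lam_adic_uniq Kres (u := u) (s := s) (z := z * s + y') uu).
by rewrite -[LHS](subrK (p%:R * y')) Es Ez; ring.
Qed.

Lemma pres_p_divisible Q : (forall v, Q v -> L v) ->
  (forall v, Q v -> exists w, Q w /\ v = p%:R *: w) -> forall v, Q v -> v = 0.
Proof.
move=> QL Qp v Qv; have [c [y Ev]] := pres_L (QL _ Qv).
have Hs s : exists w, Q w /\ v = p%:R ^+ s *: w.
  elim: s => [|s [w [Qw ->]]]; first by exists v; rewrite expr0 scale1r.
  by have [w' [Qw' ->]] := Qp _ Qw; exists w'; rewrite exprSr scalerA.
have Hcy s : exists c' y', rdvd lam (c - p%:R ^+ s * c') /\ rdvd (gT ty) (y - p%:R ^+ s * y').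
  have [w [Qw Ew]] := Hs s; have [c' [y' Ew']] := pres_L (QL _ Qw).
  exists c', y'; apply: freeL.
  by rewrite !scalerBl -!scalerA addrACA -opprD -scalerDr -Ew' -Ew -Ev subrr.
have g_mon : gT ty \is monic.
  by rewrite /ann_poly; case: ty; [exact: XnS1_monic|exact: phi1_monic].
rewrite Ev (scale_rdvd _ k0) ?add0r.
  rewrite (scale_rdvd _ t0) //; apply: (red_sep_modp Kres g_mon) => s.
  have [_ [y' [_ [b Eb]]]] := Hcy s; exists y', b.
  by rewrite -Eb addrC subrK.
apply: (red_sep_modp Kres (lam_monic K)) => s.
have [c' [_ [[b Eb] _]]] := Hcy s; exists c', b.
by rewrite -Eb addrC subrK.
Qed.

Hypothesis Hrange : range_ok p ty n.

Let n_lt : (n < p.-1)%N.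
Proof. by move: Hrange; rewrite /range_ok; case: ty => // /andP []. Qed.

Let lenT_ge : (p.-1 <= lenT ty)%N.
Proof. by rewrite /len_ty; case: ty => //; exact: leq_pred. Qed.

(** If [k = phi2 *: w], comparison at [k] makes the coefficient [q] of [w] at [e] a unit, while
    comparison at [t] makes [q * lam ^+ n] vanish modulo [p] and [gT ty]. This needs
    [lenT ty <= n]. *)
Lemma pres_k_phi2 w : M w -> k <> phi2 *: w.
Proof.
move=> /gen [q [c [y ->]]]; rewrite !scalerDr [phi2 *: (q *: e)]scaleCA Ee.
rewrite (phi2_Xp1_act (v := c *: k)); last by rewrite scaleCA k1 scaler0.
rewrite (phi2_Xp1_act (v := y *: t)); last by rewrite scaleCA t1 scaler0.
rewrite scalerDr !scalerA => E.
have [[s Hs] [s' Hs']] : rdvd lam (q + p%:R * c - 1) /\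
    rdvd (gT ty) (q * lam ^+ n + p%:R * y).
  apply: freeL; rewrite scalerBl scale1r !scalerDl addrAC; apply/eqP.
  by rewrite subr_eq0; apply/eqP; rewrite [RHS]E addrACA addrA.
have uq : unit1 q.
  have -> : q = 1 + lam * s + p%:R * (- c) by rewrite -Hs; ring.
  by apply: (unit1_mod Kres); exact: unit11.
have [z Ez] := gT_lamX Kres ty.
have : (lenT ty <= n)%N.
  apply: (lam_adic_uniq Kres (u := q) (s := s') (z := z * s' - y) uq).
  by rewrite -[LHS](addrK (p%:R * y)) [_ ^+ _ * q]mulrC Hs' Ez; ring.
by move: n_lt lenT_ge; lia.
Qed.

Let unit_nunit (a b : P) : rdvd phi2 (1 - (a + b)) -> unit1 a \/ unit1 b.
Proof.
move=> [s E]; have [ua|] := boolP (unit1 a); first by left.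
rewrite negbK => /eqP a0; right; have := unit11 red.
have -> : 1 = (a + b) + phi2 * s by rewrite -E; ring.
rewrite /unit_at1 !hornerD hornerM horner_phi2 !rmorphD rmorphM /= a0 add0r.
by rewrite (red_p Kres) mul0r addr0.
Qed.

Section Summand.
Variables (P1 P2 : V -> Prop).
Hypotheses (HP1 : submod P1) (HP2 : submod P2).
Hypotheses (P1M : forall v, P1 v -> M v) (P2M : forall v, P2 v -> M v).
Hypothesis P12 : forall v, M v -> exists u w, [/\ P1 u, P2 w & v = u + w].
Hypothesis P12_0 : forall v, P1 v -> P2 v -> v = 0.

Lemma direct_uniq u w u' w' : P1 u -> P2 w -> P1 u' -> P2 w' ->
  u + w = u' + w' -> u = u' /\ w = w'.
Proof.
move=> Pu Pw Pu' Pw' E; have E' : u - u' = w' - w.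
  by apply/eqP; rewrite subr_eq addrAC eq_sym subr_eq addrC E addrC.
have uu : u - u' = 0 by apply: P12_0; [exact: submodB|rewrite E'; exact: submodB].
split; apply/eqP; first by rewrite -subr_eq0 uu.
by rewrite eq_sym -subr_eq0 -E' uu.
Qed.

Lemma direct0 u w : P1 u -> P2 w -> u + w = 0 -> u = 0 /\ w = 0.
Proof.
move=> Pu Pw E; apply: direct_uniq => //; [exact: HP1.1|exact: HP2.1|].
by rewrite addr0.
Qed.

(* [P2] lies in [L] because [w] does; comparing components of [k] and [t] modulo
   [p] then makes it [p]-divisible. *)
Lemma summand_zero u w : P1 u -> P2 w -> e = u + w -> Xp1 *: w = 0 ->
  forall v, P2 v -> v = 0.
Proof.
move=> Pu Pw Eew w0.
have P2L v : P2 v -> L v.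
  move=> Pv; split; first exact: P2M.
  have [q [c [y Ev]]] := gen (P2M Pv).
  have [|l1 [l2 [Pl1 Pl2 El]]] := @P12 (c *: k + y *: t).
    by apply: submodD => //; apply: submodZ.
  have [_ l20] : Xp1 *: l1 = 0 /\ Xp1 *: l2 = 0.
    by apply: direct0; [exact: submodZ|exact: submodZ|rewrite -scalerDr -El pres_L_span].
  have [_ ->] : 0 = q *: u + l1 /\ v = q *: w + l2.
    apply: direct_uniq => //; first exact: HP1.1.
    - by apply: submodD => //; apply: submodZ.
    - by apply: submodD => //; apply: submodZ.
    by rewrite add0r Ev -addrA El Eew scalerDr addrACA.
  by rewrite scalerDr scaleCA w0 scaler0 add0r l20.
have [k1' [k2 [Pk1 Pk2 Ek]]] := P12 Mk.
have [t1' [t2 [Pt1 Pt2 Et]]] := P12 Mt.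
have [_ k20] : lam *: k1' = 0 /\ lam *: k2 = 0.
  by apply: direct0; [exact: submodZ|exact: submodZ|rewrite -scalerDr -Ek].
have [_ t20] : gT ty *: t1' = 0 /\ gT ty *: t2 = 0.
  by apply: direct0; [exact: submodZ|exact: submodZ|rewrite -scalerDr -Et].
have comp v c y : P2 v -> v = c *: k + y *: t -> v = c *: k2 + y *: t2.
  move=> Pv Ev; have [_ ->//] : 0 = c *: k1' + y *: t1' /\ v = c *: k2 + y *: t2.
  apply: direct_uniq => //; first exact: HP1.1.
  - by apply: submodD => //; apply: submodZ.
  - by apply: submodD => //; apply: submodZ.
  by rewrite add0r Ev Ek Et !scalerDr addrACA.
have Epw : p%:R *: w = k2 + lam ^+ n *: t2.
  rewrite -(phi2_Xp1_act w0).
  have [_ //] : phi2 *: u = k1' + lam ^+ n *: t1' /\ phi2 *: w = k2 + lam ^+ n *: t2.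
  apply: direct_uniq; try exact: submodZ.
  - by apply: submodD => //; apply: submodZ.
  - by apply: submodD => //; apply: submodZ.
  by rewrite -scalerDr -Eew Ee Ek Et !scalerDr addrACA.
have [c [d Ed]] := pres_L (P2L _ Pt2).
have Et2 := comp _ _ _ Pt2 Ed.
have k2E : k2 = p%:R *: w - lam ^+ n *: t2 by rewrite Epw addrK.
have Mw : M w by exact: P2M.
have t2_div : (exists w', P2 w' /\ t2 = p%:R *: w') -> forall v, P2 v -> v = 0.
  move=> [w' [Pw' Ew']]; apply: (pres_p_divisible P2L _) => v Pv.
  have [a [b Ev]] := pres_L (P2L _ Pv).
  exists (a *: (w - lam ^+ n *: w') + b *: w'); split.
    apply: submodD => //; apply: submodZ => //; apply: submodB => //.
    exact: submodZ.
  rewrite (comp _ _ _ Pv Ev) k2E Ew' [RHS]scalerDr.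
  congr (_ + _); last exact: scaleCA.
  by rewrite [RHS]scaleCA [in RHS]scalerBr; congr (_ *: (_ - _)); exact: scaleCA.
(* Both cases combine [t2 = c *: k2 + d *: t2] with [p%:R *: w = k2 + lam ^+ n *: t2]. If [1 - d] is
   a unit, [t2] is [p] times a vector of [P2]. Otherwise [d] is a unit, and up to a multiple of [k]
   a too small power of [lam], times a unit, sends [t] into [p M]. *)
have [/andP [Ety n0]|Ety] : (ty && (0 < n)%N) \/ ty = false.
  by case: (ty) Hrange => /= H; [left; case/andP: H|right].
- have Et2' : (1 - d + c * lam ^+ n) *: t2 = p%:R *: (c *: w).
    rewrite scalerDl scalerBl scale1r {1}Et2 addrK -scalerA -scalerDr.
    by rewrite scaleCA Epw.
  have [u1|nu] := boolP (unit1 (1 - d + c * lam ^+ n)).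
    apply: t2_div; have [U HU] := unit1_act Kres V u1.
    exists (U *: (c *: w)); split; first by do 2 apply: submodZ => //.
    by rewrite scaleCA -Et2' HU // MN //; exact: P2M.
  have ud : unit1 d.
    apply: contraR nu => /nunit1 [//|c0 [s ->]].
    rewrite -(prednK n0) exprS.
    have -> : 1 - (p%:R * c0%:P + lam * s) + c * (lam * lam ^+ n.-1) =
      1 + lam * (c * lam ^+ n.-1 - s) + p%:R * (- c0%:P) by ring.
    by apply: (unit1_mod Kres); exact: unit11.
  (* One factor [lam] removes the terms at [k]; the exponent [n.+1] is still below [p]. *)
  have : (lenT ty <= n.+1)%N.
    apply: (@pres_lamX_pM 0 n.+1 d (lam *: w)) => //; first exact: submodZ.
    rewrite scaleCA Epw scalerDr k20 add0r scale0r add0r Ed.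
    rewrite (scaleCA lam) [lam *: (_ + _)]scalerDr (scaleCA lam c) k0 scaler0 add0r.
    by rewrite !scalerA exprSr.
  by move: n_lt; rewrite /len_ty Ety; lia.
have t0' : phi1 *: t = 0 by move: t0; rewrite Ety.
rewrite Ety in t20.
have ck : c *: k = 0.
  apply: tf; have : phi1 *: t2 = 0 by [].
  by rewrite Ed scalerDr !(scaleCA phi1) t0' scaler0 addr0 (phi1_lam_act p k0) scaleCA.
have ck2 : c *: k2 = 0.
  have [[s ->] _] : rdvd lam c /\ rdvd (gT ty) 0.
    by apply: freeL; rewrite ck scale0r addr0.
  by rewrite mulrC -scalerA k20 scaler0.
have [a [b Ek2]] := pres_L (P2L _ Pk2).
have bt : b *: t = 0.
  apply: tf; have lbt : lam *: (b *: t) = 0.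
    by have := k20; rewrite Ek2 scalerDr (scaleCA lam a) k0 scaler0 add0r.
  by rewrite -(phi1_lam_act p lbt) scaleCA t0' scaler0.
rewrite {}bt addr0 in Ek2.
have Ed0 : (1 - d) *: t2 = 0 by rewrite scalerBl scale1r {1}Et2 ck2 add0r subrr.
have [u1|nu] := boolP (unit1 (1 - d)).
  apply: t2_div; have [U HU] := unit1_act Kres V u1.
  exists 0; split; first exact: HP2.1.
  by rewrite -(HU t2) ?Ed0 ?scaler0 // MN //; exact: P2M.
have ud : unit1 d.
  apply: contraR nu => /nunit1 [//|c0 [s ->]].
  have -> : 1 - (p%:R * c0%:P + lam * s) = 1 + lam * (- s) + p%:R * (- c0%:P) by ring.
  by apply: (unit1_mod Kres); exact: unit11.
have : (lenT ty <= n)%N.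
  apply: (@pres_lamX_pM a n d w) => //.
  by rewrite Epw -Ek2 Ed ck add0r scalerA.
by move: n_lt lenT_ge; lia.
Qed.

End Summand.

(** The coefficients [q], [q'] at [e] of the two components of [e] add up to 1 modulo [phi2]. Their
    product is 0 there, since [Xp1 *: (q' *: u)] lies in both summands. One of them is a unit, so
    the other is 0 modulo [phi2]; its component lies in [L], and [summand_zero] applies. *)
Lemma pres_indecomposable (P1 P2 : V -> Prop) : submod P1 -> submod P2 ->
  (forall v, P1 v -> M v) -> (forall v, P2 v -> M v) ->
  (forall v, M v -> exists u w, [/\ P1 u, P2 w & v = u + w]) ->
  (forall v, P1 v -> P2 v -> v = 0) ->
  (forall v, P1 v -> v = 0) \/ (forall v, P2 v -> v = 0).
Proof.
move=> HP1 HP2 P1M P2M P12 P12_0; have [u [w [Pu Pw Eew]]] := P12 _ Me.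
have [q [c [y Eu]]] := gen (P1M _ Pu); have [q' [c' [y' Ew]]] := gen (P2M _ Pw).
have qq : rdvd phi2 (1 - (q + q')).
  have Ee' : e = (q *: e + c *: k + y *: t) + (q' *: e + c' *: k + y' *: t).
    by rewrite -Eu -Ew.
  apply: freeE; rewrite (_ : _ *: e = (c + c') *: k + (y + y') *: t) ?pres_L_span //.
  rewrite scalerBl scale1r {1}Ee' !scalerDl; apply/eqP; rewrite subr_eq; apply/eqP.
  by rewrite [LHS]addrACA [X in X + _]addrACA [RHS]addrC [RHS]addrA.
have Xe (r : P) c0 y0 v : v = r *: e + c0 *: k + y0 *: t -> forall r', Xp1 *: (r' *: v) = Xp1 *: ((r' * r) *: e).
  move=> -> r'; rewrite -addrA scalerDr scalerA scalerDr [X in _ + X]scaleCA.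
  by rewrite pres_L_span scaler0 addr0.
have q'u : Xp1 *: (q' *: u) = 0.
  apply: P12_0; first by do 2 apply: submodZ => //.
  rewrite (Xe _ _ _ _ Eu) mulrC -(Xe _ _ _ _ Ew).
  by do 2 apply: submodZ => //.
have dq'q : rdvd phi2 (q' * q) by apply: freeE; rewrite -(Xe _ _ _ _ Eu).
have dX : rdvd phi2 XN1 by exists Xp1; rewrite mulrC Xp1_phi2.
have X0 r c0 y0 v : M v -> v = r *: e + c0 *: k + y0 *: t -> rdvd phi2 r -> Xp1 *: v = 0.
  move=> Mv Ev [s Es]; rewrite -[v]scale1r (Xe _ _ _ _ Ev) mul1r Es scalerA mulrA Xp1_phi2.
  by rewrite mulrC -scalerA MN ?scaler0.
have [uq|uq'] := unit_nunit qq.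
  right; apply: (summand_zero HP1 HP2 P2M P12 P12_0 Pu Pw Eew).
  apply: (X0 _ _ _ _ (P2M _ Pw) Ew).
  exact: (unit1_cancel_XN1 Kres dX uq).
left; apply: (summand_zero HP2 HP1 P1M _ _ Pw Pu).
- by move=> v /P12 [u' [w' [Pu' Pw' ->]]]; exists w', u'; split=> //; rewrite addrC.
- by move=> v Pv Pv'; apply: P12_0.
- by rewrite Eew addrC.
apply: (X0 _ _ _ _ (P1M _ Pu) Eu).
by apply: (unit1_cancel_XN1 Kres dX uq'); rewrite mulrC.
Qed.

(** With [j > 0] the factor [lam ^+ j] kills [k], so [e] goes to [lam ^+ (n + j) *: t]; on [L] the
    factor [phi2] is already [p]. Modulo [p] the annihilator of [t] is [lam ^+ lenT ty]. *)
Lemma pres_invariant_phi2 j : (0 < j)%N ->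
  (forall v, M v -> exists w, M w /\ (lam ^+ j * phi2) *: v = p%:R *: w) <->
  (lenT ty <= n + j)%N.
Proof.
move=> j0; have lamk : lam ^+ j *: k = 0.
  by rewrite -(prednK j0) exprS mulrC -scalerA k0 scaler0.
have Ej : (lam ^+ j * phi2) *: e = lam ^+ (n + j) *: t.
  by rewrite -scalerA Ee scalerDr lamk add0r scalerA -exprD addnC.
split=> [/(_ e Me) [w [Mw]]|le_len v /gen [q [c [y ->]]]].
  rewrite Ej => E; apply: (@pres_lamX_pM 0 _ 1 w Mw (unit11 red)).
  by rewrite scale0r add0r mulr1.
have [z Ez] := gT_lamX Kres ty.
have Et : lam ^+ (n + j) *: t = p%:R *: (- (lam ^+ (n + j - lenT ty) * z) *: t).
  rewrite -(subnK le_len) exprD addnK scaleCA.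
  have -> : lam ^+ lenT ty = gT ty - p%:R * z by rewrite Ez addrK.
  rewrite -scalerA scalerBl t0 sub0r -!scalerA scalerN scaleNr.
  by rewrite -scalerA (scaleCA p%:R).
exists (q *: (- (lam ^+ (n + j - lenT ty) * z) *: t) +
  (lam ^+ j *: (c *: k) + lam ^+ j *: (y *: t))); split.
  apply: submodD => //; first by do 2 apply: submodZ => //.
  by apply: submodD => //; do 2 apply: submodZ => //.
rewrite -addrA scalerDr [_ *: (q *: e)]scaleCA Ej Et [RHS]scalerDr (scaleCA q); congr (_ + _).
rewrite -scalerA -phi2_Xp1_act -scalerDr; first by rewrite scaleCA.
by rewrite scaleCA pres_L_span scaler0.
Qed.

(** [phi1] acts on [k] as [p]. On [t] it is 0 in the cyclotomic case; in the free case it is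
    [lam ^+ p.-1] modulo [p], one exponent short of [p]. *)
Lemma pres_invariant_phi1 :
  (forall v, L v -> exists w, M w /\ phi1 *: v = p%:R *: w) <-> ty = false.
Proof.
split=> [H|Ety v /pres_L [c [y ->]]].
  apply: contraTF isT => Ety; have [z Ez] := phi1_lamX Kres.
  have [|w [Mw Ew]] := H t; first by split.
  have : (lenT ty <= p.-1)%N.
    apply: (@pres_lamX_pM 0 _ 1 (w - z *: t) _ (unit11 red)).
      by apply: submodB => //; exact: submodZ.
    rewrite scale0r add0r mulr1 scalerBr -Ew Ez scalerDl.
    by rewrite -scalerA addrK.
  by rewrite /len_ty Ety; lia.
exists (c *: k); split; first exact: submodZ.
have t0' : phi1 *: t = 0 by move: t0; rewrite Ety.
by rewrite scalerDr !(scaleCA phi1) t0' scaler0 addr0 (phi1_lam_act p k0) scaleCA.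
Qed.

Lemma pres_Xp1_e : Xp1 *: e <> 0.
Proof.
by move=> E; apply: (nunit1_phi2 Kres); apply: freeE; rewrite scale1r.
Qed.

End Presentation.

(* Row vectors as a module over [K[X]], with ['X] acting as [A]. *)
Definition matmod (K : comNzRingType) (F : fieldType) (iota : {rmorphism K -> F})
  (N : nat) (A : 'M[F]_N) : Type := 'rV[F]_N.

(** * Evaluation of polynomials at a matrix *)

Section HornerMatrix.
Variables (K : comNzRingType) (F : fieldType) (iota : {rmorphism K -> F}).
Variables (N : nat) (A : 'M[F]_N).

Definition hornermx (q : {poly K}) : 'M[F]_N := \sum_(i < size q) iota q`_i *: A ^+ i.

Lemma hornermx_wide n (q : {poly K}) : (size q <= n)%N ->
  hornermx q = \sum_(i < n) iota q`_i *: A ^+ i.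
Proof.
move=> qn; rewrite /hornermx (big_ord_widen _ (fun i => iota q`_i *: A ^+ i) qn).
rewrite big_mkcond; apply: eq_bigr => i _; case: ltnP => // /leq_sizeP -> //.
by rewrite rmorph0 scale0r.
Qed.

Lemma hornermxD : {morph hornermx : q r / q + r}.
Proof.
move=> q r; pose n := maxn (size (q + r)) (maxn (size q) (size r)).
rewrite !(@hornermx_wide n) /n ?leq_max ?leqnn ?orbT // -big_split.
by apply: eq_bigr => i _ /=; rewrite coefD rmorphD scalerDl.
Qed.

Lemma hornermxC c : hornermx c%:P = (iota c)%:M.
Proof.
rewrite (@hornermx_wide 1) ?size_polyC ?leq_b1 // big_ord1 coefC /= expr0.
by rewrite scalemx1.
Qed.

Lemma hornermxMX q : hornermx (q * 'X) = hornermx q * A.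
Proof.
rewrite (@hornermx_wide (size q).+1); last first.
  by apply: (leq_trans (size_polyMleq _ _)); rewrite size_polyX addn2.
rewrite big_ord_recl coefMX eqxx rmorph0 scale0r add0r mulr_suml.
by apply: eq_bigr => i _; rewrite coefMX /= /bump /= add1n -[RHS]scalemxAl exprSr.
Qed.

Lemma hornermx_comm q : hornermx q * A = A * hornermx q.
Proof.
rewrite mulr_suml mulr_sumr; apply: eq_bigr => i _.
by rewrite -[LHS]scalemxAl -[RHS]scalemxAr; congr (_ *: _); rewrite -[LHS]exprSr -[RHS]exprS.
Qed.

Lemma hornermxM : {morph hornermx : q r / q * r}.
Proof.
move=> q r; elim/poly_ind: q => [|q c IH].
  rewrite mul0r -polyC0 hornermxC rmorph0; have -> : (0 : F)%:M = 0 :> 'M[F]_N.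
    by rewrite raddf0.
  by rewrite mul0r.
have HC d s : hornermx (d%:P * s) = (iota d)%:M * hornermx s.
  have sz : (size (d%:P * s)%R <= size s)%N by rewrite mul_polyC size_scale_leq.
  rewrite (hornermx_wide sz) /hornermx mulr_sumr; apply: eq_bigr => i _.
  by rewrite coefCM rmorphM -scalerA; apply/esym; exact: mul_scalar_mx.
rewrite mulrDl hornermxD HC hornermxD mulrDl hornermxC; congr (_ + _).
have -> : q * 'X * r = q * r * 'X by rewrite mulrAC.
by rewrite !hornermxMX IH -!mulrA hornermx_comm.
Qed.

Local Notation matmod := (matmod iota A).
HB.instance Definition _ := GRing.Zmodule.copy matmod 'rV[F]_N.

Definition matact (q : {poly K}) (v : matmod) : matmod := v *m hornermx q.

Lemma matactA q r v : matact q (matact r v) = matact (q * r) v.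
Proof. by rewrite /matact -mulmxA -[hornermx r *m _]hornermxM mulrC. Qed.

Lemma matact1 : left_id 1 matact.
Proof. by move=> v; rewrite /matact -polyC1 hornermxC rmorph1 mulmx1. Qed.

Lemma matactDr : right_distributive matact +%R.
Proof. by move=> q v w; rewrite /matact [LHS]mulmxDl. Qed.

Lemma matactDl v : {morph matact^~ v : q r / q + r}.
Proof. by move=> q r; rewrite /matact hornermxD [LHS]mulmxDr. Qed.

HB.instance Definition _ := GRing.Zmodule_isLmodule.Build {poly K} matmod
  matactA matact1 matactDr matactDl.

Lemma matmod_scaleE q (v : matmod) : q *: v = v *m hornermx q.
Proof. by []. Qed.

Lemma matmodC c (v : matmod) : c%:P *: v = iota c *: (v : 'rV_N).
Proof. by rewrite matmod_scaleE hornermxC mul_mx_scalar. Qed.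

Lemma hornermx_Xn n : hornermx 'X^n = A ^+ n.
Proof.
elim: n => [|n IH]; first by rewrite expr0 -polyC1 hornermxC rmorph1.
by rewrite exprSr hornermxMX IH exprSr.
Qed.

Lemma matmodXn n (v : matmod) : 'X^n *: v = v *m A ^+ n.
Proof. by rewrite matmod_scaleE hornermx_Xn. Qed.

Lemma matmodX (v : matmod) : 'X *: v = v *m A.
Proof. by rewrite -[X in X *: v]expr1 matmodXn expr1. Qed.

End HornerMatrix.

Lemma matmod_map (K : comNzRingType) (F : fieldType) (iota : {rmorphism K -> F}) N (A : 'M[F]_N)
    (q : {poly K}) (v : 'rV[F]_N) :
  (q *: (v : matmod iota A) : 'rV_N) =
  map_poly iota q *: (v : matmod (idfun : {rmorphism F -> F}) A).
Proof.
rewrite !matmod_scaleE; congr (_ *m _).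
rewrite [RHS](@hornermx_wide _ _ _ _ _ (size q)) ?size_poly // /hornermx.
by apply: eq_bigr => i _; rewrite coef_map.
Qed.

Lemma matmod_XN1 (K : comNzRingType) (F : fieldType) (iota : {rmorphism K -> F}) N
    (A : 'M[F]_N) n (v : matmod iota A) : A ^+ n = 1 -> ('X^n - 1 : {poly K}) *: v = 0.
Proof.
move=> An; rewrite scalerBl scale1r matmodXn An; apply/eqP; rewrite subr_eq0.
by rewrite [v *m 1]mulmx1.
Qed.

Lemma mulmx_id (F : fieldType) N (B : 'M[F]_N) : (forall v : 'rV_N, v *m B = v) -> B = 1.
Proof. by move=> H; apply/row_matrixP => i; rewrite [LHS]rowE H row1. Qed.

(** * The group ring of a cyclic group as row vectors *)

Section GroupRing.
Variables (F : fieldType) (n : nat).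
Hypothesis n_gt0 : (0 < n)%N.
Local Notation f := ('X^n - 1 : {poly F}).

Definition grv (q : {poly F}) : 'rV[F]_n := \row_(j < n) (q %% ('X^n - 1))`_j.

Lemma grvD q r : grv (q + r) = grv q + grv r.
Proof. by apply/rowP => j; rewrite !mxE modpD coefD. Qed.

Lemma grvZ c q : grv (c *: q) = c *: grv q.
Proof. by apply/rowP => j; rewrite !mxE modpZl coefZ. Qed.

Lemma grv0 : grv 0 = 0.
Proof. by apply/rowP => j; rewrite !mxE mod0p coef0. Qed.

Lemma grv_eq0 q : grv q = 0 <-> rdvd f q.
Proof.
split=> [q0|[s ->]]; last first.
  by apply/rowP => j; rewrite !mxE modp_mulr coef0.
exists (q %/ f); rewrite mulrC {1}(divp_eq q f); suff -> : q %% f = 0 by rewrite addr0.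
apply/polyP => i; rewrite coef0; have [ltin|lein] := ltnP i n.
  by move/rowP/(_ (Ordinal ltin)): q0; rewrite !mxE.
apply/leq_sizeP: lein; rewrite -ltnS -[in X in (_ < X)%N](size_XnS1 F n_gt0).
by rewrite ltn_modp monic_neq0 // XnS1_monic.
Qed.

Lemma grv_mod q r : rdvd f (q - r) -> grv q = grv r.
Proof. by move=> /grv_eq0; rewrite -scaleN1r grvD grvZ scaleN1r => /subr0_eq. Qed.

Lemma grvXn i (j : 'I_n) : (i < n)%N -> grv 'X^i 0 j = ((j : nat) == i)%:R.
Proof.
move=> ltin; rewrite mxE modp_small ?coefXn //.
by rewrite size_XnS1 // size_polyXn ltnS.
Qed.

Lemma grvX q : grv (q * 'X) = grv q *m shiftmx F n.
Proof.
have HXn i : (i < n)%N -> grv ('X^i * 'X) = grv 'X^i *m shiftmx F n.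
  move=> ltin; apply/rowP => j; rewrite [RHS]mxE (bigD1 (Ordinal ltin)) //=.
  have SE (l j' : 'I_n) : shiftmx F n l j' = ((j' : nat) == (l.+1 %% n)%N)%:R by rewrite mxE.
  rewrite grvXn // eqxx mul1r SE /= big1 ?addr0 => [|l]; last first.
    by rewrite -val_eqE grvXn //= => /negPf ->; rewrite mul0r.
  rewrite -exprSr; have [Sin|nSi] := ltnP i.+1 n.
    by rewrite grvXn // modn_small.
  have Sn : i.+1 = n by apply/eqP; rewrite eqn_leq ltin.
  rewrite Sn modnn (@grv_mod _ 'X^0) ?grvXn //.
  by rewrite expr0; exact: rdvd_refl.
pose r := q %% f.
have Er : grv q = grv r.
  by apply: grv_mod; exists (q %/ f); rewrite {1}(divp_eq q f) /r addrK mulrC.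
have -> : grv (q * 'X) = grv (r * 'X).
  apply: grv_mod; exists (q %/ f * 'X).
  by rewrite {1}(divp_eq q f) /r; ring.
have sz_r : (size r <= n)%N.
  rewrite -ltnS -[in X in (_ < X)%N](size_XnS1 F n_gt0).
  by rewrite ltn_modp monic_neq0 // XnS1_monic.
rewrite {}Er -(coefK r) (poly_def (size r)); clearbody r.
have gsum (I : Type) (s : seq I) (G : I -> {poly F}) : grv (\sum_(i <- s) G i) = \sum_(i <- s) grv (G i).
  by elim/big_rec2: _ => [|i x y _ <-]; rewrite ?grv0 ?grvD.
rewrite mulr_suml !gsum mulmx_suml; apply: eq_bigr => i _.
by rewrite -scalerAl !grvZ HXn ?scalemxAl // (leq_trans (ltn_ord i)).
Qed.

Local Notation idF := (idfun : {rmorphism F -> F}).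

Lemma grv_act (r q : {poly F}) : r *: (grv q : matmod idF (shiftmx F n)) = grv (r * q).
Proof.
elim/poly_ind: r q => [|r c IH] q; first by rewrite scale0r mul0r grv0.
rewrite scalerDl -scalerA matmodX -grvX IH matmodC -grvZ -grvD; congr (grv _).
by rewrite -mul_polyC; ring.
Qed.

Lemma shiftmx_n : shiftmx F n ^+ n = 1.
Proof.
apply: mulmx_id => v.
have -> : v = grv (\poly_(i < n) (if insub i is Some j then v 0 j else 0)).
  apply/rowP => j; rewrite mxE modp_small ?coef_poly ?ltn_ord ?valK //.
  by rewrite size_XnS1 // ltnS size_poly.
rewrite -(@matmodXn _ _ idF) grv_act; apply: grv_mod.
set q := \poly_(_ < _) _; exists q; ring.
Qed.

Lemma row_mx_act N1 N2 (A : 'M[F]_N1) (B : 'M[F]_N2) (r : {poly F}) (u : 'rV_N1) (v : 'rV_N2) :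
  r *: (row_mx u v : matmod idF (block_mx A 0 0 B)) =
  row_mx (r *: (u : matmod idF A)) (r *: (v : matmod idF B)).
Proof.
elim/poly_ind: r u v => [|r c IH] u v; first by rewrite !scale0r row_mx0.
rewrite !scalerDl -!scalerA !matmodX !matmodC mul_row_block !mulmx0 addr0 add0r IH.
by rewrite [c *: row_mx _ _]scale_row_mx [LHS]add_row_mx.
Qed.

Lemma block_shiftmx_n : block_mx (shiftmx F n) 0 0 (shiftmx F n) ^+ n = 1.
Proof.
apply: mulmx_id => v; rewrite -[v]hsubmxK -(@matmodXn _ _ idF) row_mx_act !matmodXn.
by rewrite shiftmx_n ![_ *m 1]mulmx1.
Qed.

End GroupRing.

(** * Descent of divisibility and presentations from [F] to [K] *)

Section Descent.
Variables (p : nat) (F : fieldType) (K : F -> Prop).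
Variables (K0 : comNzRingType) (iota : {rmorphism K0 -> F}).
Hypothesis iota_inj : injective iota.
Hypothesis KE : forall x, K x <-> exists y, iota y = x.
Hypothesis p_gt0 : (0 < p)%N.
Local Notation idF := (idfun : {rmorphism F -> F}).
Variables (N : nat) (A : 'M[F]_N).

(** Division by a monic polynomial commutes with [iota], so the remainder over [K0] becomes 0 over
    [F]. *)
Lemma rdvd_map (d q : {poly K0}) : d \is monic ->
  rdvd (map_poly iota d) (map_poly iota q) -> rdvd d q.
Proof.
move=> d_mon [s Es]; exists (Pdiv.Ring.rdivp q d).
set r := Pdiv.Ring.rmodp q d.
have Eq := Pdiv.RingMonic.rdivp_eq d_mon q; rewrite -/r in Eq.
suff r0 : r = 0 by rewrite {1}Eq r0 addr0 mulrC.
have md_mon : map_poly iota d \is monic by exact: monic_map.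
have sz_r : (size (map_poly iota r) < size (map_poly iota d))%N.
  rewrite [X in (_ < X)%N]size_map_poly_id0 ?(monicP d_mon) ?rmorph1 ?oner_neq0 //; apply: leq_ltn_trans (size_poly _ _) _.
  by rewrite Pdiv.CommonRing.ltn_rmodpN0 // monic_neq0.
have : map_poly iota r %% map_poly iota d = 0.
  have -> : map_poly iota r = map_poly iota d * (s - map_poly iota (Pdiv.Ring.rdivp q d)).
    by rewrite mulrBr -Es {1}Eq rmorphD rmorphM /=; ring.
  by rewrite modp_mulr.
rewrite modp_small // => /polyP r0; apply/polyP => i; apply: iota_inj.
by rewrite coef0 rmorph0 -coef_map r0 coef0.
Qed.

Lemma KG_span_poly n (gens : seq 'rV[F]_N) (v : 'rV[F]_N) : (0 < n)%N -> A ^+ n = 1 ->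
  KG_span K n A gens v <->
  exists q : nat -> {poly K0}, v = \sum_(g < size gens) q g *: (gens`_g : matmod iota A).
Proof.
move=> n0 An; have act (q : {poly K0}) (w : matmod iota A) : (size q <= n)%N ->
    q *: w = \sum_(k < n) iota q`_k *: (w *m A ^+ k : 'rV_N).
  move=> sz; rewrite matmod_scaleE (hornermx_wide _ _ sz) mulmx_sumr.
  by apply: eq_bigr => k _; rewrite scalemxAr.
split=> [[c [Kc ->]]|[q ->]].
  have /choice [d Hd] : forall gk : nat * nat, exists y, iota y = c gk.1 gk.2.
    by move=> [g k]; apply/KE/Kc.
  exists (fun g => \poly_(k < n) d (g, k)); apply: eq_bigr => g _.
  rewrite act ?size_poly //; apply: eq_bigr => k _.
  by rewrite coef_poly ltn_ord Hd.
pose r g := Pdiv.Ring.rmodp (q g) ('X^n - 1).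
have sz_r g : (size (r g) <= n)%N.
  rewrite -ltnS -[in X in (_ < X)%N](size_XnS1 K0 n0).
  by rewrite Pdiv.CommonRing.ltn_rmodpN0 // monic_neq0 // XnS1_monic.
exists (fun g k => iota (r g)`_k); split; first by move=> g k; apply/KE; exists (r g)`_k.
apply: eq_bigr => g _; rewrite -act //.
rewrite {1}(Pdiv.RingMonic.rdivp_eq (XnS1_monic K0 n0) (q g)) -/(r g).
by rewrite scalerDl -scalerA matmod_XN1 // scaler0 add0r.
Qed.

(** Relations and freeness are checked over [F], where the models are explicit polynomials; only
    membership and generation concern the lattice. The presentation of the [F]-span serves to extend
    an isomorphism of lattices to the ambient spaces. *)
Lemma pres_descent (M : 'rV[F]_N -> Prop) ty n (e k t : 'rV[F]_N) :
  submod (M : matmod iota A -> Prop) ->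
  M e -> M k -> M t ->
  phi2R F p *: (e : matmod idF A) = k + lamR F ^+ n *: (t : matmod idF A) ->
  lamR F *: (k : matmod idF A) = 0 -> ann_poly p F ty *: (t : matmod idF A) = 0 ->
  (forall v, M v -> exists q c y : {poly K0}, v =
     q *: (e : matmod iota A) + c *: (k : matmod iota A) + y *: (t : matmod iota A)) ->
  (forall q : {poly F}, ('X^p - 1 : {poly F}) *: (q *: (e : matmod idF A)) = 0 ->
     rdvd (phi2R F p) q) ->
  (forall c y : {poly F}, c *: (k : matmod idF A) + y *: (t : matmod idF A) = 0 ->
     rdvd (lamR F) c /\ rdvd (ann_poly p F ty) y) ->
  pres p (M : matmod iota A -> Prop) ty n e k t /\
  pres p (fspan M : matmod idF A -> Prop) ty n e k t.
Proof.
move=> HM Me Mk Mt Ee k0 t0 gen freeE freeL.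
have map_gT ty' : map_poly iota (ann_poly p K0 ty') = ann_poly p F ty'.
  case: ty'; last exact: map_phi1.
  by rewrite /ann_poly rmorphB /= rmorph1 map_polyXn.
have Mspan v : M v -> fspan M v.
  move=> Mv; exists [:: (1, v)]; rewrite big_seq1 /= scale1r; split=> //.
  by move=> x; rewrite inE => /eqP ->.
split; split.
- by split.
- split.
  + rewrite matmod_map map_phi2 Ee; congr (_ + _).
    by rewrite [RHS]matmod_map rmorphXn /= map_lam.
  + by rewrite matmod_map map_lam.
  + by rewrite matmod_map map_gT.
- exact: gen.
- move=> q; rewrite matmod_map (matmod_map iota A q e) rmorphB /= rmorph1 map_polyXn.
  move=> /freeE; rewrite -(map_phi2 iota); apply: rdvd_map.
  exact: phi2_monic.
- move=> c y; rewrite (matmod_map iota A c k) (matmod_map iota A y t) => /freeL [].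
  rewrite -(map_lam iota) -map_gT => Hc Hy; split; apply: rdvd_map => //.
    exact: lam_monic.
  by rewrite /ann_poly; case: (ty); [exact: XnS1_monic|exact: phi1_monic].
- by split; apply: Mspan.
- by [].
- move=> v [s [Hs ->]].
  suff : span3 (e : matmod idF A) k t (\sum_(x <- s) x.1 *: x.2) by [].
  have HS := @submod_span3 _ _ (e : matmod idF A) k t.
  elim: s Hs => [|x s IH] Hs; first by rewrite big_nil; exact: HS.1.
  rewrite big_cons; apply: (submodD HS); last first.
    by apply: IH => y ys; apply: Hs; rewrite inE ys orbT.
  rewrite -[x.1 *: x.2](@matmodC _ _ idF _ A); apply: (submodZ HS).
  have [|q [c [y ->]]] := gen x.2; first by apply: Hs; rewrite inE eqxx.
  exists (map_poly iota q), (map_poly iota c), (map_poly iota y).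
  by rewrite (matmod_map iota A q e) (matmod_map iota A c k) (matmod_map iota A y t).
- exact: freeE.
- exact: freeL.
Qed.

End Descent.

(** * Presentations of the lattices [X_i] and [U_j] *)

Section Models.
Variables (p : nat) (F : fieldType) (K : F -> Prop).
Variables (K0 : comNzRingType) (iota : {rmorphism K0 -> F}) (red : {rmorphism K0 -> 'F_p}).
Hypothesis Kres : residue_axioms red.
Hypothesis iota_inj : injective iota.
Hypothesis KE : forall x, K x <-> exists y, iota y = x.
Let p_pr : prime p := res_prime Kres.
Let p_gt0 : (0 < p)%N := prime_gt0 p_pr.
Let p_gt1 : (1 < p)%N := prime_gt1 p_pr.
Let n_gt0 : (0 < p ^ 2)%N. Proof. by rewrite expn_gt0 p_gt0. Qed.
Local Notation idF := (idfun : {rmorphism F -> F}).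
Local Notation lam := (lamR F).
Local Notation phi1 := (phi1R F p).
Local Notation phi2 := (phi2R F p).
Local Notation Xp1 := ('X^p - 1 : {poly F}).
Local Notation XN1 := ('X^(p ^ 2) - 1 : {poly F}).

Lemma pnat_neq0 : p%:R != 0 :> F.
Proof.
rewrite -(rmorph_nat iota) -(rmorph0 iota) (inj_eq iota_inj); apply/eqP => p0.
by have := oner_neq0 K0; rewrite (res_reg Kres (x := 1)) ?p0 ?mul0r ?eqxx.
Qed.

Definition gen_e (R : comNzRingType) (i : nat) : {poly R} := phi1R R p + lamR R ^+ i.+1.

(** The value at 1 is [p], so the polynomial is nonzero; its degree is at most [p - 1], below the
    degree [p * (p - 1)] of [phi2]. *)
Lemma gen_e_ndvd i : (i <= p - 2)%N -> ~ rdvd (phi2R K0 p) (gen_e K0 i).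
Proof.
move=> ip [s Es].
have e1 : (gen_e K0 i).[1] = p%:R.
  by rewrite hornerD horner_phi1 horner_exp horner_lam1 exprS mul0r addr0.
have [s0|sn0] := eqVneq s 0.
  move: e1; rewrite Es s0 mulr0 hornerC => p0.
  by have := pnat_neq0; rewrite -(rmorph_nat iota) -p0 rmorph0 eqxx.
have sz_e : (size (gen_e K0 i) <= p)%N.
  apply: leq_trans (size_polyD _ _) _; rewrite geq_max size_phi1 // leqnn /=.
  by rewrite /lamR -polyC1 size_exp_XsubC; lia.
have : (size (phi2R K0 p) <= p)%N.
  apply: leq_trans sz_e; rewrite Es size_monicM ?phi2_monic //.
  by move: sn0; rewrite -size_poly_eq0; lia.
rewrite size_phi2 //; nia.
Qed.

(** Coprimality of [gen_e] and [phi2] is taken from [K0[X]], as an identity for [p ^ N]; then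
    [p ^ N] is inverted in [F]. *)
Lemma gen_e_free i (q : {poly F}) : (i <= p - 2)%N ->
  rdvd XN1 (Xp1 * (q * gen_e F i)) -> rdvd phi2 q.
Proof.
move=> ip [s]; rewrite -Xp1_phi2 -mulrA.
move=> /(mulfI (monic_neq0 (XnS1_monic F p_gt0))) Eq.
have [N [a [b E]]] : exists N a b, p%:R ^+ N = gen_e F i * a + phi2 * b.
  have [|N [a [b E]]] := bezout_unif Kres (phi2_monic K0 p_gt0) (unif_phi2 Kres) _ (gen_e_ndvd ip).
    by exists ('X^p - 1); rewrite mulrC Xp1_phi2.
  exists N, (map_poly iota a), (map_poly iota b).
  move/(congr1 (map_poly iota)): E; rewrite rmorphXn rmorph_nat rmorphD !rmorphM /=.
  by rewrite map_phi2 /gen_e rmorphD rmorphXn /= map_phi1 map_lam.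
have pN : ((p%:R : F) ^- N)%:P * p%:R ^+ N = 1.
  by rewrite -polyC_natr -polyC_exp -rmorphM /= mulVf // expf_neq0 // pnat_neq0.
exists (((p%:R : F) ^- N)%:P * (s * a + q * b)).
have Eqs : q * p%:R ^+ N = phi2 * (s * a + q * b) by rewrite E mulrDr mulrA Eq; ring.
by rewrite -[LHS]mul1r -pN -mulrA [_ ^+ N * q]mulrC Eqs; ring.
Qed.

Lemma lam_phi1_free (c : {poly F}) : rdvd lam (c * phi1) -> rdvd lam c.
Proof.
move=> [s /(congr1 (horner^~ 1))]; rewrite !hornerM horner_lam1 mul0r horner_phi1.
by move/eqP; rewrite mulf_eq0 (negPf pnat_neq0) orbF => /eqP; exact: rdvd_lam.
Qed.

Lemma XN1_phi2_cancel (q : {poly F}) : rdvd XN1 (q * phi2) -> rdvd Xp1 q.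
Proof.
move=> [s]; rewrite -Xp1_phi2 mulrAC => /(mulIf (monic_neq0 (phi2_monic F p_gt0))) ->.
by exists s.
Qed.

Local Notation g := (@grv F (p ^ 2)).
Local Notation S := (shiftmx F (p ^ 2)).
Local Notation S2 := (shift2 F p).

(** [X_t] and [X_e] are the two generators of [X_i]; [X_k] is then forced to be
    [phi2 *: X_e - lam ^+ i *: X_t], which is [p^2] times [norm_elt]. *)
Definition X_e i := g (gen_e F i).
Definition X_k := g (phi1 * phi2).
Definition X_t := g (lam * phi2).

Lemma KG_span_submod n N (A : 'M[F]_N) gens : (0 < n)%N -> A ^+ n = 1 ->
  submod (KG_span K n A gens : matmod iota A -> Prop).
Proof.
move=> n0 An; split.
  apply/(KG_span_poly KE _ _ n0 An).
  by exists (fun=> 0); rewrite big1 // => i _; rewrite scale0r.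
move=> a u v /(KG_span_poly KE _ _ n0 An) [q ->] /(KG_span_poly KE _ _ n0 An) [r ->].
apply/(KG_span_poly KE _ _ n0 An); exists (fun g => a * q g + r g).
by rewrite scaler_sumr -big_split; apply: eq_bigr => i _; rewrite scalerDl scalerA.
Qed.

Lemma KG_span2 n N (A : 'M[F]_N) (u w v : 'rV[F]_N) : (0 < n)%N -> A ^+ n = 1 ->
  KG_span K n A [:: u; w] v <-> exists q r : {poly K0},
    v = q *: (u : matmod iota A) + r *: (w : matmod iota A).
Proof.
move=> n0 An; split=> [/(KG_span_poly KE _ _ n0 An) [q ->]|[q [r ->]]].
  by exists (q 0%N), (q 1%N); rewrite !big_ord_recl big_ord0 addr0.
apply/(KG_span_poly KE _ _ n0 An); exists (fun i => if i is 0%N then q else r).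
by rewrite !big_ord_recl big_ord0 addr0.
Qed.

Lemma g_act (r q : {poly F}) : r *: (g q : matmod idF S) = g (r * q).
Proof. exact: grv_act. Qed.

Lemma pres_X i : (i <= p - 2)%N ->
  pres p (cd_M (X_data K p i) : matmod iota S -> Prop) false i (X_e i) X_k X_t /\
  pres p (fspan (cd_M (X_data K p i)) : matmod idF S -> Prop) false i (X_e i) X_k X_t.
Proof.
move=> ip; have SN : S ^+ (p ^ 2) = 1 := shiftmx_n F n_gt0.
pose M := cd_M (X_data K p i).
have HM : submod (M : matmod iota S -> Prop) by apply: KG_span_submod.
have ME v : M v <-> exists q r : {poly K0}, v = q *: (X_t : matmod iota S) + r *: (X_e i : matmod iota S).
  exact: (KG_span2 _ _ _ n_gt0 SN).
have Me : M (X_e i) by apply/ME; exists 0, 1; rewrite scale0r scale1r add0r.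
have Mt : M X_t by apply/ME; exists 1, 0; rewrite scale0r scale1r addr0.
have Ee : phi2 *: (X_e i : matmod idF S) = X_k + lam ^+ i *: (X_t : matmod idF S).
  rewrite /X_e /X_k /X_t !g_act -grvD; congr g.
  by rewrite /gen_e exprS; ring.
have k0 : lam *: (X_k : matmod idF S) = 0.
  by rewrite g_act; apply/(grv_eq0 n_gt0); rewrite mulrA lam_phi1 Xp1_phi2; exact: rdvd_refl.
have t0 : phi1 *: (X_t : matmod idF S) = 0.
  rewrite g_act; apply/(grv_eq0 n_gt0); rewrite mulrA [phi1 * _]mulrC lam_phi1 Xp1_phi2.
  exact: rdvd_refl.
apply: (pres_descent iota_inj) => //.
- have -> : X_k = phi2R K0 p *: (X_e i : matmod iota S) - lamR K0 ^+ i *: (X_t : matmod iota S).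
    rewrite (matmod_map iota S (phi2R K0 p)) map_phi2 Ee.
    by rewrite (matmod_map iota S (_ ^+ i)) rmorphXn /= map_lam [RHS]addrK.
  by apply: (submodB HM); apply: (submodZ HM).
- move=> v /ME [q [r ->]]; exists r, 0, q.
  by rewrite scale0r addr0 [RHS]addrC.
- move=> q; rewrite /X_e !g_act => /(grv_eq0 n_gt0); exact: gen_e_free.
- move=> c y; rewrite /X_k /X_t !g_act -grvD => /(grv_eq0 n_gt0).
  have -> : c * (phi1 * phi2) + y * (lam * phi2) = (c * phi1 + y * lam) * phi2 by ring.
  move=> /XN1_phi2_cancel [s Es]; rewrite -lam_phi1 in Es.
  have [c' Ec] : rdvd lam c.
    apply: lam_phi1_free; exists (phi1 * s - y).
    have -> : c * phi1 = (c * phi1 + y * lam) - y * lam by rewrite addrK.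
    by rewrite Es; ring.
  split; first by exists c'.
  exists (s - c'); apply: (mulfI (monic_neq0 (lam_monic F))).
  have -> : lam * y = (c * phi1 + y * lam) - c * phi1 by ring.
  by rewrite Es Ec /ann_poly; ring.
Qed.

(** The second coordinate makes [X^p - 1] the annihilator of [U_t]: the first coordinate alone is
    already killed by [phi1]. *)
Definition U_e j := row_mx (g (gen_e F j)) (g (lam ^+ j)).
Definition U_k : 'rV[F]_(p ^ 2 + p ^ 2) := row_mx (g (phi1 * phi2)) 0.
Definition U_t := row_mx (g (lam * phi2)) (g phi2).

Lemma g2_act (r a b : {poly F}) :
  r *: (row_mx (g a) (g b) : matmod idF S2) = row_mx (g (r * a)) (g (r * b)).
Proof. by rewrite row_mx_act !grv_act. Qed.

Lemma g2_add (a b c d : {poly F}) :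
  row_mx (g a) (g b) + row_mx (g c) (g d) = row_mx (g (a + c)) (g (b + d)).
Proof. by rewrite add_row_mx !grvD. Qed.

Lemma g2_eq0 (a b : {poly F}) :
  row_mx (g a) (g b) = 0 <-> rdvd XN1 a /\ rdvd XN1 b.
Proof.
split=> [E|[/(grv_eq0 n_gt0) -> /(grv_eq0 n_gt0) ->]]; last by rewrite row_mx0.
move: E; rewrite -[RHS]row_mx0 => /eq_row_mx [/(grv_eq0 n_gt0) Ha /(grv_eq0 n_gt0) Hb].
by split.
Qed.

Lemma U_kE : U_k = row_mx (g (phi1 * phi2)) (g 0).
Proof. by rewrite grv0. Qed.

Lemma pres_U j : (j <= p - 2)%N ->
  pres p (cd_M (U_data K p j) : matmod iota S2 -> Prop) true j (U_e j) U_k U_t /\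
  pres p (fspan (cd_M (U_data K p j)) : matmod idF S2 -> Prop) true j (U_e j) U_k U_t.
Proof.
move=> jp; have SN : S2 ^+ (p ^ 2) = 1 := block_shiftmx_n F n_gt0.
pose M := cd_M (U_data K p j).
have HM : submod (M : matmod iota S2 -> Prop) by apply: KG_span_submod.
have ME v : M v <-> exists q r : {poly K0}, v = q *: (U_e j : matmod iota S2) + r *: (U_t : matmod iota S2).
  rewrite /U_e /gen_e addrC; exact: (KG_span2 _ _ _ n_gt0 SN).
have Me : M (U_e j) by apply/ME; exists 1, 0; rewrite scale0r scale1r addr0.
have Mt : M U_t by apply/ME; exists 0, 1; rewrite scale0r scale1r add0r.
have Ee : phi2 *: (U_e j : matmod idF S2) = U_k + lam ^+ j *: (U_t : matmod idF S2).
  rewrite U_kE /U_e /U_t !g2_act [RHS]g2_add; congr (row_mx (g _) (g _)).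
    by rewrite /gen_e exprS; ring.
  by rewrite add0r mulrC.
have k0 : lam *: (U_k : matmod idF S2) = 0.
  rewrite U_kE g2_act; apply/g2_eq0; rewrite mulr0 mulrA lam_phi1 Xp1_phi2.
  by split; [exact: rdvd_refl|exact: rdvd0].
have t0 : Xp1 *: (U_t : matmod idF S2) = 0.
  rewrite g2_act; apply/g2_eq0; rewrite mulrCA Xp1_phi2.
  by split; [apply: rdvdMl|]; exact: rdvd_refl.
apply: (pres_descent iota_inj) => //.
- have -> : U_k = phi2R K0 p *: (U_e j : matmod iota S2) - lamR K0 ^+ j *: (U_t : matmod iota S2).
    rewrite (matmod_map iota S2 (phi2R K0 p)) map_phi2 Ee.
    by rewrite (matmod_map iota S2 (_ ^+ j)) rmorphXn /= map_lam [RHS]addrK.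
  by apply: (submodB HM); apply: (submodZ HM).
- move=> v /ME [q [r ->]]; exists q, 0, r.
  by rewrite scale0r addr0.
- by move=> q; rewrite /U_e !g2_act => /g2_eq0 [+ _]; exact: gen_e_free.
- move=> c y; rewrite U_kE /U_t !g2_act [LHS]g2_add mulr0 add0r => /g2_eq0 [H1 H2].
  have [s Es] := XN1_phi2_cancel H2.
  split; last by exists s.
  have [r Er] : rdvd Xp1 (c * phi1).
    apply: XN1_phi2_cancel; have -> : c * phi1 * phi2 =
      (c * (phi1 * phi2) + y * (lam * phi2)) - XN1 * (s * lam).
      by rewrite -Xp1_phi2 Es; ring.
    by apply: rdvdB => //; apply: rdvdMr; exact: rdvd_refl.
  by apply: lam_phi1_free; exists (phi1 * r); rewrite Er -lam_phi1 mulrA.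
Qed.

End Models.

(** * Geometric sums and exponents modulo [p^2] *)

Section GeometricSum.
Variable R : comNzRingType.

(** At [y = X] this is the factor of [T(a)] in [T(a^m)]; at [y = X^k] it is the factor of [x] in the
    [m]-th power of [(a^k, x)]. *)
Definition geo (m : nat) (y : R) : R := \sum_(i < m) y ^+ i.

Lemma geoS m y : geo m.+1 y = 1 + y * geo m y.
Proof.
rewrite /geo big_ord_recl expr0 mulr_sumr; congr (_ + _).
by apply: eq_bigr => i _; rewrite exprS.
Qed.

Lemma geoD a b y : geo (a + b) y = geo a y + y ^+ a * geo b y.
Proof.
elim: a => [|a IH]; first by rewrite /geo big_ord0 add0r mul1r.
by rewrite addSn !geoS IH exprS; ring.
Qed.

Lemma geoM a b y : geo (a * b) y = geo a y * geo b (y ^+ a).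
Proof.
elim: b => [|b IH]; first by rewrite muln0 /geo !big_ord0 mulr0.
by rewrite mulnS geoD IH geoS; ring.
Qed.

Lemma geo1 m : geo m 1 = m%:R.
Proof.
rewrite /geo (eq_bigr (fun=> 1)); last by move=> i _; rewrite expr1n.
by rewrite sumr_const card_ord.
Qed.

Lemma geo_cong (d y z : R) m : rdvd d (y - z) -> rdvd d (geo m y - geo m z).
Proof.
move=> H; rewrite /geo -sumrB; elim/big_ind: _ => [|a b|i _]; [exact: rdvd0|exact: rdvdD|].
by rewrite subrXX; exact: rdvdMr.
Qed.

End GeometricSum.

Lemma XN1_cong (R : comNzRingType) n a b : (a = b %[mod n])%N ->
  rdvd ('X^n - 1 : {poly R}) ('X^a - 'X^b).
Proof.
have H c : rdvd ('X^n - 1 : {poly R}) ('X^c - 'X^(c %% n)).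
  rewrite {1}(divn_eq c n) exprD -{2}[_ ^+ (c %% n)]mul1r -mulrBl.
  by apply: rdvdMr; apply: Xp1_dvd; exact: dvdn_mull.
move=> E; have -> : 'X^a - 'X^b = ('X^a - 'X^(a %% n)) - ('X^b - 'X^(b %% n)) :> {poly R}.
  by rewrite E; ring.
exact: rdvdB.
Qed.

(** Every nontrivial subgroup of [C_{p^2}] contains [a^p], since the gcd of [k] and [p ^ 2] is 1 or
    [p]. *)
Lemma mult_to_p p k : prime p -> (0 < k < p ^ 2)%N ->
  exists s c, (k * s = p + p ^ 2 * c)%N.
Proof.
move=> pr /andP [k0 kn]; case: (egcdnP (p ^ 2) k0) => a b E _.
have := dvdn_gcdr k (p ^ 2) => /(dvdn_pfactor _ 2 pr) [[|[|[|//]]] _ Eg].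
- exists (a * p)%N, (b * p)%N; move: E; rewrite Eg expn0 => E; nia.
- exists a, b; move: E; rewrite Eg expn1 => E; nia.
- have : (gcdn k (p ^ 2) <= k)%N by apply: dvdn_leq => //; exact: dvdn_gcdl.
  by rewrite Eg leqNgt kn.
Qed.

(** * Torsion and cohomology in terms of the invariant vector *)

Section CrysGeneral.
Variables (p : nat) (F : fieldType) (K : F -> Prop).
Variables (K0 : comNzRingType) (iota : {rmorphism K0 -> F}) (red : {rmorphism K0 -> 'F_p}).
Hypothesis Kres : residue_axioms red.
Hypothesis iota_inj : injective iota.
Hypothesis KE : forall x, K x <-> exists y, iota y = x.
Let p_pr : prime p := res_prime Kres.
Let p_gt0 : (0 < p)%N := prime_gt0 p_pr.
Let p_gt1 : (1 < p)%N := prime_gt1 p_pr.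
Let n_gt0 : (0 < p ^ 2)%N. Proof. by rewrite expn_gt0 p_gt0. Qed.
Local Notation n := (p ^ 2)%N.
Local Notation P := {poly K0}.
Local Notation lam := (lamR K0).
Local Notation phi1 := (phi1R K0 p).
Local Notation phi2 := (phi2R K0 p).
Local Notation XN1 := ('X^(p ^ 2) - 1 : P).

Lemma F_natr_neq0 m : m.+1%:R != 0 :> F.
Proof.
rewrite -(rmorph_nat iota) -(rmorph0 iota) (inj_eq iota_inj); apply/eqP => m0.
by have := oner_neq0 K0; rewrite (natr_reg Kres (n := m) (x := 1)) ?m0 ?mul0r ?eqxx.
Qed.

Lemma matmod_tf N (A : 'M[F]_N) (v : matmod iota A) m : (m.+1%:R : P) *: v = 0 -> v = 0.
Proof.
rewrite -polyC_natr matmodC rmorph_nat => /eqP; rewrite scaler_eq0.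
by rewrite (negPf (F_natr_neq0 m)) => /eqP.
Qed.

Lemma matmod_tfp N (A : 'M[F]_N) (v : matmod iota A) : (p%:R : P) *: v = 0 -> v = 0.
Proof. by rewrite -(prednK p_gt0); exact: matmod_tf. Qed.

Section Data.
Variable D : crys_data F.
Local Notation N := (cd_N D).
Local Notation A := (cd_A D).
Local Notation M := (cd_M D).
Local Notation T := (cd_T D).
Local Notation V := (matmod iota A).
Hypothesis An : A ^+ n = 1.
Hypothesis HM : submod (M : V -> Prop).

Let VN (v : V) : XN1 *: v = 0. Proof. exact: matmod_XN1. Qed.

Lemma XN1_act (q r : P) (v : V) : rdvd XN1 (q - r) -> q *: v = r *: v.
Proof.
by move=> H; apply/eqP; rewrite -subr_eq0 -scalerBl (scale_rdvd H) ?VN.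
Qed.

Lemma exprAn k : A ^+ (k %% n) = A ^+ k.
Proof. by rewrite {2}(divn_eq k n) exprD mulnC exprM An expr1n mul1r. Qed.

Lemma crys_pow k (x : V) m : iter m (crys_mul n D (k, x)) (crys_one D) =
  ((k * m) %% n, (geo m ('X^k : P) *: x : 'rV_N))%N.
Proof.
elim: m => [|m IH]; first by rewrite muln0 mod0n /geo big_ord0 scale0r.
rewrite iterS IH /crys_mul /= modnDmr mulnS exprAn; congr (_, _).
rewrite /geo big_ord_recr /= scalerDl addrC -exprM matmodXn; congr (_ + _).
Qed.

Hypothesis HT : is_cocycle n D.
Local Notation tau := (T 1%N : V).

Lemma fspan_submod : submod (fspan M : V -> Prop).
Proof.
split; first by exists [::]; rewrite big_nil; split.
have fD u v : fspan M u -> fspan M v -> fspan M (u + v).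
  move=> [s [Hs ->]] [s' [Hs' ->]]; exists (s ++ s'); rewrite big_cat; split=> //.
  by move=> x; rewrite mem_cat => /orP [/Hs|/Hs'].
move=> a u v [s [Hs ->]]; apply: fD.
exists [seq (x.1, (a *: (x.2 : V) : 'rV_N)) | x <- s]; split.
  by move=> x /mapP [y ys ->] /=; apply: (submodZ HM); apply: Hs.
rewrite big_map matmod_scaleE mulmx_suml; apply: eq_bigr => x _ /=.
by rewrite matmod_scaleE scalemxAl.
Qed.

Lemma fspanF c u : fspan M u -> fspan M (c *: u).
Proof.
move=> [s [Hs ->]]; exists [seq (c * x.1, x.2) | x <- s]; split.
  by move=> x /mapP [y ys ->] /=; apply: Hs.
by rewrite big_map scaler_sumr; apply: eq_bigr => x _; rewrite /= scalerA.
Qed.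

Lemma cocycle0 : M (T 0%N).
Proof.
have := HT.2 0%N 0%N n_gt0 n_gt0; rewrite mod0n expr0.
have -> : T 0%N *m 1 = T 0%N by exact: mulmx1.
by rewrite opprD addrA subrr sub0r => /(submodN HM); rewrite opprK.
Qed.

Lemma cocycle_geo k : (k < n)%N -> M (T k - geo k ('X : P) *: tau).
Proof.
elim: k => [_|k IH kn].
  by rewrite /geo big_ord0 scale0r subr0; exact: cocycle0.
have n1 : (1 < n)%N by rewrite (leq_trans p_gt1) // leq_pmull.
have := HT.2 1%N k n1 (ltnW kn); rewrite add1n modn_small // expr1.
move: (T k.+1) => t H.
have {}IH := submodZ HM 'X (IH (ltnW kn)).
rewrite geoS scalerDl scale1r -scalerA.
have := submodD HM H IH; rewrite scalerBr matmodX.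
set a := _ *m _; set b := T 1%N; set c := _ *: (_ *: _).
by have -> : t - (a + b) + (a - c) = t - (b + c) by rewrite opprD -addrA [- a - b]addrC -addrA addKr opprD.
Qed.

Lemma geo_p_phi1 : geo p ('X : P) = phi1. Proof. by []. Qed.

Lemma geo_p_phi2 : geo p ('X^p : P) = phi2.
Proof.
rewrite /geo /phi2R /phi1R rmorph_sum; apply: eq_bigr => i _.
by rewrite rmorphXn /= comp_polyX.
Qed.

Lemma geo_n : geo n ('X : P) = phi1 * phi2.
Proof. by rewrite -mulnn geoM geo_p_phi2. Qed.

(** The rule for [T] around the whole cycle returns to [T(1)], which is 0 modulo [M]; the geometric
    sum of length [p ^ 2] is [phi1 * phi2]. *)
Lemma norm_tau : M (phi1 *: (phi2 *: tau)).
Proof.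
rewrite scalerA -geo_n -(prednK n_gt0) geoS.
have lt : (n.-1 < n)%N by rewrite prednK.
have n1 : (1 < n)%N by rewrite (leq_trans p_gt1) // leq_pmull.
have := HT.2 1%N n.-1 n1 lt; rewrite add1n prednK // modnn expr1 => H.
have := submodN HM (submodD HM H (submodZ HM 'X (cocycle_geo lt))).
move: cocycle0 => H0 /(submodD HM H0).
rewrite scalerBr matmodX scalerDl scale1r -scalerA.
set a := _ *m _; set b := T 1%N; set c := _ *: (_ *: _); set d := T 0%N.
have -> // : d - (d - (a + b) + (a - c)) = b + c.
by rewrite opprD !opprB addrA [d + _]addrC subrK [LHS]addrC addrA subrK addrC.
Qed.

Lemma crys_pow_set k (x : V) : crys_set n D (k, x) -> forall m,
  M (geo m ('X^k : P) *: x - geo (k * m) ('X : P) *: tau).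
Proof.
move=> [/= kn [_ Mx]] m; rewrite geoM mulrC.
rewrite -scalerA -scalerBr; apply: (submodZ HM).
have -> : x - geo k ('X : P) *: tau = (x - T k) + (T k - geo k ('X : P) *: tau).
  by rewrite addrA subrK.
by apply: (submodD HM) => //; exact: cocycle_geo.
Qed.

Lemma geo_p_mod c : M (geo (p + n * c) ('X : P) *: tau - phi1 *: tau).
Proof.
have -> : geo (p + n * c) ('X : P) = phi1 + ('X^p * geo c 'X^n) * (phi1 * phi2).
  by rewrite geoD geo_p_phi1 geoM geo_n; ring.
rewrite scalerDl [phi1 *: _ + _]addrC addrK -scalerA -[(phi1 * phi2) *: tau]scalerA.
by apply: (submodZ HM); exact: norm_tau.
Qed.

(** The lifts of [a^p] are the vectors [phi1 *: tau - w] with [w] in [M], and the translation part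
    of the [p]-th power is obtained by applying [phi2]. A torsion element is no translation unless
    trivial, and then [mult_to_p] gives a power of it over [a^p]. *)
Lemma crys_torsion_freeP : crys_torsion_free n D <->
  forall w, M w -> phi1 *: (phi2 *: tau) <> phi2 *: (w : V).
Proof.
split=> [tfD w Mw E|Hm [k x] Hs m m0].
  have pn : (p < n)%N by rewrite -mulnn ltn_Pmull.
  pose v : V := phi1 *: tau - w.
  suff [p0] : (p, v) = crys_one D by move: (p_gt0); rewrite p0.
  apply: (tfD _ _ p p_gt0).
    split=> //=; split.
      apply: (submodB fspan_submod).
        by apply: (submodZ fspan_submod); apply: HT.1; exact: ltn_trans pn.
      by exists [:: (1, w)]; rewrite big_seq1 scale1r; split=> // y; rewrite inE => /eqP ->.
    have -> : v - T p = - (T p - geo p ('X : P) *: tau) - w.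
      by rewrite geo_p_phi1 opprB /v addrAC.
    by apply: (submodB HM) => //; apply: (submodN HM); exact: cocycle_geo.
  rewrite crys_pow mulnn modnn geo_p_phi2; congr (_, _).
  by rewrite /v scalerBr -E scalerA mulrC -scalerA subrr.
rewrite crys_pow => [[_ E]]; move: Hs E; case: k => [|k] Hs E.
  congr (_, _); apply: (@matmod_tf _ A _ m.-1).
  by rewrite prednK // -geo1 -[X in geo _ X](expr0 'X).
exfalso; have kn : (0 < k.+1 < n)%N by case: Hs.
move: {k} k.+1 kn Hs E => k kn Hs E.
have [s [c Eks]] := mult_to_p p_pr kn.
pose x' : V := geo s ('X^k : P) *: (x : V).
have Mx' : M (phi1 *: tau - x').
  rewrite -opprB; apply: (submodN HM); have H1 := crys_pow_set Hs s; rewrite Eks in H1.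
  by have := submodD HM H1 (geo_p_mod c); rewrite addrA subrK.
apply: (Hm _ Mx'); rewrite scalerBr.
(* The lift [x'] of [a^p] has a trivial power of exponent [p * m]; modulo [X^(p^2) - 1] the
   geometric sum involved is [m] times [phi2], and [m] acts without torsion. *)
suff -> : phi2 *: x' = 0 by rewrite subr0 scalerA mulrC -scalerA.
apply: (@matmod_tf _ A _ m.-1); rewrite prednK //.
have E0 : geo (s * (p * m)) ('X^k : P) *: (x : V) = 0.
  have -> : (s * (p * m) = m * (s * p))%N by rewrite mulnA mulnC.
  by rewrite geoM mulrC -scalerA E scaler0.
rewrite -[RHS]E0 geoM -exprM Eks mulrC -scalerA -/x' scalerA; apply: XN1_act.
have H1 : rdvd XN1 (geo (p * m) ('X^p : P) - geo (p * m) 'X^(p + n * c)).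
  by apply: geo_cong; apply: XN1_cong; rewrite addnC mulnC modnMDl.
have H2 : rdvd XN1 (m%:R * phi2 - geo (p * m) ('X^p : P)).
  rewrite geoM geo_p_phi2 -exprM mulnn [_ * phi2]mulrC -mulrBr -geo1; apply: rdvdMl.
  by apply: geo_cong; rewrite -(expr0 'X); apply: XN1_cong; rewrite modnn mod0n.
by have := rdvdD H2 H1; rewrite addrA subrK.
Qed.

(** If [tau = l + lam *: x] with [l] in [M], the norm kills [lam *: x], so the invariant vector is
    [phi2 *: (phi1 *: l)]. *)
Lemma crys_not_cohomologous :
  (forall w, M w -> phi1 *: (phi2 *: tau) <> phi2 *: (w : V)) ->
  ~ cohomologous_to_zero n D.
Proof.
move=> Hm [x [_ Hx]]; have n1 : (1 < n)%N by rewrite (leq_trans p_gt1) // leq_pmull.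
have := Hx _ n1; rewrite expr1; set l := _ - _ => Ml.
apply: (Hm (phi1 *: (l : V))); first exact: (submodZ HM).
have -> : tau = (l : V) + lam *: (x : V).
  by rewrite /l scalerBl scale1r matmodX subrK.
have E0 : phi1 *: (phi2 *: (lam *: (x : V))) = 0.
  have EX : phi1 * (phi2 * lam) = XN1 by rewrite -Xp1_phi2 -lam_phi1; ring.
  by rewrite !scalerA -mulrA EX VN.
by rewrite !scalerDr E0 addr0 !scalerA mulrC.
Qed.

End Data.
End CrysGeneral.

(** * Comparison of two presentations *)

Section Triple.
Variables (p : nat) (R : comNzRingType).
Local Notation P := {poly R}.

Definition triple (V : lmodType P) (e k t : V) (i : 'I_3) : V := [:: e; k; t]`_i.

Definition coef3 (q c y : P) (i : 'I_3) : P := [:: q; c; y]`_i.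

Lemma dot_triple (V : lmodType P) (q : 'I_3 -> P) (e k t : V) :
  dot q (triple e k t) = q ord0 *: e + q (lift ord0 ord0) *: k + q ord_max *: t.
Proof.
rewrite /dot !big_ord_recl big_ord0 addr0 addrA /triple /=; congr (_ + _ + _ *: _).
by congr q; apply: val_inj.
Qed.

Lemma dot_coef3 (V : lmodType P) q c y (e k t : V) :
  dot (coef3 q c y) (triple e k t) = q *: e + c *: k + y *: t.
Proof. by rewrite dot_triple. Qed.

(** All relations in a presented module follow from the three defining ones, which the other triple
    satisfies too. Over [K] this makes the map between two lattices well defined; over [F] it gives
    injectivity. *)
Lemma pres_relation (V1 V2 : lmodType P) (M : V2 -> Prop) ty n
    (e1 k1 t1 : V1) (e2 k2 t2 : V2) (q : 'I_3 -> P) :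
  phi2R R p *: e1 = k1 + lamR R ^+ n *: t1 -> lamR R *: k1 = 0 -> ann_poly p R ty *: t1 = 0 ->
  pres p M ty n e2 k2 t2 ->
  dot q (triple e2 k2 t2) = 0 -> dot q (triple e1 k1 t1) = 0.
Proof.
rewrite !dot_triple; move: (q _) (q _) (q _) => y c {}q.
move=> Ee1 k10 t10 [_ [Ee2 k20 t20] _ freeE freeL] E.
have [s Es] : rdvd (phi2R R p) q.
  apply: freeE; move: E => /eqP; rewrite -addrA addr_eq0 => /eqP ->.
  rewrite scalerN scalerDr ![('X^p - 1) *: _]scalerA ![('X^p - 1) * _]mulrC -!scalerA.
  by rewrite (lam_Xp1_act p k20) (scale_rdvd (gT_Xp1 p R ty) t20) !scaler0 addr0 oppr0.
have split_phi2 (V : lmodType P) (e k t : V) : phi2R R p *: e = k + lamR R ^+ n *: t ->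
    q *: e + c *: k + y *: t = (s + c) *: k + (s * lamR R ^+ n + y) *: t.
  by move=> H; rewrite Es mulrC -scalerA H scalerDr scalerA !scalerDl addrACA addrA.
move: E; rewrite (split_phi2 _ _ _ _ Ee2) => /freeL [Hk Ht].
by rewrite (split_phi2 _ _ _ _ Ee1) (scale_rdvd Hk k10) (scale_rdvd Ht t10) addr0.
Qed.

End Triple.

Lemma hornermx_intertwine (R : comNzRingType) (F : fieldType) (iota : {rmorphism R -> F})
    N1 N2 (A1 : 'M[F]_N1) (A2 : 'M[F]_N2) (B : 'M[F]_(N1, N2)) q (v : matmod iota A1) :
  A1 *m B = B *m A2 ->
  (q *: v : 'rV_N1) *m B = q *: ((v : 'rV_N1) *m B : matmod iota A2).
Proof.
move=> AB; rewrite !matmod_scaleE -mulmxA -[RHS]mulmxA; congr (_ *m _).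
rewrite /hornermx mulmx_suml mulmx_sumr; apply: eq_bigr => i _.
rewrite -scalemxAl -scalemxAr; congr (_ *: _).
elim: (i : nat) => [|j IH]; first by rewrite !expr0 [1 *m B]mul1mx [B *m 1]mulmx1.
by rewrite exprSr -[_ * A1 *m B]mulmxA AB mulmxA IH exprSr [RHS]mulmxA.
Qed.

Lemma dot_intertwine (R : comNzRingType) (F : fieldType) (iota : {rmorphism R -> F})
    N1 N2 (A1 : 'M[F]_N1) (A2 : 'M[F]_N2) (B : 'M[F]_(N1, N2)) n (q : 'I_n -> {poly R})
    (e : 'I_n -> matmod iota A1) : A1 *m B = B *m A2 ->
  (dot q e : 'rV_N1) *m B = dot q (fun i => (e i : 'rV_N1) *m B : matmod iota A2).
Proof.
move=> AB; rewrite [dot q e *m B]mulmx_suml; apply: eq_bigr => i _.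
exact: hornermx_intertwine.
Qed.

Lemma submod_closed (R : comNzRingType) (F : fieldType) (iota : {rmorphism R -> F}) N
    (A : 'M[F]_N) (M : 'rV[F]_N -> Prop) : M 0 -> (forall u v, M u -> M v -> M (u + v)) ->
  (forall c v, M v -> M (iota c *: v)) -> (forall v, M v -> M (v *m A)) ->
  submod (M : matmod iota A -> Prop).
Proof.
move=> M0 MD MZ MA; split=> // q u v Mu Mv; apply: (MD) => //.
rewrite matmod_scaleE /hornermx mulmx_sumr; elim/big_ind: _ => [|x y|i _]; [exact: M0|exact: MD|].
rewrite -scalemxAr; apply: MZ; elim: (i : nat) => [|j IH].
  by rewrite expr0 [u *m 1]mulmx1.
by rewrite exprSr mulmxA; apply: MA.
Qed.

(** * Equal presentations give isomorphic groups *)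

Section Iso.
Variables (p : nat) (F : fieldType) (K : F -> Prop).
Variables (K0 : comNzRingType) (iota : {rmorphism K0 -> F}) (red : {rmorphism K0 -> 'F_p}).
Hypothesis Kres : residue_axioms red.
Hypothesis iota_inj : injective iota.
Hypothesis KE : forall x, K x <-> exists y, iota y = x.
Let p_pr : prime p := res_prime Kres.
Let p_gt0 : (0 < p)%N := prime_gt0 p_pr.
Local Notation n := (p ^ 2)%N.
Local Notation P := {poly K0}.
Local Notation idF := (idfun : {rmorphism F -> F}).

Lemma matmod_scaleC N (A : 'M[F]_N) (q : P) (c : F) (v : 'rV[F]_N) :
  q *: (c *: v : matmod iota A) = c *: (q *: (v : matmod iota A) : 'rV_N).
Proof. by rewrite !matmod_scaleE -scalemxAl. Qed.

Lemma dot_map N (A : 'M[F]_N) m (q : 'I_m -> P) (e : 'I_m -> 'rV[F]_N) :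
  (dot q (e : 'I_m -> matmod iota A) : 'rV_N) =
  dot (fun i => map_poly iota (q i)) (e : 'I_m -> matmod idF A).
Proof. by apply: eq_bigr => i _; rewrite matmod_map. Qed.

Variables (d : nat) (A1 : 'M[F]_d) (T1 : nat -> 'rV[F]_d) (D2 : crys_data F).
Local Notation D1 := (lattice_data K A1 T1).
Local Notation A2 := (cd_A D2).
Local Notation N2 := (cd_N D2).
Local Notation V1 := (matmod iota A1).
Local Notation V2 := (matmod iota A2).
Local Notation W1 := (matmod idF A1).
Local Notation W2 := (matmod idF A2).
Local Notation M1 := (cd_M D1).
Local Notation M2 := (cd_M D2).
Local Notation T2 := (cd_T D2).
Local Notation tau1 := (T1 1%N).
Local Notation tau2 := (T2 1%N).
Hypotheses (A1n : A1 ^+ n = 1) (A2n : A2 ^+ n = 1).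
Hypotheses (HM1 : submod (M1 : V1 -> Prop)) (HM2 : submod (M2 : V2 -> Prop)).
Hypotheses (HT1 : is_cocycle n D1) (HT2 : is_cocycle n D2).
Variables (ty : bool) (m : nat) (e1 k1 t1 : 'rV[F]_d) (e2 k2 t2 : 'rV[F]_N2).
Hypothesis pres1 : pres p (M1 : V1 -> Prop) ty m e1 k1 t1.
Hypothesis pres2 : pres p (M2 : V2 -> Prop) ty m e2 k2 t2.
Hypothesis pres2F : pres p (fspan M2 : W2 -> Prop) ty m e2 k2 t2.
Hypothesis k1E : phi1R K0 p *: (phi2R K0 p *: (tau1 : V1)) = k1.
Hypothesis k2E : phi1R K0 p *: (phi2R K0 p *: (tau2 : V2)) = k2.

Let M1_delta (j : 'I_d) : M1 (delta_mx 0 j).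
Proof.
move=> l; rewrite mxE eqxx /=; apply/KE; case: (l == j).
  by exists 1; rewrite rmorph1.
by exists 0; rewrite rmorph0.
Qed.

(** [B] carries the first triple to the second, hence the norm of [tau1] to that of [tau2]. The norm
    is [p^2] modulo [lam], with [p^2] invertible in [F], so [tau1 *m B - tau2] is [- (lam *: y)].
    The isomorphism is [B] followed by conjugation with a translation. *)
Lemma lattice_iso : crys_iso n D1 D2.
Proof.
have [_ [Ee1 k10 t10] gen1 _ _] := pres1.
have [_ [Ee2 k20 t20] gen2 _ _] := pres2.
have [_ _ gen2F _ _] := pres2F.
pose f1 := @triple K0 V1 e1 k1 t1; pose f2 := @triple K0 V2 e2 k2 t2.
have gen1' v : M1 v -> exists q, v = dot q f1.
  by move=> /gen1 [q [c [y ->]]]; exists (coef3 q c y); rewrite dot_coef3.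
have gen2' v : M2 v -> exists q, v = dot q f2.
  by move=> /gen2 [q [c [y ->]]]; exists (coef3 q c y); rewrite dot_coef3.
have /choice [Q HQ] := fun j => gen1' _ (M1_delta j).
pose B : 'M[F]_(d, N2) := \matrix_(j, l) (dot (Q j) f2 : 'rV_N2) 0 l.
have rowB j : row j B = dot (Q j) f2 by apply/rowP => l; rewrite !mxE.
have B_comb v q : M1 v -> v = dot q f1 -> v *m B = dot q f2.
  move=> Mv Ev; have /choice [w Hw] : forall j, exists x, iota x = v 0 j.
    by move=> j; apply/KE.
  have E1 : v = dot (comb (fun j => (w j)%:P) Q) f1.
    rewrite dot_comb {1}(row_sum_delta v); apply: eq_bigr => j _.
    by rewrite matmodC Hw -HQ.
  have E2 : v *m B = dot (comb (fun j => (w j)%:P) Q) f2.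
    rewrite dot_comb (mulmx_sum_row v B); apply: eq_bigr => j _.
    by rewrite matmodC Hw rowB.
  rewrite E2; apply: (@subr0_eq V2); rewrite -dotB.
  by apply: (pres_relation Ee2 k20 t20 pres1); rewrite dotB -E1 -Ev subrr.
have AB : A1 *m B = B *m A2.
  apply/row_matrixP => j; rewrite !row_mul rowB.
  rewrite (@B_comb _ (fun i => 'X * Q j i)).
  - by rewrite dotZ matmodX.
  - rewrite rowE -(@matmodX _ _ iota); exact: (submodZ HM1).
  - by rewrite dotZ -HQ matmodX rowE.
have [[Me1 Mk1 Mt1] _ _ _ _] := pres1.
have f1B i : (f1 i : 'rV_d) *m B = f2 i.
  have Mf1 : M1 (f1 i) by rewrite /f1; case: i => [[|[|[|//]]]].
  by rewrite (@B_comb _ (delta _ i)) // dot_delta.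
pose g1 := @triple F W1 e1 k1 t1; pose g2 := @triple F W2 e2 k2 t2.
have g1B q : (dot q g1 : 'rV_d) *m B = dot q g2.
  have EE : (fun i => (g1 i : 'rV_d) *m B : W2) = g2 by apply/funext => i; exact: f1B.
  exact: etrans (dot_intertwine q g1 AB) (congr1 (@dot _ W2 3 q) EE).
have genF (v : 'rV_d) : exists q, v = dot q g1.
  exists (comb (fun j => (v 0 j)%:P) (fun j i => map_poly iota (Q j i))).
  rewrite dot_comb {1}(row_sum_delta v); apply: eq_bigr => j _.
  by rewrite matmodC -(dot_map A1) -HQ.
have injB (v : 'rV_d) : v *m B = 0 -> v = 0.
  have [q ->] := genF v; rewrite g1B => E.
  apply: (@pres_relation p F W1 W2 _ ty m e1 k1 t1 e2 k2 t2 q _ _ _ pres2F E).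
  - move: Ee1; rewrite matmod_map map_phi2 => ->; congr (_ + _).
    by rewrite matmod_map rmorphXn /= map_lam.
  - by move: k10; rewrite matmod_map map_lam.
  - move: t10; rewrite matmod_map /ann_poly; case: (ty).
      by rewrite rmorphB /= rmorph1 map_polyXn.
    by rewrite map_phi1.
have B_M (v : 'rV_d) : M1 v -> M2 (v *m B).
  move=> Mv; have [q Eq] := gen1' _ Mv; rewrite (B_comb _ _ Mv Eq).
  have [[Me2 Mk2 Mt2] _ _ _ _] := pres2.
  by rewrite dot_triple; apply: (submodD HM2); [apply: (submodD HM2)|]; apply: (submodZ HM2).
have M_B z : M2 z -> exists2 v : 'rV_d, M1 v & z = v *m B.
  move=> /gen2' [q ->]; exists (dot q f1).
    by rewrite dot_triple; apply: (submodD HM1); [apply: (submodD HM1)|]; apply: (submodZ HM1).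
  have EE : (fun i => (f1 i : 'rV_d) *m B : V2) = f2 by apply/funext => i; exact: f1B.
  by apply/esym; apply: etrans (dot_intertwine q f1 AB) _; rewrite EE.
have span_B z : fspan M2 z -> exists v : 'rV_d, z = v *m B.
  move=> /gen2F [q [c [y ->]]]; exists (dot (coef3 q c y) g1).
  by rewrite g1B dot_coef3.
have HS2 := fspan_submod HM2.
have B_span (v : 'rV_d) : fspan M2 (v *m B).
  have [q ->] := genF v; rewrite g1B dot_triple.
  have [[Me2 Mk2 Mt2] _ _ _ _] := pres2F.
  have HS2F : submod (fspan M2 : W2 -> Prop).
    apply: submod_closed => [|u w Su Sw|c w Sw|w Sw].
    - exact: HS2.1.
    - exact: (submodD HS2).
    - exact: fspanF.
    - by rewrite -(@matmodX _ _ iota); exact: (submodZ HS2).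
  by apply: (submodD HS2F); [apply: (submodD HS2F)|]; apply: (submodZ HS2F).
pose z : V2 := (tau1 *m B : 'rV_N2) - tau2.
have n1 : (1 < n)%N by rewrite (leq_trans (prime_gt1 p_pr)) // leq_pmull.
have Sz : fspan M2 z by apply: (submodB HS2); [exact: B_span|exact: HT2.1].
have Nz : phi1R K0 p *: (phi2R K0 p *: z) = 0.
  rewrite /z !scalerBr k2E -[tau1 *m B]/((tau1 : V1) *m B : V2).
  rewrite -(hornermx_intertwine (phi2R K0 p) (tau1 : V1) AB).
  rewrite -(hornermx_intertwine (phi1R K0 p) (phi2R K0 p *: (tau1 : V1)) AB) k1E.
  apply/eqP; rewrite subr_eq0; apply/eqP.
  by have := f1B (lift ord0 ord0); rewrite /f1 /f2 /triple.
have [y Sy Ey] : exists2 y : V2, fspan M2 y & z = - (lamR K0 *: y).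
  have [g Eg] := lam_rem (phi1R K0 p * phi2R K0 p).
  rewrite hornerM horner_phi1 horner_phi2 -natrM mulnn in Eg.
  have nF : n%:R != 0 :> F.
    by rewrite -(prednK (n := n)) ?expn_gt0 ?p_gt0 //; exact: F_natr_neq0 Kres iota_inj _.
  have Ez : (n%:R : F) *: (z : 'rV_N2) = - (lamR K0 *: (g *: z)).
    apply/eqP; rewrite -addr_eq0; apply/eqP.
    have := Nz; rewrite scalerA Eg scalerDl matmodC rmorph_nat -scalerA.
    by [].
  exists ((n%:R : F)^-1 *: (g *: z : 'rV_N2)).
    by apply: fspanF; apply: (submodZ HS2).
  have E3 : (z : 'rV_N2) = (n%:R : F)^-1 *: ((n%:R : F) *: (z : 'rV_N2)).
    by rewrite scalerA mulVf // scale1r.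
  by rewrite matmod_scaleC; apply: etrans E3 _; rewrite Ez; exact: scalerN.
(* Through [B] the cocycles differ by the coboundary of [y], because a geometric sum times [lam]
   telescopes to [X^k - 1]. *)
have hM k : (k < n)%N -> M2 ((T1 k : 'rV_d) *m B + ((y : 'rV_N2) *m A2 ^+ k - y) - T2 k).
  move=> kn; have H1 := B_M _ (cocycle_geo Kres (D := D1) HM1 HT1 kn).
  have H2 := cocycle_geo Kres HM2 HT2 kn.
  pose G := geo k ('X : P).
  have EB : (G *: (tau1 : V1) : 'rV_d) *m B = G *: (z + tau2).
    by rewrite (hornermx_intertwine G (tau1 : V1) AB) /z subrK.
  have EG : (y : 'rV_N2) *m A2 ^+ k - y = - (G *: z).
    rewrite Ey scalerN opprK scalerA.
    have -> : G * lamR K0 = 'X^k - 1.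
      by rewrite mulrC /lamR subrX1; congr (_ * _).
    by rewrite scalerBl scale1r matmodXn.
  move: H1; rewrite mulmxBl EB EG scalerDr.
  move=> H1; have := submodB HM2 H1 H2.
  set a := _ *m B; set b := G *: z; set c : V2 := G *: (tau2 : V2); set w := T2 k.
  have -> // : a - (b + c) - (w - c) = a - b - w.
  by rewrite opprB opprD !addrA subrK.
exists (fun s => (s.1, (s.2 : 'rV_d) *m B + ((y : 'rV_N2) *m A2 ^+ s.1 - y))).
have yM k : fspan M2 ((y : 'rV_N2) *m A2 ^+ k - y).
  by apply: (submodB HS2) => //; rewrite -(@matmodXn _ _ iota); apply: (submodZ HS2).
split; [|split; [|split]].
- move=> [k x] [/= kn [_ Mx]]; split=> //; split.
    by apply: (submodD HS2) => //; exact: B_span.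
  have := submodD HM2 (B_M _ Mx) (hM _ kn); rewrite /= mulmxBl.
  set a := x *m B; set b := T1 k *m B; set c := _ - y; set w := T2 k.
  by have -> // : a - b + (b + c - w) = a + c - w by rewrite !addrA subrK.
- move=> [k x] [k' x'] _ _ [/= <-] /addIr E; congr (_, _).
  by apply/eqP; rewrite -subr_eq0; apply/eqP/injB; rewrite mulmxBl E subrr.
- move=> [k w] [/= kn [Sw Mw]].
  have [|x Ex] := span_B (w - ((y : 'rV_N2) *m A2 ^+ k - y)).
    by apply: (submodB HS2).
  exists (k, x); split; last by rewrite /= -Ex subrK.
  split=> //=; split.
    exists [seq (x 0 j, delta_mx 0 j) | j <- enum 'I_d]; split.
      by move=> e /mapP [j _ ->]; exact: M1_delta.
    by rewrite big_map big_enum /=; exact: row_sum_delta.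
  have [|v Mv Ev] := M_B ((x - T1 k) *m B).
    have := submodB HM2 Mw (hM _ kn); rewrite mulmxBl -Ex.
    set a := T1 k *m B; set c := _ - y.
    by have -> // : w - T2 k - (a + c - T2 k) = w - c - a by rewrite opprB addrA subrK opprD addrA addrAC.
  suff -> : x - T1 k = v by [].
  by apply/eqP; rewrite -subr_eq0; apply/eqP/injB; rewrite mulmxBl Ev subrr.
- move=> [k x] [k' x'] [/= kn _] [/= kn' _]; congr (_, _) => /=.
  rewrite mulmxDl -[x *m A1 ^+ k']/((x : V1) *m _) -(@matmodXn _ _ iota).
  rewrite (hornermx_intertwine ('X^k') (x : V1) AB) matmodXn (exprAn A2n) exprD.
  rewrite mulmxDl mulmxBl -[_ * _]/(_ *m _) mulmxA.
  set a := x *m B *m _; set b := x' *m B; set c := y *m A2 ^+ k *m _; set w := y *m A2 ^+ k'.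
  by rewrite [RHS]addrACA; congr (_ + _); rewrite addrA subrK.
Qed.

End Iso.

(** [Phi(X^r)] times [geo r X] is [geo (p * r) X], a multiple of [phi1]; and [geo r X] is invertible
    modulo [phi1], because [r] is invertible modulo [p]. *)
Lemma phi1_Xr (R : comNzRingType) p r : prime p -> ~~ (p %| r)%N ->
  rdvd (phi1R R p) (geo p ('X^r : {poly R})).
Proof.
move=> pr pr_r; have r0 : (0 < r)%N by rewrite lt0n; apply: contraNneq pr_r => ->; rewrite dvdn0.
have [s c Esc _] : egcdn_spec r p (egcdn r p) by exact: egcdnP.
have gr : gcdn r p = 1%N by apply/eqP; rewrite -/(coprime r p) coprime_sym prime_coprime.
rewrite gr in Esc; pose A := geo r ('X : {poly R}); pose Bs := geo s ('X^r : {poly R}).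
pose D := geo r ('X^p : {poly R}); pose E := 'X * geo c ('X^p : {poly R}).
have phi1E : geo p ('X : {poly R}) = phi1R R p by [].
have AB : A * Bs = 1 + phi1R R p * E.
  rewrite -geoM mulnC Esc addn1 geoS [(c * p)%N]mulnC geoM phi1E /E; ring.
have AD : geo p ('X^r) * A = phi1R R p * D by rewrite mulrC -geoM mulnC geoM phi1E.
exists (D * Bs - geo p ('X^r) * E).
have -> : phi1R R p * (D * Bs - geo p 'X^r * E) =
  (phi1R R p * D) * Bs - geo p 'X^r * (phi1R R p * E) by ring.
have -> : phi1R R p * E = A * Bs - 1 by rewrite AB; ring.
by rewrite -AD; ring.
Qed.

Lemma phi2_Xr (R : comNzRingType) p r : prime p -> ~~ (p %| r)%N ->
  rdvd (phi2R R p) (geo p ('X^(p * r) : {poly R})).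
Proof.
move=> pr pr_r; have [s /(congr1 (fun q => q \Po ('X^p : {poly R})))] := phi1_Xr R pr pr_r.
rewrite rmorphM /= -/(phi2R R p) => E; exists (s \Po 'X^p); rewrite -E.
rewrite /geo rmorph_sum; apply: eq_bigr => i _.
by rewrite !rmorphXn /= comp_polyX -!exprM mulnA.
Qed.

Lemma crys_iso_sym (F : fieldType) n (D1 D2 : crys_data F) :
  (forall s t, crys_set n D1 s -> crys_set n D1 t -> crys_set n D1 (crys_mul n D1 s t)) ->
  (forall s t, crys_set n D2 s -> crys_set n D2 t -> crys_set n D2 (crys_mul n D2 s t)) ->
  crys_iso n D1 D2 -> crys_iso n D2 D1.
Proof.
move=> mul1 mul2 [f [f_set [f_inj [f_surj f_mul]]]].
have /choice [g Hg] : forall u, exists s, crys_set n D2 u -> crys_set n D1 s /\ f s = u.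
  move=> u; have [/f_surj [s Hs]|nu] := EM (crys_set n D2 u); first by exists s.
  by exists (crys_one D1) => /nu.
exists g; split; first by move=> s /Hg [].
split; first by move=> s t /Hg [_ Es] /Hg [_ Et] E; rewrite -Es -Et E.
split.
  move=> u Hu; exists (f u); split; first exact: f_set.
  have [Sg Eg] := Hg _ (f_set _ Hu); exact: f_inj.
move=> s t Hs Ht; have [Ss Es] := Hg _ Hs; have [St Et] := Hg _ Ht.
have [Sst Est] := Hg _ (mul2 _ _ Hs Ht).
by apply: f_inj => //; [exact: mul1|rewrite Est f_mul // Es Et].
Qed.

(** * Invariance under abstract isomorphism *)

Section NonIso.
Variables (p : nat) (F : fieldType) (K : F -> Prop).
Variables (K0 : comNzRingType) (iota : {rmorphism K0 -> F}) (red : {rmorphism K0 -> 'F_p}).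
Hypothesis Kres : residue_axioms red.
Hypothesis iota_inj : injective iota.
Let p_pr : prime p := res_prime Kres.
Let p_gt0 : (0 < p)%N := prime_gt0 p_pr.
Let n_gt0 : (0 < p ^ 2)%N. Proof. by rewrite expn_gt0 p_gt0. Qed.
Local Notation n := (p ^ 2)%N.
Local Notation P := {poly K0}.
Local Notation lam := (lamR K0).
Local Notation phi1 := (phi1R K0 p).
Local Notation phi2 := (phi2R K0 p).
Local Notation XN1 := ('X^(p ^ 2) - 1 : P).

Definition modelled (D : crys_data F) ty m := [/\ cd_A D ^+ n = 1,
  submod (cd_M D : matmod iota (cd_A D) -> Prop), is_cocycle n D, range_ok p ty m &
  exists e k t, pres p (cd_M D : matmod iota (cd_A D) -> Prop) ty m e k t].

Lemma modelled_mul D ty m s t : modelled D ty m ->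
  crys_set n D s -> crys_set n D t -> crys_set n D (crys_mul n D s t).
Proof.
move=> [An HM HT _ _]; case: s t => [k x] [k' x'] [/= kn [Sx Mx]] [/= kn' [Sx' Mx']].
have HS := fspan_submod HM; split; first by rewrite ltn_mod.
rewrite /= -(@matmodXn _ _ iota); split.
  by apply: (submodD HS) => //; apply: (submodZ HS).
have := HT.2 k' k kn' kn; rewrite addnC => H.
have := submodB HM (submodD HM (submodZ HM 'X^k' Mx) Mx') H.
rewrite scalerBr matmodXn (@matmodXn _ _ iota).
set a := x *m _; set b := cd_T D k *m _; set c := cd_T D k'; set w := cd_T D _.
have -> // : a - b + (x' - c) - (w - (b + c)) = a + x' - w.
by rewrite addrACA -opprD opprB addrA subrK.
Qed.

(** By [mult_to_p] a nontrivial [a^k] has [a^p] among its powers, and [a^p] moves [e]. *)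
Lemma modelled_faithful D ty m k : modelled D ty m -> (k < n)%N ->
  (forall u, cd_M D u -> u *m cd_A D ^+ k = u) -> k = 0%N.
Proof.
move=> [An HM HT _ [e [k' [t Hp]]]] kn Hk; apply/eqP; rewrite -leqn0 leqNgt; apply/negP => k0.
apply: (pres_Xp1_e Kres Hp).
have [[Me _ _] _ _ _ _] := Hp.
have [s [c E]] := mult_to_p p_pr (introT andP (conj k0 kn)).
have Es : ('X^(k * s) : P) *: (e : matmod iota (cd_A D)) = e.
  elim: s {E} => [|s IH]; first by rewrite muln0 expr0 scale1r.
  by rewrite mulnS exprD -scalerA IH matmodXn Hk.
rewrite scalerBl scale1r -[X in _ - X]Es E; apply/eqP; rewrite subr_eq0; apply/eqP.
apply: (XN1_act An); apply: XN1_cong.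
by rewrite [in RHS]addnC mulnC modnMDl.
Qed.

Lemma modelled_one D ty m : modelled D ty m -> crys_set n D (crys_one D).
Proof.
move=> [An HM HT _ _]; split=> //=; split; first by exists [::]; rewrite big_nil; split.
by rewrite sub0r; apply: (submodN HM); exact: cocycle0 Kres _ HM HT.
Qed.

Lemma modelled_M D ty m v : modelled D ty m -> (cd_M D v <-> crys_set n D (0%N, v)).
Proof.
move=> [An HM HT _ _]; have T0 := cocycle0 Kres HM HT; split=> [Mv|[_ [_ /= Mv]]].
  split=> //=; split; last exact: (submodB HM).
  by exists [:: (1, v)]; rewrite big_seq1 scale1r; split=> // y; rewrite inE => /eqP ->.
by rewrite -[v](subrK (cd_T D 0%N)); exact: (submodD HM).
Qed.

Section Transfer.
Variables (D1 D2 : crys_data F) (ty1 ty2 : bool) (m1 m2 : nat).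
Hypotheses (H1 : modelled D1 ty1 m1) (H2 : modelled D2 ty2 m2).
Local Notation M1 := (cd_M D1).
Local Notation M2 := (cd_M D2).
Local Notation A1 := (cd_A D1).
Local Notation A2 := (cd_A D2).
Local Notation V1 := (matmod iota A1).
Local Notation V2 := (matmod iota A2).

(* [f] maps the translations [M1] into [M2]: the image of [(0, v)] commutes with
   all [n]-th powers, hence acts trivially on [M2], which is faithful. *)
Lemma iso_lattice_map : crys_iso n D1 D2 -> exists (theta : V1 -> V2) r, [/\ ~~ (p %| r)%N,
  (forall v : V1, M1 v -> M2 (theta v)),
  (forall u v : V1, M1 u -> M1 v -> theta (u + v) = theta u + theta v),
  (forall v : V1, M1 v -> theta ('X *: v) = 'X^r *: theta v) &
  (forall (v : V1) (w : V2), M1 v -> M2 w -> theta v = p%:R *: w -> exists2 w' : V1, M1 w' & v = p%:R *: w')].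
Proof.
move=> [f [f_set [f_inj [f_surj f_mul]]]].
have [A1n HM1 HT1 _ [e1 [k1 [t1 Hp1]]]] := H1; have [A2n HM2 HT2 _ _] := H2.
have f1 : f (crys_one D1) = crys_one D2.
  have S1 := modelled_one H1; have := f_mul _ _ S1 S1.
  have -> : crys_mul n D1 (crys_one D1) (crys_one D1) = crys_one D1.
    by rewrite /crys_mul /crys_one /= mod0n mul0mx add0r.
  have := f_set _ S1; case: (f _) => k x [/= kn _] [Ek Ex].
  have k0 : k = 0%N.
    have : ((k + k) %% n = (k + 0) %% n)%N by rewrite -Ek addn0 modn_small.
    by move=> /eqP; rewrite eqn_modDl mod0n modn_small // => /eqP.
  rewrite /crys_one k0; congr (_, _); move: Ex; rewrite k0 expr0 [x *m 1]mulmx1.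
  by move=> /eqP; rewrite -subr_eq0 opprD addrA subrr sub0r oppr_eq0 => /eqP.
have f_iter s : crys_set n D1 s -> forall m, crys_set n D1 (iter m (crys_mul n D1 s) (crys_one D1)) /\
    f (iter m (crys_mul n D1 s) (crys_one D1)) = iter m (crys_mul n D2 (f s)) (crys_one D2).
  move=> Ss; elim=> [|m [IH1 IH2]]; first by split; [exact: modelled_one H1|].
  by rewrite !iterS; split; [exact: modelled_mul H1 _ _|rewrite f_mul // IH2].
have S0 v : M1 v -> crys_set n D1 (0%N, v) by move/(modelled_M v H1).
have f0 v : M1 v -> (f (0%N, v)).1 = 0%N.
  move=> Mv; have := f_set _ (S0 _ Mv); case Ef: (f _) => [k w] [/= kn _].
  apply: (modelled_faithful H2 kn) => u /(modelled_M u H2) Su.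
  (* The [n]-th power of a preimage of [(0, u)] is a translation and commutes with [(0, v)]. Hence
     [a^k] fixes [n] times [u], and so [u] itself. *)
  have [[h x] [Sx Ex]] := f_surj _ Su; have [Si Ei] := f_iter _ Sx n.
  move: Si Ei; rewrite Ex (crys_pow (iota := iota) A1n) (crys_pow (iota := iota) A2n) mul0n mod0n modnMl.
  rewrite expr0 geo1; set x' := _ *: _ => Sx' Ex'.
  have Ec : crys_mul n D1 (0%N, v) (0%N, x') = crys_mul n D1 (0%N, x') (0%N, v).
    by rewrite /crys_mul /= !expr0 ![_ *m 1]mulmx1 addrC.
  have := congr1 f Ec; rewrite !f_mul // ?Ef ?Ex'; try exact: S0.
  rewrite /crys_mul /= expr0 [w *m 1]mulmx1 addrC => [[_ /addIr E]].
  have E2 : (n%:R : P) *: (('X^k : P) *: (u : V2) - u) = 0.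
    rewrite scalerBr scaleCA matmodXn -E; apply/eqP; by rewrite subr_eq0.
  have E3 : ('X^k : P) *: (u : V2) - u = 0.
    by apply: (matmod_tf Kres iota_inj (m := n.-1)); rewrite prednK.
  by have := subr0_eq E3; rewrite matmodXn.
pose theta (v : V1) : V2 := (f (0%N, v)).2.
have fE v : M1 v -> f (0%N, v) = (0%N, theta v :> 'rV_(cd_N D2)).
  by move=> Mv; have := f0 _ Mv; rewrite /theta; case: (f _) => k w /= ->.
have theta_M v : M1 v -> M2 (theta v).
  by move=> Mv; apply/(modelled_M _ H2); rewrite -fE //; apply: f_set; exact: S0.
have theta_D u v : M1 u -> M1 v -> theta (u + v) = theta u + theta v.
  move=> Mu Mv; have := f_mul _ _ (S0 _ Mu) (S0 _ Mv); rewrite !fE //.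
  rewrite /crys_mul /= !expr0 !mod0n ![_ *m 1]mulmx1 fE; last exact: (submodD HM1).
  by case.
have theta_inj u v : M1 u -> M1 v -> theta u = theta v -> u = v.
  move=> Mu Mv E; have := f_inj _ _ (S0 _ Mu) (S0 _ Mv); rewrite !fE // E => /(_ erefl).
  by case.
have n1 : (1 < n)%N by rewrite (leq_trans (prime_gt1 p_pr)) // leq_pmull.
have Stau : crys_set n D1 (1%N, cd_T D1 1%N).
  split=> //=; split; first exact: HT1.1.
  by rewrite subrr; exact: HM1.1.
(* [r] is the exponent to which [a] is sent; conjugation by a lift of [a] then gives the twisted
   action. *)
case Er: (f (1%N, cd_T D1 1%N)) => [r y].
have Sr := f_set _ Stau; rewrite Er in Sr.
have twist v : M1 v -> theta ('X *: (v : V1)) = 'X^r *: theta v.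
  move=> Mv; have MXv := submodZ HM1 'X Mv.
  have Ec : crys_mul n D1 (0%N, v) (1%N, cd_T D1 1%N) =
      crys_mul n D1 (1%N, cd_T D1 1%N) (0%N, 'X *: (v : V1)).
    rewrite /crys_mul /= add0n addn0 expr0 expr1 [cd_T D1 _ *m 1]mulmx1 matmodX.
    by rewrite addrC.
  have := congr1 f Ec; rewrite !f_mul //; try exact: S0.
  rewrite !fE // Er /crys_mul /= expr0 [y *m 1]mulmx1 => [[_]].
  by rewrite addrC => /addrI E; rewrite matmodXn E.
have twistX i v : M1 v -> theta ('X^i *: (v : V1)) = 'X^(r * i) *: theta v.
  move=> Mv; elim: i => [|i IH]; first by rewrite muln0 !expr0 !scale1r.
  rewrite exprS -scalerA twist; last exact: (submodZ HM1).
  by rewrite IH scalerA -exprD mulnS.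
have [[Me _ _] _ _ _ _] := Hp1.
exists theta, r; split=> //.
- apply/negP => /dvdnP [c Ec]; apply: (pres_Xp1_e Kres Hp1).
  rewrite scalerBl scale1r; apply/eqP; rewrite subr_eq0; apply/eqP.
  apply: theta_inj => //; first exact: (submodZ HM1).
  rewrite twistX // -[RHS]scale1r -(expr0 'X); apply: (XN1_act A2n); apply: XN1_cong.
  by rewrite Ec -mulnA mulnn modnMl mod0n.
(* The preimage of a translation is a translation too: it commutes with [M1], on which [C_{p^2}]
   acts faithfully. *)
- move=> v w Mv Mw E; have Sw := (modelled_M w H2).1 Mw.
  have [[h x] [Sx Ex]] := f_surj _ Sw.
  have h0 : h = 0%N.
    have hn : (h < n)%N by case: Sx.
    apply: (modelled_faithful H1 hn) => u Mu.
    have Ec : f (crys_mul n D1 (h, x) (0%N, u)) = f (crys_mul n D1 (0%N, u) (h, x)).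
      rewrite !f_mul //; try exact: S0.
      by rewrite Ex fE // /crys_mul /= !expr0 ![_ *m 1]mulmx1 addrC.
    have := f_inj _ _ (modelled_mul H1 Sx (S0 _ Mu)) (modelled_mul H1 (S0 _ Mu) Sx) Ec.
    rewrite /crys_mul /= expr0 [x *m 1]mulmx1 addrC => [[_ /addIr]].
    by move=> <-.
  rewrite h0 in Sx Ex; have Mx := (modelled_M x H1).2 Sx.
  exists x => //; apply: theta_inj => //; first exact: (submodZ HM1).
  have -> : theta (p%:R *: (x : V1)) = p%:R *: theta x.
    elim: (p) => [|q IH].
      rewrite !scale0r; have := theta_D 0 0 HM1.1 HM1.1; rewrite addr0.
      by move=> /eqP; rewrite -subr_eq0 opprD addrA subrr sub0r oppr_eq0 => /eqP.
    rewrite !mulrSr !scalerDl !scale1r theta_D ?IH //; exact: (submodZ HM1).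
  by rewrite E; congr (_ *: _); move: Ex; rewrite fE // => [[->]].
Qed.

(** Under [theta], [lam] becomes [X^r - 1], a multiple of [lam], and [phi1], [phi2] become multiples
    of themselves. So both divisibility conditions pass from [M2] back to [M1]. *)
Lemma iso_transfer : crys_iso n D1 D2 ->
  (ty2 = false -> ty1 = false) /\
  (forall j, (0 < j)%N -> (len_ty p ty2 <= m2 + j)%N -> (len_ty p ty1 <= m1 + j)%N).
Proof.
move=> /iso_lattice_map [theta [r [pr_r theta_M theta_D twist pdiv]]].
have [A1n HM1 HT1 R1 [e1 [k1 [t1 Hp1]]]] := H1.
have [A2n HM2 HT2 R2 [e2 [k2 [t2 Hp2]]]] := H2.
have tf1 v := matmod_tfp Kres iota_inj (A := A1) (v := v).
have tf2 v := matmod_tfp Kres iota_inj (A := A2) (v := v).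
have twistX i (v : V1) : M1 v -> theta ('X^i *: v) = 'X^(i * r) *: theta v.
  move=> Mv; elim: i => [|i IH]; first by rewrite mul0n !expr0 !scale1r.
  rewrite exprS -scalerA twist; last exact: (submodZ HM1).
  by rewrite IH scalerA -exprD mulSn.
have twist_geo i c (v : V1) : M1 v ->
    theta (geo c ('X^i : P) *: v) = geo c ('X^(i * r) : P) *: theta v.
  move=> Mv; elim: c => [|c IH].
    rewrite /geo !big_ord0 !scale0r; have := theta_D 0 0 HM1.1 HM1.1; rewrite addr0.
    by move=> /eqP; rewrite -subr_eq0 opprD addrA subrr sub0r oppr_eq0 => /eqP.
  rewrite !geoS !scalerDl !scale1r -!scalerA theta_D //; last by do 2 apply: (submodZ HM1).
  by rewrite twistX ?IH //; exact: (submodZ HM1).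
have twist_lam j (v : V1) : M1 v -> theta (lam ^+ j *: v) = ('X^r - 1) ^+ j *: theta v.
  move=> Mv; elim: j => [|j IH]; first by rewrite !expr0 !scale1r.
  rewrite !exprS -!scalerA -IH; set u := lam ^+ j *: v.
  have Mu : M1 u by exact: (submodZ HM1).
  have E : theta (lam *: u) + theta u = 'X^r *: theta u.
    rewrite -theta_D //; last exact: (submodZ HM1).
    by rewrite -twist // /lamR scalerBl scale1r subrK.
  by rewrite [RHS]scalerBl scale1r -E addrK.
split=> [|j j0].
  move=> /(pres_invariant_phi1 Kres tf2 HM2 Hp2 R2) I2.
  apply/(pres_invariant_phi1 Kres tf1 HM1 Hp1 R1) => v [Mv Lv].
  have [s Es] := phi1_Xr K0 p_pr pr_r.
  have [|w [Mw Ew]] := I2 (theta v).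
    split; first exact: theta_M.
    (* [X^(p * r)] fixes [theta v]; as [p] does not divide [r], one of its powers is [X^p] modulo
       [X^(p^2) - 1]. *)
    have E : 'X^(p * r) *: theta v = theta v.
      by rewrite -twistX //; congr (theta _); apply/subr0_eq; rewrite -[X in _ - X]scale1r -scalerBl.
    have rn : (0 < (p * r) %% n < n)%N.
      rewrite ltn_mod n_gt0 andbT lt0n -mulnn -muln_modr muln_eq0 negb_or -lt0n p_gt0.
      by rewrite -/(dvdn p r).
    have [s' [c' E']] := mult_to_p p_pr rn.
    have Es' : 'X^((p * r) * s') *: theta v = theta v.
      by elim: (s') => [|q IH]; [rewrite muln0 expr0 scale1r|rewrite mulnS exprD -scalerA IH E].
    rewrite scalerBl scale1r -[X in _ - X]Es'; apply/eqP; rewrite subr_eq0; apply/eqP.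
    apply: (XN1_act A2n); apply: XN1_cong.
    by rewrite -[RHS]modnMml E' [in RHS]addnC mulnC modnMDl.
  have [|w' Mw' Ew'] := pdiv (phi1 *: v) (s *: w) (submodZ HM1 _ Mv) (submodZ HM2 _ Mw).
    have := twist_geo 1%N p v Mv; rewrite mul1n Es.
    have -> : geo p ('X^1 : P) = phi1 by rewrite expr1.
    by move=> ->; rewrite mulrC -scalerA Ew scaleCA.
  by exists w'.
move=> /(pres_invariant_phi2 Kres tf2 HM2 Hp2 j0) I2.
apply/(pres_invariant_phi2 Kres tf1 HM1 Hp1 j0) => v Mv.
have [s Es] := phi2_Xr K0 p_pr pr_r.
have [w [Mw Ew]] := I2 _ (theta_M _ Mv).
pose a := geo r ('X : P) ^+ j * s.
have [|w' Mw' Ew'] := pdiv ((lam ^+ j * phi2) *: v) (a *: w) (submodZ HM1 _ Mv) (submodZ HM2 _ Mw).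
  rewrite -scalerA twist_lam; last exact: (submodZ HM1).
  rewrite -(geo_p_phi2 p K0) twist_geo // Es scalerA.
  have -> : ('X^r - 1) ^+ j * (phi2 * s) = a * (lam ^+ j * phi2) :> P.
    by rewrite subrX1 -/(geo r 'X) -/lam exprMn /a; ring.
  by rewrite -scalerA Ew scaleCA.
by exists w'.
Qed.

End Transfer.

Theorem modelled_iso_inj (D1 D2 : crys_data F) ty1 ty2 m1 m2 :
  modelled D1 ty1 m1 -> modelled D2 ty2 m2 -> crys_iso n D1 D2 -> ty1 = ty2 /\ m1 = m2.
Proof.
move=> H1 H2 I12.
have I21 : crys_iso n D2 D1.
  by apply: crys_iso_sym I12 => s t; [exact: modelled_mul H1|exact: modelled_mul H2].
have [t12 l12] := iso_transfer H1 H2 I12; have [t21 l21] := iso_transfer H2 H1 I21.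
have E : ty1 = ty2.
  by case: ty1 ty2 t12 t21 {H1 H2 l12 l21} => [] [] // t12 t21; [rewrite t12|rewrite t21].
split=> //; subst ty2.
have mlt m D : modelled D ty1 m -> (m < len_ty p ty1)%N.
  by move=> [_ _ _ + _]; rewrite /range_ok /len_ty; case: (ty1); lia.
have L1 := mlt _ _ H1; have L2 := mlt _ _ H2.
(* Each index is tested at its own threshold, the least exponent [j] with [lenT <= m + j]. *)
apply/eqP; rewrite eqn_leq; apply/andP; split.
- have := l21 (len_ty p ty1 - m1)%N; rewrite subnKC ?subn_gt0 ?(ltnW L1) // L1 leqnn => /(_ isT isT).
  by lia.
- have := l12 (len_ty p ty1 - m2)%N; rewrite subnKC ?subn_gt0 ?(ltnW L2) // L2 leqnn => /(_ isT isT).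
  by lia.
Qed.

End NonIso.

(** * The subset [K] of [F] as a ring with residue map *)

Section SubringType.
Variables (F : fieldType) (K : F -> Prop).
Definition subring_pred : {pred F} := fun x => `[<K x>].
Hypothesis HK : subring_closed subring_pred.
HB.instance Definition _ := GRing.isSubringClosed.Build F subring_pred HK.

Record subring_type := SubringType { subring_val : F; _ : subring_val \in subring_pred }.
HB.instance Definition _ := [isSub for subring_val].
HB.instance Definition _ := [Choice of subring_type by <:].
HB.instance Definition _ := [SubChoice_isSubComNzRing of subring_type by <:].

Lemma subring_type_exists : exists (K0 : comNzRingType) (iota : {rmorphism K0 -> F}),
  injective iota /\ forall x, K x <-> exists y, iota y = x.
Proof.
exists subring_type, (val : {rmorphism subring_type -> F}); split; first exact: val_inj.
move=> x; split=> [Kx|[[y Ky] <-]]; last exact: asboolW Ky.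
by exists (SubringType (asboolT Kx : x \in subring_pred)).
Qed.

End SubringType.

Section ResidueMap.
Variables (p : nat) (K : comNzRingType).
Hypothesis p_pr : prime p.
Hypothesis res1 : forall x : K, exists k y, x = k%:R + p%:R * y.
Hypothesis res2 : forall k (y : K), k%:R = p%:R * y -> (p %| k)%N.

Lemma residue_map : exists red : {rmorphism K -> 'F_p}, forall x, red x = 0 -> rdvd (p%:R : K) x.
Proof.
have /choice [ky Hky] : forall x : K, exists ky : nat * K, x = ky.1%:R + p%:R * ky.2.
  by move=> x; have [k [y E]] := res1 x; exists (k, y).
pose f x : 'F_p := (ky x).1%:R.
have uniq k k' (y y' : K) : k%:R + p%:R * y = k'%:R + p%:R * y' -> k%:R = k'%:R :> 'F_p.
  wlog le_kk : k k' y y' / (k' <= k)%N => [H E|E].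
    by have [/H|/ltnW/H] := leqP k' k; [apply; exact: E|move=> {}H; rewrite (H _ _ (esym E))].
  have dv : (p %| k - k')%N.
    apply: (res2 (y := y' - y)); rewrite natrB //.
    by rewrite -[k%:R](addrK (p%:R * y)) E; ring.
  rewrite -(subnK le_kk) natrD; move/dvdnP: dv => [c ->].
  by rewrite natrM pchar_Fp_0 // mulr0 add0r.
have fE x k y : x = k%:R + p%:R * y -> f x = k%:R.
  by move=> E; apply: (uniq _ _ (ky x).2 y); rewrite -Hky.
have fB : zmod_morphism f.
  (* A natural number congruent to the difference modulo [p]: the added multiple of [p] avoids
     truncated subtraction. *)
  move=> x y; pose k := ((ky x).1 + p * (ky y).1 - (ky y).1)%N.
  have le : ((ky y).1 <= (ky x).1 + p * (ky y).1)%N.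
    by apply: leq_trans (leq_addl _ _); rewrite leq_pmull // prime_gt0.
  rewrite (fE _ k ((ky x).2 - (ky y).2 - (ky y).1%:R)).
    by rewrite /k natrB // natrD natrM pchar_Fp_0 // mul0r addr0.
  by rewrite {1}(Hky x) {1}(Hky y) /k natrB // natrD natrM; ring.
have fM : monoid_morphism f.
  split; first by rewrite (fE _ 1%N 0) // mulr0 addr0.
  move=> x y; rewrite (fE _ ((ky x).1 * (ky y).1)%N
    ((ky x).1%:R * (ky y).2 + (ky x).2 * (ky y).1%:R + p%:R * (ky x).2 * (ky y).2)).
    by rewrite natrM.
  by rewrite {1}(Hky x) {1}(Hky y) natrM; ring.
pose fA := GRing.isZmodMorphism.Build K 'F_p f fB.
pose fR := GRing.isMonoidMorphism.Build K 'F_p f fM.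
pose red : {rmorphism K -> 'F_p} := HB.pack f fA fR.
exists red => x /= fx0; have dv : (p %| (ky x).1)%N.
  by rewrite (dvdn_pcharf (pchar_Fp p_pr)); apply/eqP.
rewrite (Hky x); apply: rdvdD; last exact: rdvdMr (rdvd_refl _).
by move/dvdnP: dv => [c ->]; rewrite natrM; apply: rdvdMl; exact: rdvd_refl.
Qed.

End ResidueMap.

(** The residue axioms stated inside [F], so that both descriptions of [K] are checked by computing
    with elements of [F]. *)
Record local_subring (p : nat) (F : fieldType) (K : F -> Prop) : Prop := LocalSubring {
  ls_closed : subring_closed (subring_pred K);
  ls_res1 : forall x, K x -> exists k y, K y /\ x = k%:R + p%:R * y;
  ls_res2 : forall k y, K y -> k%:R = p%:R * y -> (p %| k)%N;
  ls_unit : forall x, K x -> ~ (exists y, K y /\ x = p%:R * y) -> exists y, K y /\ x * y = 1;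
  ls_sep : forall x, K x -> (forall s, exists y, K y /\ x = p%:R ^+ s * y) -> x = 0;
  ls_p : p%:R != 0 :> F }.

Lemma local_subring_residue p F K : prime p -> @local_subring p F K ->
  exists (K0 : comNzRingType) (iota : {rmorphism K0 -> F}) (red : {rmorphism K0 -> 'F_p}),
  [/\ residue_axioms red, injective iota & forall x, K x <-> exists y, iota y = x].
Proof.
move=> p_pr [HK H1 H2 H3 H4 H5]; have [K0 [iota [inj KE]]] := subring_type_exists HK.
have Ki y : K (iota y) by apply/KE; exists y.
have [||red Hred] := @residue_map p K0 p_pr.
- move=> x; have [k [y [/KE [y0 <-] E]]] := H1 _ (Ki x).
  by exists k, y0; apply: inj; rewrite E rmorphD rmorphM /= !rmorph_nat.
- by move=> k y E; apply: (H2 k _ (Ki y)); rewrite -!(rmorph_nat iota) -rmorphM /= -E.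
exists K0, iota, red; split=> //; split=> //.
- move=> x nx; have [|y [/KE [y0 <-] E]] := H3 _ (Ki x).
    move=> [y [/KE [y0 <-] E]]; move/eqP: nx; apply.
    have -> : x = p%:R * y0 by apply: inj; rewrite E rmorphM /= rmorph_nat.
    by rewrite rmorphM /= rmorph_nat pchar_Fp_0 // mul0r.
  by exists y0; apply: inj; rewrite rmorphM /= E rmorph1.
- move=> x E; apply: inj; rewrite rmorph0; apply: (mulfI H5).
  by rewrite mulr0 -(rmorph_nat iota) -rmorphM /= E rmorph0.
- move=> x Hx; apply: inj; rewrite rmorph0; apply: (H4 _ (Ki x)) => s.
  by have [y ->] := Hx s; exists (iota y); split=> //; rewrite rmorphM rmorphXn /= rmorph_nat.
Qed.

Lemma Zploc_local p F K : prime p -> is_Zploc_in p F K -> @local_subring p F K.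
Proof.
move=> p_pr [ch KE]; have p0 := prime_gt0 p_pr.
have int0 (z : int) : z%:~R = 0 :> F -> z = 0.
  case: z => [[|m]|m] //.
    by rewrite -pmulrn => /eqP; rewrite (negPf (ch m)).
  by rewrite NegzE mulrNz -pmulrn => /eqP; rewrite oppr_eq0 (negPf (ch m)).
have intI (a b : int) : a%:~R = b%:~R :> F -> a = b.
  by move=> E; apply/subr0_eq/int0; rewrite rmorphB /= E subrr.
have nz (z : int) : ~~ (p%:Z %| z)%Z -> z%:~R != 0 :> F.
  by apply: contraNneq => /int0 ->; exact: dvdz0.
have pdM (a b : int) : ~~ (p%:Z %| a)%Z -> ~~ (p%:Z %| b)%Z -> ~~ (p%:Z %| a * b)%Z.
  by rewrite !dvdzE /= abszM Euclid_dvdM // negb_or => -> ->.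
have pF : p%:R = p%:Z%:~R :> F by [].
split.
- split.
  + apply/asboolP/KE; exists 1, 1; split; last by rewrite divr1.
    by rewrite dvdzE /= Euclid_dvd1.
  + move=> x y /asboolP/KE [a [b [nb ->]]] /asboolP/KE [c [d [nd ->]]].
    apply/asboolP/KE; exists (a * d - c * b), (b * d); split; first exact: pdM.
    rewrite rmorphB !rmorphM /=; field; by rewrite !nz.
  + move=> x y /asboolP/KE [a [b [nb ->]]] /asboolP/KE [c [d [nd ->]]].
    apply/asboolP/KE; exists (a * c), (b * d); split; first exact: pdM.
    rewrite !rmorphM /=; field; by rewrite !nz.
- move=> x /KE [a [b [nb ->]]].
  have cop : coprimez p%:Z b by rewrite coprimezE prime_coprime // -[p in (p %| _)%N]/(absz p%:Z) -dvdzE.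
  have [[u v] /= Euv] := coprimezP _ _ cop.
  (* From [u p + v b = 1], the residue of [a / b] is that of [a v]. *)
  pose k := ((a * v) %% p%:Z)%Z.
  have k0 : (0 <= k)%R by apply: modz_ge0; rewrite eqz_nat; lia.
  have Ek : (`|k|%N%:Z = k) by rewrite gez0_abs.
  exists `|k|%N, ((a * u + (a * v %/ p%:Z)%Z * b)%:~R / b%:~R); split.
    by apply/KE; exists (a * u + (a * v %/ p%:Z)%Z * b), b.
  have -> : `|k|%N%:R = k%:~R :> F by rewrite -[in RHS]Ek.
  have E : a = k * b + p%:Z * (a * u + (a * v %/ p%:Z)%Z * b).
    rewrite /k; have := divz_eq (a * v) p%:Z; move: (_ %/ _)%Z (_ %% _)%Z => q r Er.
    have -> : r = a * v - q * p%:Z by rewrite Er addrC addKr.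
    rewrite -[LHS]mulr1 -Euv; ring.
  apply: (mulIf (nz _ nb)); rewrite mulfVK ?nz // mulrDl -mulrA mulfVK ?nz //.
  by rewrite pF -!rmorphM -rmorphD /= -E.
- move=> k y /KE [a [b [nb ->]]] E.
  have Ekb : (k%:Z * b) = (p%:Z * a).
    by apply: intI; rewrite !rmorphM /= -[k%:Z%:~R]/(k%:R) E mulrA mulfVK ?nz.
  have : (p %| `|(k%:Z * b)%R|)%N by rewrite Ekb abszM dvdn_mulr.
  by rewrite abszM Euclid_dvdM // => /orP [//|H]; move: nb; rewrite dvdzE /= H.
- move=> x /KE [a [b [nb ->]]] Hx.
  have na : ~~ (p%:Z %| a)%Z.
    apply/negP => /dvdzP [q Eq]; apply: Hx; exists (q%:~R / b%:~R); split.
      by apply/KE; exists q, b.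
    by rewrite Eq rmorphM /= mulrA; congr (_ / _); rewrite mulrC.
  exists (b%:~R / a%:~R); split; first by apply/KE; exists b, a.
  by field; rewrite !nz.
- move=> x /KE [a [b [nb ->]]] Hx; suff -> : a = 0 by rewrite mul0r.
  apply/eqP; rewrite -absz_eq0 -leqn0 leqNgt; apply/negP => a0.
  (* One exponent suffices: [p ^ |a|] exceeds [|a|] and cannot divide a nonzero [a]. *)
  have [y [/KE [c [d [nd ->]]] E]] := Hx `|a|%N.
  have Eab : a * d = p%:Z ^+ `|a| * c * b.
    apply: intI; move: E; rewrite mulrA => /eqP; rewrite eqr_div ?nz // => /eqP.
    by rewrite !rmorphM rmorphXn.
  have : (p ^ `|a| %| `|a| * `|d|)%N.
    by rewrite -abszM Eab !abszM abszX /= -mulnA dvdn_mulr.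
  rewrite Gauss_dvdl; last by rewrite coprimeXl // prime_coprime.
  by move=> /(dvdn_leq a0); rewrite leqNgt ltn_expl // prime_gt1.
- by have := ch p.-1; rewrite prednK.
Qed.

(** * The [p]-adic integers as coherent sequences *)

Section PadicIntegers.
Variables (p : nat) (F : fieldType) (K : F -> Prop) (phi : (nat -> int) -> F).
Hypothesis p_pr : prime p.
Hypothesis phiD : forall x y, padic_valid p x -> padic_valid p y ->
  phi (padic_add p x y) = phi x + phi y.
Hypothesis phiM : forall x y, padic_valid p x -> padic_valid p y ->
  phi (padic_mul p x y) = phi x * phi y.
Hypothesis phi1 : phi (padic_one p) = 1.
Hypothesis phi_inj : forall x y, padic_valid p x -> padic_valid p y -> phi x = phi y ->
  forall k, x k = y k.
Hypothesis KE : forall f : F, K f <-> exists x, padic_valid p x /\ phi x = f.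
Let p_gt0 : (0 < p)%N := prime_gt0 p_pr.

Definition pw k : int := (p ^ k)%:Z.

(* Sequences that are compatible modulo [p ^ k], without normalization of the terms. *)
Definition coherent (z : nat -> int) := forall k, (pw k %| z k.+1 - z k)%Z.
Definition reduce (z : nat -> int) : nat -> int := fun k => (z k %% pw k)%Z.

Lemma pw_gt0 k : (0 < pw k)%R. Proof. by rewrite ltz_nat expn_gt0 p_gt0. Qed.

Lemma pw_neq0 k : pw k != 0. Proof. by rewrite eqz_nat expn_eq0; case: p p_gt0. Qed.

Lemma pwS k : pw k.+1 = p%:Z * pw k. Proof. by rewrite /pw expnS PoszM. Qed.

Lemma dvdz_mod k z : (pw k %| (z %% pw k)%Z - z)%Z.
Proof. by rewrite -eqz_mod_dvd modz_mod. Qed.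

Lemma reduce_valid z : coherent z -> padic_valid p (reduce z).
Proof.
move=> Hz k; rewrite /reduce; split; first exact: modz_ge0 (pw_neq0 k).
split; first exact: ltz_pmod (pw_gt0 k).
apply/eqP; rewrite -/(pw k) eqz_mod_dvd.
have -> a : a - z k = (a - z k.+1) + (z k.+1 - z k) by rewrite addrA subrK.
apply: rpredD; last exact: Hz.
by apply: dvdz_trans (dvdz_mod k.+1 _); rewrite pwS dvdz_mull.
Qed.

Lemma valid_coherent x : padic_valid p x -> coherent x.
Proof.
move=> Hx k; have [_ [_ E]] := Hx k.
by rewrite -eqz_mod_dvd -/(pw k) in E *; rewrite -[in X in _ == X]E modz_mod.
Qed.

Lemma valid_reduce x : padic_valid p x -> reduce x = x.
Proof.
move=> Hx; apply/funext => k; have [x0 [xk _]] := Hx k.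
by rewrite /reduce modz_small // x0.
Qed.

(** [phi] extended to unnormalized sequences, on which sums and products are taken term by term. *)
Definition psi z := phi (reduce z).

Lemma psiD z w : coherent z -> coherent w -> psi (fun k => z k + w k) = psi z + psi w.
Proof.
move=> Hz Hw; rewrite /psi -phiD; try exact: reduce_valid.
by congr phi; apply/funext => k; rewrite /padic_add /reduce modzDm.
Qed.

Lemma psiM z w : coherent z -> coherent w -> psi (fun k => z k * w k) = psi z * psi w.
Proof.
move=> Hz Hw; rewrite /psi -phiM; try exact: reduce_valid.
by congr phi; apply/funext => k; rewrite /padic_mul /reduce modzMm.
Qed.

Lemma eq_psi z w : (forall k, (pw k %| z k - w k)%Z) -> psi z = psi w.
Proof.
move=> H; congr phi; apply/funext => k; rewrite /reduce.
by apply/eqP; rewrite eqz_mod_dvd.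
Qed.

Lemma psi_inj z w : coherent z -> coherent w -> psi z = psi w ->
  forall k, (pw k %| z k - w k)%Z.
Proof.
move=> Hz Hw E k; rewrite -eqz_mod_dvd; apply/eqP.
exact: phi_inj (reduce_valid Hz) (reduce_valid Hw) E k.
Qed.

Lemma KP f : K f <-> exists z, coherent z /\ psi z = f.
Proof.
split=> [/KE [x [Hx <-]]|[z [Hz <-]]].
  by exists x; split; [exact: valid_coherent|rewrite /psi valid_reduce].
by apply/KE; exists (reduce z); split=> //; exact: reduce_valid.
Qed.

Lemma coherentD z w : coherent z -> coherent w -> coherent (fun k => z k + w k).
Proof. by move=> Hz Hw k; rewrite opprD addrACA rpredD. Qed.

Lemma coherentN z : coherent z -> coherent (fun k => - z k).
Proof. by move=> Hz k; rewrite -opprD rpredN. Qed.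

Lemma coherentM z w : coherent z -> coherent w -> coherent (fun k => z k * w k).
Proof.
move=> Hz Hw k.
have -> : z k.+1 * w k.+1 - z k * w k = (z k.+1 - z k) * w k.+1 + z k * (w k.+1 - w k) by ring.
by apply: rpredD; [rewrite dvdz_mulr|rewrite dvdz_mull].
Qed.

Lemma coherent_const c : coherent (fun=> c).
Proof. by move=> k; rewrite subrr dvdz0. Qed.

Lemma psi_nat m : psi (fun=> m%:Z) = m%:R.
Proof.
elim: m => [|m IH].
  have := psiD (coherent_const 0) (coherent_const 0); rewrite addr0 => /eqP.
  by rewrite -subr_eq0 opprD addrA subrr sub0r oppr_eq0 => /eqP.
have <- : psi (fun=> m%:Z + 1) = m.+1%:R.
  have psi1 : psi (fun=> 1) = 1 := phi1.
  by rewrite (psiD (coherent_const m) (coherent_const 1)) IH psi1 mulrSr.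
by congr psi; apply/funext => k; rewrite -addn1 PoszD.
Qed.

(** The quotient is [w k = (z k.+1 - c) / p]: division by [p] costs one digit of precision, hence
    the shift of index. *)
Lemma psi_div c z : coherent z -> (p%:Z %| z 1%N - c%:Z)%Z ->
  exists w, coherent w /\ psi z = c%:R + p%:R * psi w.
Proof.
move=> Hz H1; have Hk k : (p%:Z %| z k.+1 - c%:Z)%Z.
  elim: k => [//|k IH]; rewrite (_ : _ - _ = (z k.+2 - z k.+1) + (z k.+1 - c%:Z)); last by ring.
  by apply: rpredD => //; apply: dvdz_trans (Hz k.+1); rewrite pwS dvdz_mulr.
have /choice [w Hw] : forall k, exists w, z k.+1 - c%:Z = w * p%:Z.
  by move=> k; apply/dvdzP.
have cw : coherent w.
  move=> k; have := Hz k.+1; have -> : z k.+2 - z k.+1 = p%:Z * (w k.+1 - w k).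
    have -> : z k.+2 - z k.+1 = (z k.+2 - c%:Z) - (z k.+1 - c%:Z) by ring.
    by rewrite !Hw; ring.
  rewrite pwS dvdz_mul2l //; by case: p p_gt0.
exists w; split=> //; rewrite -!psi_nat -psiM //; last exact: coherent_const.
rewrite -psiD; try exact: coherent_const; last by apply: coherentM => //; exact: coherent_const.
apply: eq_psi => k; have -> : z k - (c%:Z + p%:Z * w k) = - (z k.+1 - z k).
  by rewrite mulrC -Hw; ring.
by rewrite rpredN.
Qed.

Lemma Zp_local_psi : local_subring p K.
Proof.
split.
- split.
  + by apply/asboolP/KP; exists (fun=> 1); split; [exact: coherent_const|exact: (psi_nat 1)].
  + move=> x y /asboolP/KP [z [Hz <-]] /asboolP/KP [w [Hw <-]]; apply/asboolP/KP.
    have Hzw := coherentD Hz (coherentN Hw); exists (fun k => z k + - w k); split=> //.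
    apply/eqP; rewrite eq_sym subr_eq -psiD //; apply/eqP; congr psi.
    by apply/funext => k; rewrite subrK.
  + move=> x y /asboolP/KP [z [Hz <-]] /asboolP/KP [w [Hw <-]]; apply/asboolP/KP.
    by exists (fun k => z k * w k); split; [exact: coherentM|exact: psiM].
- move=> x /KP [z [Hz <-]]; pose c := `|(z 1%N %% pw 1)%Z|%N.
  have [|w [Hw E]] := @psi_div c z Hz.
    have := dvdz_mod 1 (z 1%N); rewrite -rpredN opprB {1}/pw expn1.
    by rewrite /c gez0_abs // modz_ge0 // pw_neq0.
  by exists c, (psi w); split=> //; apply/KP; exists w.
- move=> k y /KP [w [Hw <-]]; rewrite -!psi_nat -psiM //; last exact: coherent_const.
  move=> E; have := psi_inj (coherent_const k) (coherentM (coherent_const p) Hw) E 1%N.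
  rewrite /pw expn1 => H; have : (p%:Z %| k%:Z)%Z.
    by rewrite -[k%:Z](subrK (p%:Z * w 1%N)) rpredD // dvdz_mulr.
  by [].
- move=> x /KP [z [Hz <-]] Hx.
  have n1 : ~~ (p%:Z %| z 1%N)%Z.
    apply/negP => H1; apply: Hx; have [|w [Hw E]] := @psi_div 0 z Hz; first by rewrite subr0.
    by exists (psi w); split; [apply/KP; exists w|rewrite E add0r].
  have nk k : ~~ (p%:Z %| z k.+1)%Z.
    elim: k => [//|k]; apply: contra => H; rewrite -[z k.+1](subKr (z k.+2)) rpredB //.
    by apply: dvdz_trans (Hz k.+1); rewrite pwS dvdz_mulr.
  have cop k : coprimez (pw k.+1) (z k.+1).
    by rewrite coprimezE /= coprimeXl // prime_coprime //; exact: nk.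
  have /choice [u Hu] : forall k, exists u, (pw k %| z k * u - 1)%Z.
    (* Modulo [p ^ 0] there is no condition, so the term of index 0 is arbitrary. *)
    move=> [|k]; first by exists 0; rewrite /pw expn0 dvd1z.
    have [[a b] /= E] := coprimezP _ _ (cop k); exists b.
    have -> : z k.+1 * b - 1 = pw k.+1 * (- a) by rewrite -E; ring.
    exact: dvdz_mulr.
  have cu : coherent u.
    move=> [|k]; first by rewrite /pw expn0 dvd1z.
    rewrite -(Gauss_dvdzr _ (cop k)).
    have -> : z k.+1 * (u k.+2 - u k.+1) = (z k.+2 * u k.+2 - 1) - (z k.+1 * u k.+1 - 1)
       - (z k.+2 - z k.+1) * u k.+2 by ring.
    apply: rpredB; last by apply: dvdz_mulr; exact: Hz.
    apply: rpredB => //; apply: dvdz_trans (Hu k.+2).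
    by rewrite (pwS k.+1) dvdz_mull.
  exists (psi u); split; first by apply/KP; exists u.
  by rewrite -psiM // -[RHS]/(1%:R) -(psi_nat 1); apply: eq_psi.
- move=> x /KP [z [Hz <-]] Hx; rewrite -[RHS]/(0%:R) -(psi_nat 0); apply: eq_psi => s; rewrite subr0.
  have [y [/KP [w [Hw <-]]]] := Hx s; rewrite -natrX -psi_nat -psiM //; last exact: coherent_const.
  move=> E; have := psi_inj Hz (coherentM (coherent_const _) Hw) E s => H.
  by rewrite -[z s](subrK ((p ^ s)%:Z * w s)) rpredD // dvdz_mulr.
- apply/eqP; rewrite -psi_nat -[RHS]/(0%:R) -(psi_nat 0) => E.
  (* Index 2 is the first at which [p] is not congruent to 0. *)
  have := psi_inj (coherent_const p) (coherent_const 0) E 2%N; rewrite subr0 dvdzE /=.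
  by move=> /(dvdn_leq p_gt0); rewrite leqNgt -mulnn ltn_Pmull // prime_gt1.
Qed.

End PadicIntegers.

Lemma Zp_local p F K : prime p -> is_Zp_in p F K -> @local_subring p F K.
Proof. by move=> p_pr [phi [HD [HM [H1 [Hinj HK]]]]]; exact: (Zp_local_psi p_pr HD HM H1 Hinj HK). Qed.

(** * Assembly: the models as crystals and the classification of lattices *)

Section Crystal.
Variables (p : nat) (F : fieldType) (K : F -> Prop).
Variables (K0 : comNzRingType) (iota : {rmorphism K0 -> F}) (red : {rmorphism K0 -> 'F_p}).
Hypothesis Kres : residue_axioms red.
Hypothesis iota_inj : injective iota.
Hypothesis KE : forall x, K x <-> exists y, iota y = x.
Let p_pr : prime p := res_prime Kres.
Let p_gt0 : (0 < p)%N := prime_gt0 p_pr.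
Let n_gt0 : (0 < p ^ 2)%N. Proof. by rewrite expn_gt0 p_gt0. Qed.
Local Notation n := (p ^ 2)%N.
Local Notation P := {poly K0}.
Local Notation phi1 := (phi1R K0 p).
Local Notation phi2 := (phi2R K0 p).
Local Notation idF := (idfun : {rmorphism F -> F}).

Lemma KG_submod N (A : 'M[F]_N) M Q : KG_submodule K A M Q ->
  submod (Q : matmod iota A -> Prop).
Proof.
move=> [_ [Q0 [QD [QZ QA]]]]; apply: submod_closed => // c v Qv.
by apply: QZ => //; apply/KE; exists c.
Qed.

Lemma submod_KG N (A : 'M[F]_N) (M Q : matmod iota A -> Prop) : submod Q ->
  (forall v, Q v -> M v) -> KG_submodule K A M Q.
Proof.
move=> HQ QM; split=> //; split; first exact: HQ.1.
split; first exact: (submodD HQ).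
split=> [c v /KE [y <-] Qv|v Qv].
  by rewrite -(@matmodC _ _ iota _ A); exact: (submodZ HQ).
by rewrite -(@matmodX _ _ iota); exact: (submodZ HQ).
Qed.

Section CyclicCocycle.
Variable D : crys_data F.
Local Notation A := (cd_A D).
Local Notation M := (cd_M D).
Local Notation V := (matmod iota A).
Variable tau : 'rV[F]_(cd_N D).
Hypotheses (An : A ^+ n = 1) (HM : submod (M : V -> Prop)).
Hypotheses (DT : cd_T D = cyc_cocycle A tau) (Stau : fspan M tau).
Hypothesis Mtau : M (phi1 *: (phi2 *: (tau : V))).

Lemma cyc_cocycleE k : cd_T D k = geo k ('X : P) *: (tau : V).
Proof.
rewrite DT /cyc_cocycle /geo scaler_suml mulmx_sumr; apply: eq_bigr => i _.
by rewrite matmodXn.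
Qed.

(** The rule is exact at the exponent [k + k']. Reducing the exponent modulo [p ^ 2] changes the
    geometric sum by a multiple of the norm, which sends [tau] into [M]. *)
Lemma cyc_is_cocycle : is_cocycle n D.
Proof.
have HS := fspan_submod HM; split=> [k _|k k' kn kn'].
  by rewrite cyc_cocycleE; exact: (submodZ HS).
have E : cd_T D k' *m A ^+ k + cd_T D k = geo (k + k') ('X : P) *: (tau : V).
  by rewrite !cyc_cocycleE geoD scalerDl -scalerA matmodXn addrC.
rewrite {}E cyc_cocycleE; set a := (k + k')%N; rewrite {2}(divn_eq a n) addnC geoD scalerDl opprD addrA subrr sub0r.
apply: (submodN HM); rewrite -scalerA; apply: (submodZ HM).
rewrite mulnC geoM geo_n mulrC -scalerA -[(phi1 * phi2) *: _]scalerA.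
exact: (submodZ HM).
Qed.

Lemma cyc_cocycle1 : cd_T D 1%N = tau.
Proof. by rewrite cyc_cocycleE /geo big_ord1 expr0 scale1r. Qed.

End CyclicCocycle.

(** On vectors fixed by [a] the norm acts as [p ^ 2]; this is the origin of the factor [p^(-2)] in
    the cocycles. *)
Lemma norm_scaled N (A : 'M[F]_N) (k : 'rV[F]_N) : lamR K0 *: (k : matmod iota A) = 0 ->
  phi1 *: (phi2 *: ((p%:R ^+ 2)^-1 *: k : matmod iota A)) = k.
Proof.
move=> k0; rewrite (matmod_scaleC iota A phi2) (matmod_scaleC iota A phi1).
rewrite (phi2_Xp1_act (lam_Xp1_act p k0)) scaleCA (phi1_lam_act p k0).
rewrite -polyC_natr !matmodC rmorph_nat.
suff E (v : 'rV[F]_N) : (p%:R ^+ 2)^-1 *: (p%:R *: (p%:R *: v)) = v by exact: E.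
by rewrite !scalerA -expr2 mulVf ?scale1r // expf_neq0 // (pnat_neq0 Kres iota_inj).
Qed.

(** [modelled] with the middle vector tied to the cocycle as its norm: the form in which
    [lattice_iso] compares two groups. *)
Definition crystal (D : crys_data F) ty m e t := [/\ cd_A D ^+ n = 1,
  submod (cd_M D : matmod iota (cd_A D) -> Prop), is_cocycle n D, range_ok p ty m &
  pres p (cd_M D : matmod iota (cd_A D) -> Prop) ty m e
    (phi1 *: (phi2 *: (cd_T D 1%N : matmod iota (cd_A D)))) t].

Lemma crystal_modelled D ty m e t : @crystal D ty m e t -> modelled p iota D ty m.
Proof.
move=> [An HM HT R Hp]; split=> //.
by exists e, (phi1 *: (phi2 *: (cd_T D 1%N : matmod iota (cd_A D)))), t.
Qed.

Lemma crystal_ok D ty m e t : @crystal D ty m e t ->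
  crys_torsion_free n D /\ crys_indecomposable K n D.
Proof.
move=> [An HM HT R Hp]; have Hk := pres_k_phi2 Kres Hp R.
split; first exact/(crys_torsion_freeP Kres iota_inj An HM HT).
split; last exact: (crys_not_cohomologous Kres An HM Hk).
have [[Me _ _] _ _ _ _] := Hp.
split.
  exists e; split=> //; apply/eqP => e0; apply: (pres_Xp1_e Kres Hp).
  by rewrite e0 scaler0.
move=> Q1 Q2 HQ1 HQ2 MQ Q0.
have tf v := matmod_tfp Kres iota_inj (A := cd_A D) (v := v).
have MN v : cd_M D v -> ('X^n - 1 : P) *: (v : matmod iota (cd_A D)) = 0.
  by move=> _; exact: matmod_XN1.
apply: (pres_indecomposable Kres tf HM MN Hp R (KG_submod HQ1) (KG_submod HQ2)).
- by case: HQ1.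
- by case: HQ2.
- by move=> v /MQ [u [w [Qu [Qw E]]]]; exists u, w.
- exact: Q0.
Qed.

Lemma crystal_X i : (i <= p - 2)%N -> exists e t, @crystal (X_data K p i) false i e t /\
  pres p (fspan (cd_M (X_data K p i)) : matmod idF (cd_A (X_data K p i)) -> Prop) false i e
    (phi1 *: (phi2 *: (cd_T (X_data K p i) 1%N : matmod iota (cd_A (X_data K p i))))) t.
Proof.
move=> ip; have [Hp HpF] := pres_X Kres iota_inj KE ip.
pose D := X_data K p i; pose tau := norm_elt F p.
have An : cd_A D ^+ n = 1 by exact: shiftmx_n.
have HM : submod (cd_M D : matmod iota (cd_A D) -> Prop) by apply: (KG_span_submod KE).
have [[_ Mk _] [_ k0 _] _ _ _] := Hp.
have Ek : phi1 *: (phi2 *: (tau : matmod iota (cd_A D))) = X_k p F := norm_scaled k0.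
have tauE : tau = (p%:R ^+ 2)^-1 *: X_k p F by [].
have Stau : fspan (cd_M D) tau.
  rewrite tauE; apply: fspanF; exists [:: (1, X_k p F)]; rewrite big_seq1 scale1r; split=> // y.
  by rewrite inE => /eqP ->.
have T1 : cd_T D 1%N = tau by exact: cyc_cocycle1.
exists (X_e p F i), (X_t p F); rewrite T1 Ek; split=> //; split=> //.
- by apply: (cyc_is_cocycle HM _ Stau) => //; rewrite Ek.
- by rewrite /range_ok; have := prime_gt1 p_pr; lia.
- by rewrite T1 Ek.
Qed.

Lemma crystal_U j : (1 <= j <= p - 2)%N -> exists e t, @crystal (U_data K p j) true j e t /\
  pres p (fspan (cd_M (U_data K p j)) : matmod idF (cd_A (U_data K p j)) -> Prop) true j e
    (phi1 *: (phi2 *: (cd_T (U_data K p j) 1%N : matmod iota (cd_A (U_data K p j))))) t.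
Proof.
move=> /andP [j1 jp]; have [Hp HpF] := pres_U Kres iota_inj KE jp.
pose D := U_data K p j; pose tau := row_mx (norm_elt F p) 0 : 'rV[F]_(cd_N D).
have An : cd_A D ^+ n = 1 by exact: block_shiftmx_n.
have HM : submod (cd_M D : matmod iota (cd_A D) -> Prop) by apply: (KG_span_submod KE).
have [[_ Mk _] [_ k0 _] _ _ _] := Hp.
have tauE : tau = (p%:R ^+ 2)^-1 *: U_k p F by rewrite /tau /U_k scale_row_mx scaler0.
have Ek : phi1 *: (phi2 *: (tau : matmod iota (cd_A D))) = U_k p F.
  by rewrite tauE; exact: norm_scaled k0.
have Stau : fspan (cd_M D) tau.
  rewrite tauE; apply: fspanF; exists [:: (1, U_k p F)]; rewrite big_seq1 scale1r; split=> // y.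
  by rewrite inE => /eqP ->.
have T1 : cd_T D 1%N = tau by exact: cyc_cocycle1.
exists (U_e p F j), (U_t p F); rewrite T1 Ek; split=> //; split=> //.
- by apply: (cyc_is_cocycle HM _ Stau) => //; rewrite Ek.
- by rewrite /range_ok; move: j1 jp; lia.
- by rewrite T1 Ek.
Qed.

Lemma lattice_submod d (A : 'M[F]_d) T : (forall i j, K (A i j)) ->
  submod (cd_M (lattice_data K A T) : matmod iota A -> Prop).
Proof.
move=> KA; have KD x y : K x -> K y -> K (x + y).
  by move=> /KE [a <-] /KE [b <-]; apply/KE; exists (a + b); rewrite rmorphD.
have KM x y : K x -> K y -> K (x * y).
  by move=> /KE [a <-] /KE [b <-]; apply/KE; exists (a * b); rewrite rmorphM.
have K_0 : K 0 by apply/KE; exists 0; rewrite rmorph0.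
apply: submod_closed => /= [j|u v Ku Kv j|c v Kv j|v Kv j]; rewrite mxE //.
- exact: KD.
- by apply: KM => //; apply/KE; exists c.
- by elim/big_ind: _ => // i _; apply: KM.
Qed.

Lemma lattice_classification d (A : 'M[F]_d) T : (forall i j, K (A i j)) -> A ^+ n = 1 ->
  A ^+ p <> 1 -> is_cocycle n (lattice_data K A T) ->
  crys_torsion_free n (lattice_data K A T) -> KG_indecomposable K A (cd_M (lattice_data K A T)) ->
  exists ty m e t, @crystal (lattice_data K A T) ty m e t.
Proof.
move=> KA An Ap HT tfD [_ indec]; have HM := lattice_submod T KA.
set M := cd_M _ in HM indec *.
have tf v := matmod_tfp Kres iota_inj (A := A) (v := v).
have MN v : M v -> ('X^n - 1 : P) *: (v : matmod iota A) = 0 by move=> _; exact: matmod_XN1.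
have Mdelta (j : 'I_d) : M (delta_mx 0 j).
  by move=> l; rewrite mxE eqxx /=; apply/KE; exists (l == j)%:R; rewrite rmorph_nat.
have fgM : fingen (M : matmod iota A -> Prop).
  exists d, (fun j => delta_mx 0 j); split=> // v Mv.
  have /choice [w Hw] : forall j, exists x, iota x = v 0 j by move=> j; apply/KE.
  exists (fun j => (w j)%:P); rewrite {1}(row_sum_delta v); apply: eq_bigr => j _.
  by rewrite matmodC Hw.
have faith : exists v : matmod iota A, M v /\ ('X^p - 1 : P) *: v <> 0.
  apply: contrapT => Hn; apply: Ap; apply/row_matrixP => j; rewrite rowE row1.
  have : ('X^p - 1 : P) *: (delta_mx 0 j : matmod iota A) = 0.
    by apply: contrapT => E; apply: Hn; exists (delta_mx 0 j).
  by rewrite scalerBl scale1r => /subr0_eq; rewrite matmodXn.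
have Hm := (crys_torsion_freeP Kres iota_inj (D := lattice_data K A T) An HM HT).1 tfD.
have L0m : annih (M : matmod iota A -> Prop) (lamR K0)
    (phi1 *: (phi2 *: (T 1%N : matmod iota A))).
  split; first exact: (norm_tau Kres (D := lattice_data K A T) HM HT).
  by rewrite !scalerA mulrA lam_phi1 Xp1_phi2 matmod_XN1.
have [|ty [m [e [t [R Hp]]]]] := classification Kres tf HM fgM MN faith _ L0m Hm.
  move=> Q1 Q2 HQ1 HQ2 Q1M Q2M MQ Q0; apply: indec; try exact: submod_KG.
  - by move=> v /MQ [u [w [Qu Qw E]]]; exists u, w.
  - exact: Q0.
by exists ty, m, e, t.
Qed.

End Crystal.

Theorem theorem2 (p : nat) (F : fieldType) (K : F -> Prop) :
  prime p ->
  is_Zploc_in p F K \/ is_Zp_in p F K ->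
  (* the groups Crys(C_{p^2}; X_i; T_i) are torsion-free indecomposable *)
  (forall i : nat, (i <= p - 2)%N ->
     crys_torsion_free (p ^ 2) (X_data K p i) /\
     crys_indecomposable K (p ^ 2) (X_data K p i)) /\
  (* the groups Crys(C_{p^2}; U_j; f_j) are torsion-free indecomposable *)
  ((2 < p)%N -> forall j : nat, (1 <= j <= p - 2)%N ->
     crys_torsion_free (p ^ 2) (U_data K p j) /\
     crys_indecomposable K (p ^ 2) (U_data K p j)) /\
  (* every torsion-free indecomposable Crys(C_{p^2}; M; T), M a faithful
     K C_{p^2}-lattice, is isomorphic to one of them *)
  (forall (d : nat) (A : 'M[F]_d) (T : nat -> 'rV[F]_d),
     (forall i j, K (A i j)) ->
     A ^+ (p ^ 2) = 1 ->
     (forall k, (k < p ^ 2)%N -> A ^+ k = 1 -> k = 0%N) ->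
     is_cocycle (p ^ 2) (lattice_data K A T) ->
     crys_torsion_free (p ^ 2) (lattice_data K A T) ->
     crys_indecomposable K (p ^ 2) (lattice_data K A T) ->
     (exists i : nat, (i <= p - 2)%N /\
        crys_iso (p ^ 2) (lattice_data K A T) (X_data K p i)) \/
     ((2 < p)%N /\ exists j : nat, (1 <= j <= p - 2)%N /\
        crys_iso (p ^ 2) (lattice_data K A T) (U_data K p j))) /\
  (* there are exactly 2p - 3 of them: they are pairwise non-isomorphic *)
  (forall i i' : nat, (i <= p - 2)%N -> (i' <= p - 2)%N ->
     crys_iso (p ^ 2) (X_data K p i) (X_data K p i') -> i = i') /\
  ((2 < p)%N -> forall j j' : nat, (1 <= j <= p - 2)%N -> (1 <= j' <= p - 2)%N ->
     crys_iso (p ^ 2) (U_data K p j) (U_data K p j') -> j = j') /\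
  ((2 < p)%N -> forall i j : nat, (i <= p - 2)%N -> (1 <= j <= p - 2)%N ->
     ~ crys_iso (p ^ 2) (X_data K p i) (U_data K p j)).
Proof.
move=> p_pr HK; have ls : local_subring p K.
  by case: HK => HK; [exact: Zploc_local|exact: Zp_local].
have [K0 [iota [red [Kres iota_inj KE]]]] := local_subring_residue p_pr ls.
have p_gt1 := prime_gt1 p_pr.
have modX i : (i <= p - 2)%N -> modelled p iota (X_data K p i) false i.
  by move=> /(crystal_X Kres iota_inj KE) [e [t [/crystal_modelled H _]]].
have modU j : (1 <= j <= p - 2)%N -> modelled p iota (U_data K p j) true j.
  by move=> /(crystal_U Kres iota_inj KE) [e [t [/crystal_modelled H _]]].
split; [|split; [|split; [|split; [|split]]]].
- move=> i /(crystal_X Kres iota_inj KE) [e [t [H _]]].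
  exact: (crystal_ok Kres iota_inj KE H).
- move=> _ j /(crystal_U Kres iota_inj KE) [e [t [H _]]].
  exact: (crystal_ok Kres iota_inj KE H).
- move=> d A T KA An A_faithful HT tfD [indec _].
  have Ap : A ^+ p <> 1.
    have pn : (p < p ^ 2)%N by rewrite -mulnn ltn_Pmull // ltnW.
    by move=> /(A_faithful _ pn) p0; rewrite p0 in p_gt1.
  have [ty [m [e [t [An' HM HT' R Hp]]]]] :=
    lattice_classification Kres iota_inj KE KA An Ap HT tfD indec.
  (* A free [t] gives a group of type [U], and its range [0 < m < p.-1] forces [2 < p]; a cyclotomic
     [t] gives type [X]. *)
  case: ty R Hp => /= R Hp.
    have mp : (1 <= m <= p - 2)%N by move: R; lia.
    right; split; first by move: mp; lia.
    exists m; split=> //.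
    have [e2 [t2 [[An2 HM2 HT2 R2 Hp2] Hp2F]]] := crystal_U Kres iota_inj KE mp.
    exact: (lattice_iso Kres iota_inj KE An2 HM HM2 HT HT2 Hp Hp2 Hp2F).
  have mp : (m <= p - 2)%N by move: R; lia.
  left; exists m; split=> //.
  have [e2 [t2 [[An2 HM2 HT2 R2 Hp2] Hp2F]]] := crystal_X Kres iota_inj KE mp.
  exact: (lattice_iso Kres iota_inj KE An2 HM HM2 HT HT2 Hp Hp2 Hp2F).
(* There are [p - 1] indices [i] and [p - 2] indices [j]; the three statements left make the
   [2p - 3] groups pairwise non-isomorphic. *)
- move=> i i' /modX Hi /modX Hi' I.
  by have [] := modelled_iso_inj Kres iota_inj Hi Hi' I.
- move=> _ j j' /modU Hj /modU Hj' I.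
  by have [] := modelled_iso_inj Kres iota_inj Hj Hj' I.
- move=> _ i j /modX Hi /modU Hj I.
  by have [] := modelled_iso_inj Kres iota_inj Hi Hj I.
Qed.
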